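(* Let $\mathbb F$ be an algebraically closed field of characteristic different from $2$. (a) Every pair $(A,B)$ of matrices over $\mathbb F$ of the same size, in which $A$ is symmetric and $B$ is skew-symmetric, is congruent to a direct sum, determined uniquely up to permutation of summands, of tridiagonal pairs of the following three types ($k,n$ positive integers). In each pair the first matrix $X$ is symmetric and is described by its diagonal and its entries $X_{j,j+1}=X_{j+1,j}$ ($j=1,2,\dots$), and the second matrix $Y$ is skew-symmetric with zero diagonal and is described by its entries $Y_{j,j+1}=-Y_{j+1,j}$ ($j=1,2,\dots$). (i) Size $2k$: $X$ has zero diagonal and $X_{j,j+1}=1$ for all $j$; $Y_{j,j+1}=\lambda$ for all $j$; here $\lambda\in\mathbb F$, $\lambda\neq0$, and $\lambda$ is determined up to replacement by $-\lambda$. (ii) Size $n$: $X$ has diagonal $(\varepsilon,0,\dots,0)$ and the entries $X_{j,j+1}$ form the sequence $0,1,0,1,\dots$; the entries $Y_{j,j+1}$ form the sequence $1,0,1,0,\dots$; here $\varepsilon=1$ if $n$ is a multiple of $4$, and $\varepsilon\in\{0,1\}$ otherwise. (iii) Size $4k$: $X$ has zero diagonal and the entries $X_{j,j+1}$ form the sequence $1,0,1,0,\dots$; the entries $Y_{j,j+1}$ form the sequence $0,1,0,1,\dots$. (b) This direct sum is determined uniquely up to permutation of summands by the Kronecker canonical form of $(A,B)$ under equivalence. The Kronecker canonical form of each of the direct summands is as follows: - type (i): $(I_k,J_k(\lambda))\oplus(I_k,J_k(-\lambda))$ with $\lambda\ne0$; - type (ii) with $\varepsilon=0$: $(F_k,G_k)\oplus(F_k^T,G_k^T)$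 if $n=2k+1$, and $(J_k(0),I_k)\oplus(J_k(0),I_k)$ if $n=2k$ ($k$ is odd); - type (ii) with $\varepsilon=1$: $(I_n,J_n(0))$ if $n$ is odd, and $(J_n(0),I_n)$ if $n$ is even; - type (iii): $(I_{2k},J_{2k}(0))\oplus(I_{2k},J_{2k}(0))$.
   Context: Matrix pairs $(A,B)$ and $(A',B')$ of square matrices are congruent if there is a nonsingular $S$ with $S^TAS=A'$ and $S^TBS=B'$. Matrix pairs $(A,B)$ and $(A',B')$ are equivalent if there are nonsingular $R,S$ with $RAS=A'$ and $RBS=B'$. Direct sums of pairs are taken componentwise: $(A,B)\oplus(A',B')=(A\oplus A',B\oplus B')$. $I_n$ is the $n\times n$ identity matrix and $J_n(\lambda)$ is the $n\times n$ upper triangular Jordan block with eigenvalue $\lambda$ (ones on the superdiagonal). For $n\ge 0$, $F_n$ and $G_n$ are the $n\times(n+1)$ matrices $F_n=[\,I_n\ |\ 0\,]$ (identity followed by a zero column) and $G_n=[\,0\ |\ I_n\,]$ (zero column followed by the identity); $F_0=G_0$ is the $0\times 1$ matrix (taking a direct sum with it adjoins a zero column; with its transpose, a zero row). Kronecker's theorem: each pair of matrices of the same size is equivalent to a direct sum, determined uniquely up to permutation of summands, of pairs of the form $(I_n,J_n(\lambda))$, $(J_n(0),I_n)$, $(F_n,G_n)$, $(F_n^T,G_n^T)$; this direct sum is the Kronecker canonical form of the pair. *)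

(* Defs.v *)
From HB Require Import structures.
From mathcomp Require Import all_boot all_order all_algebra.

Set Implicit Arguments.
Unset Strict Implicit.
Unset Printing Implicit Defensive.

Import GRing.Theory.
Local Open Scope ring_scope.

(* Sizes are packed with the matrices, so that pairs of different sizes can be
   listed and compared. *)
Record mxpair (F : Type) := MxPair {
  mxpair_rows : nat;
  mxpair_cols : nat;
  mxpair_fst : 'M[F]_(mxpair_rows, mxpair_cols);
  mxpair_snd : 'M[F]_(mxpair_rows, mxpair_cols) }.

Section MatrixPairs.
Variable F : fieldType.
Implicit Types p q : mxpair F.

Definition mxpair0 : mxpair F := @MxPair F 0 0 0 0.

Definition mxpair_add p q : mxpair F :=
  MxPair (block_mx (mxpair_fst p) 0 0 (mxpair_fst q))
         (block_mx (mxpair_snd p) 0 0 (mxpair_snd q)).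

Definition mxpair_sum (s : seq (mxpair F)) : mxpair F :=
  foldr mxpair_add mxpair0 s.

(* Since the sizes are part of a pair, related pairs have equal sizes; the
   inductive presentation avoids casts along these equalities. *)
Inductive congruent : mxpair F -> mxpair F -> Prop :=
  Congruent n (A B S : 'M[F]_n) of S \in unitmx :
    congruent (MxPair A B) (MxPair (S^T *m A *m S) (S^T *m B *m S)).

Inductive equivalent : mxpair F -> mxpair F -> Prop :=
  Equivalent m n (A B : 'M[F]_(m, n)) (R : 'M[F]_m) (S : 'M[F]_n)
      of R \in unitmx & S \in unitmx :
    equivalent (MxPair A B) (MxPair (R *m A *m S) (R *m B *m S)).

Definition jordan_block n (l : F) : 'M[F]_n :=
  \matrix_(i, j) (l *+ (i == j) + 1 *+ (i.+1 == j :> nat)).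

Definition kronF n : 'M[F]_(n, n.+1) := \matrix_(i, j) (j == i :> nat)%:R.

Definition kronG n : 'M[F]_(n, n.+1) := \matrix_(i, j) (j == i.+1 :> nat)%:R.

(* Entries are indexed from 0: a i sits at positions (i, i.+1) and (i.+1, i),
   so it is the entry with index j = i.+1 in 1-based numbering. *)
Definition sym_tridiag n (d a : nat -> F) : 'M[F]_n :=
  \matrix_(i, j) (d i *+ (i == j) + a i *+ (i.+1 == j :> nat)
                  + a j *+ (j.+1 == i :> nat)).

Definition skew_tridiag n (b : nat -> F) : 'M[F]_n :=
  \matrix_(i, j) (b i *+ (i.+1 == j :> nat) - b j *+ (j.+1 == i :> nat)).

End MatrixPairs.

(* KronFinite n l ~ (I_n, J_n(l)), KronInfinite n ~ (J_n(0), I_n),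
   KronWide n ~ (F_n, G_n), KronTall n ~ (F_n^T, G_n^T). *)
Inductive kron_block (F : Type) :=
  | KronFinite of nat & F
  | KronInfinite of nat
  | KronWide of nat
  | KronTall of nat.

Arguments KronInfinite {F} _.
Arguments KronWide {F} _.
Arguments KronTall {F} _.

(* The boolean parameter of TypeII tells whether epsilon is 1. *)
Inductive summand (F : Type) :=
  | TypeI of nat & F
  | TypeII of nat & bool
  | TypeIII of nat.

Arguments TypeII {F} _ _.
Arguments TypeIII {F} _.

Section DecidableEquality.
Variable F : Type.

Definition kron_block_encode (b : kron_block F) :
    (nat * F) + nat + (nat + nat) :=
  match b with
  | KronFinite n l => inl (inl (n, l))
  | KronInfinite n => inl (inr n)
  | KronWide n => inr (inl n)
  | KronTall n => inr (inr n)
  end.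

Definition kron_block_decode (x : (nat * F) + nat + (nat + nat)) :
    kron_block F :=
  match x with
  | inl (inl (n, l)) => KronFinite n l
  | inl (inr n) => KronInfinite n
  | inr (inl n) => KronWide n
  | inr (inr n) => KronTall n
  end.

Lemma kron_block_encodeK : cancel kron_block_encode kron_block_decode.
Proof. by case. Qed.

Definition summand_encode (t : summand F) : (nat * F) + (nat * bool) + nat :=
  match t with
  | TypeI k l => inl (inl (k, l))
  | TypeII n e => inl (inr (n, e))
  | TypeIII k => inr k
  end.

Definition summand_decode (x : (nat * F) + (nat * bool) + nat) : summand F :=
  match x with
  | inl (inl (k, l)) => TypeI k l
  | inl (inr (n, e)) => TypeII n e
  | inr k => TypeIII k
  end.

Lemma summand_encodeK : cancel summand_encode summand_decode.
Proof. by case. Qed.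

End DecidableEquality.

HB.instance Definition _ (F : eqType) :=
  Equality.copy (kron_block F) (can_type (@kron_block_encodeK F)).

HB.instance Definition _ (F : eqType) :=
  Equality.copy (summand F) (can_type (@summand_encodeK F)).

Section CanonicalForms.
Variable F : fieldType.
Implicit Types (b : kron_block F) (t : summand F).

Definition kron_valid b : bool :=
  match b with
  | KronFinite n _ => (0 < n)%N
  | KronInfinite n => (0 < n)%N
  | KronWide _ => true
  | KronTall _ => true
  end.

Definition kron_pair b : mxpair F :=
  match b with
  | KronFinite n l => @MxPair F n n 1%:M (jordan_block n l)
  | KronInfinite n => @MxPair F n n (jordan_block n 0) 1%:M
  | KronWide n => MxPair (kronF F n) (kronG F n)
  | KronTall n => MxPair (kronF F n)^T (kronG F n)^T
  end.

Definition is_kronecker_form (p : mxpair F) (bs : seq (kron_block F)) : Prop :=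
  all kron_valid bs /\ equivalent p (mxpair_sum [seq kron_pair b | b <- bs]).

Definition summand_valid t : bool :=
  match t with
  | TypeI k l => (0 < k)%N && (l != 0)
  | TypeII n e => (0 < n)%N && ((4 %| n)%N ==> e)
  | TypeIII k => (0 < k)%N
  end.

Definition summand_pair t : mxpair F :=
  match t with
  | TypeI k l =>
      MxPair (sym_tridiag (2 * k) (fun=> 0) (fun=> 1))
             (skew_tridiag (2 * k) (fun=> l))
  | TypeII n e =>
      MxPair (sym_tridiag n (fun i => (e && (i == 0%N))%:R)
                            (fun i => (odd i)%:R))
             (skew_tridiag n (fun i => (~~ odd i)%:R))
  | TypeIII k =>
      MxPair (sym_tridiag (4 * k) (fun=> 0) (fun i => (~~ odd i)%:R))
             (skew_tridiag (4 * k) (fun i => (odd i)%:R))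
  end.

Definition is_congruence_form (p : mxpair F) (ts : seq (summand F)) : Prop :=
  all summand_valid ts /\ congruent p (mxpair_sum [seq summand_pair t | t <- ts]).

(* Equality of parameters, with l in TypeI taken up to sign. *)
Definition same_summand t t' : bool :=
  match t, t' with
  | TypeI k l, TypeI k' l' => (k == k') && ((l' == l) || (l' == - l))
  | _, _ => t == t'
  end.

Definition same_summands (ts ts' : seq (summand F)) : Prop :=
  exists2 us, perm_eq ts us & all2 same_summand us ts'.

End CanonicalForms.

(* Main.v *)
(** Uniqueness.  For matrices P, Q the dimension of the space of solutions X of
    P X A + Q X B = 0 is additive in (A, B) and invariant under equivalence.
    For suitable P, Q it is the space of Jordan chains of a given length at an
    eigenvalue (possibly infinite), or the space of polynomial null vectors of
    a given degree; second differences in the length count the Kronecker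
    blocks, and these counts determine the summands.

    Existence, by induction on the size.  Let P be one of A, B and Q the
    other, P singular with kernel K.  A kernel vector of P on which Q does not
    vanish identically as a form on K, or which Q also kills, splits off.
    Otherwise K is Q-isotropic and injects into the dual space, and the pair is
    (K + dual of K) plus a pair (P', Q') on the Q-complement, to which the
    induction applies.  After adapting bases, P pairs the kernel of P' with
    part of the dual of K, which prolongs each summand of (P', Q') by two
    vectors at every end lying in the kernel of P'; in the list of the theorem
    the prolonged summand is again a summand.  If A and B are both nonsingular,
    a maximal Jordan chain of B A^-1 at l and a chain at -l paired with it
    under A span an orthogonal summand of type (i). *)
Require Import Defs.
From HB Require Import structures.
From mathcomp Require Import all_boot all_order all_algebra.
From mathcomp Require Import perm zify.

Set Implicit Arguments.
Unset Strict Implicit.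
Unset Printing Implicit Defensive.

Import GRing.Theory.
Local Open Scope ring_scope.

(** * Congruence and equivalence of matrix pairs *)

(** The exception for sizes divisible by 4 shapes the list. For even k, two blocks (J_k(0), I_k)
    already come from two summands of type (ii) of size k with epsilon = 1, so size 2k with epsilon
    = 0 is kept only for odd k. Parity then separates all blocks at 0 and at infinity. Prolongation
    respects this: one end is added alone only if n is odd or epsilon = 1, and two ends add 4 to the
    size. Both singular cases are one argument about P^T = [eps] P, Q^T = - [eps] Q with [eps]^2 =
    1, the list being hidden in a predicate [T]. Only one summand of (P', Q') is prolonged at a
    time; for the rest of P' any dual basis of its kernel will do. Invertibility of 2 is used to
    clear Gram matrices symmetrically, to find a vector on which a nonzero symmetric form does not
    vanish, and to separate l from -l. Algebraic closedness gives an eigenvalue and the square roots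
    that scale such a vector. The matrices of types (ii) and (iii) have entries 0, 1, -1, so their
    base changes are signed permutations and the identities to check become Boolean arithmetic on
    indices. *)

Section Pairs.
Variable F : fieldType.
Implicit Types p q r : mxpair F.

(** The matrices are dependent on the sizes, so [injection] yields equalities of dependent pairs;
    decidable equality on the sizes makes them plain equalities. *)
Lemma MxPair_inj m n (A B A' B' : 'M[F]_(m, n)) :
  MxPair A B = MxPair A' B' -> A = A' /\ B = B'.
Proof.
move=> e; injection e => eB eA; split.
  exact: eq_from_Tagged (eq_from_Tagged eA).
exact: eq_from_Tagged (eq_from_Tagged eB).
Qed.

Lemma congruent_inv n (A B : 'M[F]_n) q : congruent (MxPair A B) q ->
  exists2 S : 'M_n, S \in unitmx & q = MxPair (S^T *m A *m S) (S^T *m B *m S).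
Proof.
move Ep: (MxPair A B) => p c; case: c Ep => n1 A1 B1 S uS Ep.
have e : n = n1 by have := congr1 (@mxpair_rows F) Ep.
by subst n1; have [-> ->] := MxPair_inj Ep; exists S.
Qed.

Lemma equivalent_inv m n (A B : 'M[F]_(m, n)) q : equivalent (MxPair A B) q ->
  exists2 RS : 'M_m * 'M_n, RS.1 \in unitmx /\ RS.2 \in unitmx &
    q = MxPair (RS.1 *m A *m RS.2) (RS.1 *m B *m RS.2).
Proof.
move Ep: (MxPair A B) => p c; case: c Ep => m1 n1 A1 B1 R S uR uS Ep.
have e : m = m1 by have := congr1 (@mxpair_rows F) Ep.
have e' : n = n1 by have := congr1 (@mxpair_cols F) Ep.
by subst m1 n1; have [-> ->] := MxPair_inj Ep; exists (R, S).
Qed.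

Lemma congruent_refl n (A B : 'M[F]_n) : congruent (MxPair A B) (MxPair A B).
Proof.
have := Congruent A B (unitmx1 F n).
by rewrite trmx1 !mul1mx !mulmx1.
Qed.

Lemma congruent_sym p q : congruent p q -> congruent q p.
Proof.
case=> n A B S uS.
have := Congruent (S^T *m A *m S) (S^T *m B *m S) (_ : invmx S \in unitmx).
rewrite unitmx_inv => /(_ uS).
have H (C : 'M[F]_n) : (invmx S)^T *m (S^T *m C *m S) *m invmx S = C.
  by rewrite -!mulmxA mulmxV // mulmx1 mulmxA -trmx_mul mulmxV // trmx1 mul1mx.
by rewrite !H.
Qed.

Lemma congruent_trans q p r : congruent p q -> congruent q r -> congruent p r.
Proof.
case=> n A B S uS /congruent_inv [T uT ->].
have H (C : 'M[F]_n) : T^T *m (S^T *m C *m S) *m T = (S *m T)^T *m C *m (S *m T).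
  by rewrite trmx_mul !mulmxA.
by rewrite !H; apply: Congruent; rewrite unitmx_mul uS.
Qed.

Lemma equivalent_refl p : equivalent p p.
Proof.
case: p => m n A B.
have := Equivalent A B (unitmx1 F m) (unitmx1 F n).
by rewrite !mul1mx !mulmx1.
Qed.

Lemma equivalent_trans q p r :
  equivalent p q -> equivalent q r -> equivalent p r.
Proof.
case=> m n A B R S uR uS /equivalent_inv [[R' S'] /= [uR' uS'] ->].
have H (C : 'M[F]_(m, n)) :
    R' *m (R *m C *m S) *m S' = (R' *m R) *m C *m (S *m S').
  by rewrite !mulmxA.
by rewrite !H; apply: Equivalent; rewrite unitmx_mul ?uR' ?uS.
Qed.

Lemma congruent_equivalent p q : congruent p q -> equivalent p q.
Proof. by case=> n A B S uS; apply: Equivalent; rewrite ?unitmx_tr. Qed.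

Lemma equivalent_add p p' q q' : equivalent p p' -> equivalent q q' ->
  equivalent (mxpair_add p q) (mxpair_add p' q').
Proof.
case=> m n A B R S uR uS [m' n' A' B' R' S' uR' uS'].
pose RR := block_mx R 0 0 R'; pose SS := block_mx S 0 0 S'.
have := @Equivalent _ _ _ (block_mx A 0 0 A') (block_mx B 0 0 B') RR SS.
rewrite /mxpair_add /= !mulmx_block !(mul0mx, mulmx0, addr0, add0r).
by apply; rewrite !unitmxE det_ublock unitrM -!unitmxE ?uR ?uS.
Qed.

Lemma congruent_add p p' q q' : congruent p p' -> congruent q q' ->
  congruent (mxpair_add p q) (mxpair_add p' q').
Proof.
case=> n A B S uS [n' A' B' S' uS'].
pose SS := block_mx S 0 0 S'.
have := @Congruent _ _ (block_mx A 0 0 A') (block_mx B 0 0 B') SS.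
rewrite tr_block_mx !trmx0.
rewrite /mxpair_add /= !mulmx_block !(mul0mx, mulmx0, addr0, add0r).
by apply; rewrite !unitmxE det_ublock unitrM -!unitmxE uS.
Qed.

(** The rows of [U] are the new basis and the new matrices are Gram matrices. As [n'] and [n] are
    only propositionally equal, families of vectors whose number is a sum can be used without
    casts. *)
Lemma congruent_frame n n' (A B : 'M[F]_n) (A' B' : 'M[F]_n') (U : 'M_(n', n)) :
  n' = n -> row_full U -> A' = U *m A *m U^T -> B' = U *m B *m U^T ->
  congruent (MxPair A B) (MxPair A' B').
Proof.
move=> e; subst n'; rewrite row_full_unit => uU -> ->.
have := @Congruent _ _ A B U^T; rewrite trmxK; apply.
by rewrite unitmx_tr.
Qed.

Lemma congruent_frameP n n' (A B : 'M[F]_n) (A' B' : 'M[F]_n') :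
  congruent (MxPair A B) (MxPair A' B') ->
  n' = n /\ exists U : 'M_(n', n),
   [/\ row_full U, A' = U *m A *m U^T & B' = U *m B *m U^T].
Proof.
move/congruent_inv => [S uS Ep].
have e : n' = n by have := congr1 (@mxpair_rows F) Ep.
subst n'; split=> //; exists S^T; rewrite row_full_unit unitmx_tr trmxK.
by have [-> ->] := MxPair_inj Ep.
Qed.

Lemma congruent_split n w u (A B : 'M[F]_n) (W : 'M_(w, n)) (U : 'M_(u, n)) :
  (w + u)%N = n -> (1%:M <= W + U)%MS ->
  W *m A *m U^T = 0 -> U *m A *m W^T = 0 ->
  W *m B *m U^T = 0 -> U *m B *m W^T = 0 ->
  congruent (MxPair A B)
    (mxpair_add (MxPair (W *m A *m W^T) (W *m B *m W^T))
                (MxPair (U *m A *m U^T) (U *m B *m U^T))).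
Proof.
move=> e full A1 A2 B1 B2; apply: (congruent_frame (U := col_mx W U)) => //=.
- by rewrite -sub1mx addsmxE in full *.
- by rewrite mul_col_mx tr_col_mx mul_col_row A1 A2.
- by rewrite mul_col_mx tr_col_mx mul_col_row B1 B2.
Qed.

Lemma congruent_splitP n w u (A B : 'M[F]_n) (A1 B1 : 'M_w) (A2 B2 : 'M_u) :
  congruent (MxPair A B) (mxpair_add (MxPair A1 B1) (MxPair A2 B2)) ->
  (w + u)%N = n /\ exists WU : 'M_(w, n) * 'M_(u, n), let: (W, U) := WU in
  [/\ (1%:M <= W + U)%MS,
   [/\ W *m A *m W^T = A1, W *m A *m U^T = 0, U *m A *m W^T = 0 &
       U *m A *m U^T = A2] &
   [/\ W *m B *m W^T = B1, W *m B *m U^T = 0, U *m B *m W^T = 0 &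
       U *m B *m U^T = B2]].
Proof.
case/congruent_frameP=> e [U []]; rewrite -(vsubmxK U).
move: (usubmx U) (dsubmx U) => W {}U full.
rewrite (mul_col_mx _ _ A) (mul_col_mx _ _ B) tr_col_mx !mul_col_row.
move=> /eq_block_mx [a1 a2 a3 a4] /eq_block_mx [b1 b2 b3 b4].
by split=> //; exists (W, U); split; rewrite // addsmxE sub1mx.
Qed.

Lemma signed_perm n (s : nat -> nat) (c : nat -> F) :
  (forall i, (i < n)%N -> (s i < n)%N) ->
  (forall i j, (i < n)%N -> (j < n)%N -> s i = s j -> i = j) ->
  (forall i, c i != 0) ->
  exists2 U : 'M[F]_n, U \in unitmx &
    forall i j : 'I_n, U i j = c i * (j == s i :> nat)%:R.
Proof.
move=> sn injs c0.
pose s' (i : 'I_n) := Ordinal (sn i (ltn_ord i)).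
have injs' : injective s'.
  by move=> i j /(congr1 val) /= /injs => /(_ (ltn_ord i) (ltn_ord j)) /val_inj.
exists (diag_mx (\row_i c (val i)) *m perm_mx (perm injs')).
  rewrite unitmx_mul unitmx_perm andbT unitmxE det_diag unitfE.
  by apply/prodf_neq0 => i _; rewrite mxE.
move=> i j; rewrite mul_diag_mx !mxE permE; congr (_ * _%:R).
by rewrite eq_sym.
Qed.

Lemma signed_permE (n m p q : nat) (s t : nat -> nat) (c d : nat -> F)
    (U : 'M_(m, n)) (V : 'M_(q, p)) (M : 'M_(n, p)) (f : nat -> nat -> F) :
  (forall i, (i < m)%N -> (s i < n)%N) ->
  (forall i, (i < q)%N -> (t i < p)%N) ->
  (forall (i : 'I_m) (j : 'I_n), U i j = c i * (j == s i :> nat)%:R) ->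
  (forall (i : 'I_q) (j : 'I_p), V i j = d i * (j == t i :> nat)%:R) ->
  (forall i j, M i j = f i j) ->
  forall i j, (U *m M *m V^T) i j = c i * d j * f (s i) (t j).
Proof.
move=> sn tn eU eV eM i j.
rewrite mxE (bigD1 (Ordinal (tn _ (ltn_ord j)))) //= big1 ?addr0; last first.
  by move=> k ne; rewrite [V^T _ _]mxE eV -val_eqE /= in ne *; rewrite (negPf ne) !mulr0.
rewrite mxE (bigD1 (Ordinal (sn _ (ltn_ord i)))) //= big1 ?addr0; last first.
  by move=> k ne; rewrite eU -val_eqE /= in ne *; rewrite (negPf ne) mulr0 mul0r.
by rewrite [V^T _ _]mxE eU eV eM /= !eqxx !mulr1 mulrAC.
Qed.

(* Signed permutations in natural-number indices, with the sizes only
   propositionally equal. *)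
Lemma congruent_nat n n' (A B : 'M[F]_n) (A' B' : 'M[F]_n')
    (fA fB : nat -> nat -> F) (s : nat -> nat) (c : nat -> F) :
  n' = n -> (forall i, (i < n)%N -> (s i < n)%N) ->
  (forall i j, (i < n)%N -> (j < n)%N -> s i = s j -> i = j) ->
  (forall i, c i != 0) ->
  (forall i j : 'I_n, A i j = fA i j) -> (forall i j : 'I_n, B i j = fB i j) ->
  (forall i j : 'I_n', A' i j = c i * c j * fA (s i) (s j)) ->
  (forall i j : 'I_n', B' i j = c i * c j * fB (s i) (s j)) ->
  congruent (MxPair A B) (MxPair A' B').
Proof.
move=> e; subst n' => sn injs c0 eA eB eA' eB'.
have [U uU eU] := signed_perm sn injs c0.
apply: (congruent_frame (U := U)); rewrite ?row_full_unit //.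
  by apply/matrixP=> i j; rewrite eA' (signed_permE sn sn eU eU eA).
by apply/matrixP=> i j; rewrite eB' (signed_permE sn sn eU eU eB).
Qed.

Lemma equivalent_nat m n m' n' (A B : 'M[F]_(m, n)) (A' B' : 'M[F]_(m', n'))
    (fA fB : nat -> nat -> F) (s t : nat -> nat) (c d : nat -> F) :
  m' = m -> n' = n ->
  (forall i, (i < m)%N -> (s i < m)%N) ->
  (forall i j, (i < m)%N -> (j < m)%N -> s i = s j -> i = j) ->
  (forall i, (i < n)%N -> (t i < n)%N) ->
  (forall i j, (i < n)%N -> (j < n)%N -> t i = t j -> i = j) ->
  (forall i, c i != 0) -> (forall i, d i != 0) ->
  (forall i j, A i j = fA i j) -> (forall i j, B i j = fB i j) ->
  (forall i j, A' i j = c i * d j * fA (s i) (t j)) ->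
  (forall i j, B' i j = c i * d j * fB (s i) (t j)) ->
  equivalent (MxPair A B) (MxPair A' B').
Proof.
move=> e e'; subst m' n' => sn injs tn injt c0 d0 eA eB eA' eB'.
have [U uU eU] := signed_perm sn injs c0.
have [V uV eV] := signed_perm tn injt d0.
have -> : A' = U *m A *m V^T.
  by apply/matrixP=> i j; rewrite eA' (signed_permE sn tn eU eV eA).
have -> : B' = U *m B *m V^T.
  by apply/matrixP=> i j; rewrite eB' (signed_permE sn tn eU eV eB).
by apply: Equivalent; rewrite ?unitmx_tr.
Qed.

Definition block_fun (m1 n1 : nat) (f11 f12 f21 f22 : nat -> nat -> F) i j :=
  if (i < m1)%N then if (j < n1)%N then f11 i j else f12 i (j - n1)%N
  else if (j < n1)%N then f21 (i - m1)%N j else f22 (i - m1)%N (j - n1)%N.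

Lemma block_mx_fun m1 m2 n1 n2 (A11 : 'M[F]_(m1, n1)) (A12 : 'M_(m1, n2))
    (A21 : 'M_(m2, n1)) (A22 : 'M_(m2, n2)) (f11 f12 f21 f22 : nat -> nat -> F) :
  (forall i j, A11 i j = f11 i j) -> (forall i j, A12 i j = f12 i j) ->
  (forall i j, A21 i j = f21 i j) -> (forall i j, A22 i j = f22 i j) ->
  forall i j, block_mx A11 A12 A21 A22 i j = block_fun m1 n1 f11 f12 f21 f22 i j.
Proof.
move=> e11 e12 e21 e22 i j.
rewrite -[i]splitK -[j]splitK /block_fun.
case: (split i) => i'; case: (split j) => j' /=.
- by rewrite block_mxEul !ltn_ord.
- by rewrite block_mxEur ltn_ord ltnNge leq_addr addKn.
- by rewrite block_mxEdl ltn_ord ltnNge leq_addr addKn.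
- by rewrite block_mxEdr !ltnNge !leq_addr !addKn.
Qed.

Lemma congruent_addCA (n1 n2 : nat) (A1 B1 : 'M[F]_n1) (A2 B2 : 'M_n2)
    n3 (A3 B3 : 'M_n3) :
  congruent
    (mxpair_add (MxPair A1 B1) (mxpair_add (MxPair A2 B2) (MxPair A3 B3)))
    (mxpair_add (MxPair A2 B2) (mxpair_add (MxPair A1 B1) (MxPair A3 B3))).
Proof.
(* Exchange of the first two blocks of coordinates. It is typed as rectangular because the two sums
   of sizes are not convertible. *)
pose U : 'M[F]_(n2 + (n1 + n3), n1 + (n2 + n3)) :=
  block_mx 0 (row_mx 1%:M 0) (col_mx 1%:M 0) (block_mx 0 0 0 1%:M).
have eU : U^T = block_mx 0 (row_mx 1%:M 0) (col_mx 1%:M 0) (block_mx 0 0 0 1%:M).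
  by rewrite /U !(tr_block_mx, tr_row_mx, tr_col_mx, trmx0, trmx1).
have H (C1 : 'M[F]_n1) (C2 : 'M_n2) (C3 : 'M_n3) :
    block_mx C2 0 0 (block_mx C1 0 0 C3) =
    U *m block_mx C1 0 0 (block_mx C2 0 0 C3) *m U^T.
  rewrite eU /U /= 2!mulmx_block.
  rewrite !(mul_row_block, mul_block_col, mul_row_col, mul_col_row, mulmx_block,
    mul0mx, mulmx0, mul1mx, mulmx1, addr0, add0r).
  rewrite !(mul_row_block, mul_block_col, mul_row_col, mul_mx_row, mul_col_mx,
    mul0mx, mulmx0, mul1mx, mulmx1, addr0, add0r, row_mx0, col_mx0).
  have -> : row_mx (col_mx C1 0) 0 = block_mx C1 0 0 0 :> 'M[F]_(n1 + n3).
    by rewrite block_mxEh col_mx0.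
  have -> : col_mx 0 (row_mx 0 C3) = block_mx 0 0 0 C3 :> 'M[F]_(n1 + n3).
    by rewrite block_mxEv row_mx0.
  by rewrite add_block_mx !(addr0, add0r).
apply: (congruent_frame (U := U)).
- by rewrite addnCA.
- apply/row_fullP; exists U^T; rewrite eU /U mulmx_block.
  rewrite !(mul_row_block, mul_block_col, mul_row_col, mul_col_row, mulmx_block,
    mul0mx, mulmx0, mul1mx, mulmx1, addr0, add0r) row_mx0 col_mx0.
  have -> : col_mx 0 (row_mx 0 1%:M) = block_mx 0 0 0 1%:M :> 'M[F]_(n2 + n3).
    by rewrite block_mxEv row_mx0.
  by rewrite add_block_mx !(addr0, add0r) -!scalar_mx_block.
- exact: H.
- exact: H.
Qed.

(** [congruent] relates only pairs typed with a single size, so even reflexivity has to be asked for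
    pairs of this shape. *)
Definition square p := exists n (A B : 'M[F]_n), p = MxPair A B.

Lemma square_add p q : square p -> square q -> square (mxpair_add p q).
Proof.
move=> [n [A [B ->]]] [m [C [D ->]]].
by exists (n + m)%N, (block_mx A 0 0 C), (block_mx B 0 0 D).
Qed.

Lemma square_sum (T : Type) (f : T -> mxpair F) (s : seq T) :
  (forall t, square (f t)) -> square (mxpair_sum (map f s)).
Proof.
move=> sq; elim: s => [|t s IHs] /=; last exact: square_add.
by exists 0%N, 0, 0.
Qed.

Lemma square_refl p : square p -> congruent p p.
Proof. by case=> n [A [B ->]]; apply: congruent_refl. Qed.

Lemma square_addCA p q r : square p -> square q -> square r ->
  congruent (mxpair_add p (mxpair_add q r)) (mxpair_add q (mxpair_add p r)).
Proof.
by case=> n [A [B ->]] [m [C [D ->]]] [l [G [H ->]]]; apply: congruent_addCA.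
Qed.

Lemma congruent_sum_rem (T : eqType) (f : T -> mxpair F) t (s : seq T) :
  (forall t, square (f t)) -> t \in s ->
  congruent (mxpair_sum (map f s)) (mxpair_sum (map f (t :: rem t s))).
Proof.
move=> sq; elim: s => //= a s IHs; rewrite inE eq_sym.
have [-> _|_ /= /IHs {}IHs] := eqVneq a t.
  by apply: square_refl; apply: square_add; last exact: square_sum.
apply: congruent_trans (congruent_add (square_refl (sq a)) IHs) _.
by apply: square_addCA; last exact: square_sum.
Qed.

Lemma congruent_sum_perm (T : eqType) (f : T -> mxpair F) (s1 s2 : seq T) :
  (forall t, square (f t)) -> perm_eq s1 s2 ->
  congruent (mxpair_sum (map f s1)) (mxpair_sum (map f s2)).
Proof.
move=> sq; elim: s1 s2 => [|t s1 IHs] s2 eq12.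
  move: eq12; rewrite perm_sym => /perm_nilP ->.
  by apply: square_refl; apply: square_sum.
have ts2 : t \in s2 by rewrite -(perm_mem eq12) mem_head.
apply: congruent_trans (congruent_sym (congruent_sum_rem sq ts2)) => /=.
apply: congruent_add; first exact: square_refl.
apply: IHs; rewrite -(perm_cons t); apply: perm_trans eq12 _.
exact: perm_to_rem.
Qed.

End Pairs.

(** * Kronecker forms of the types II and III *)

Definition blockb (m n : nat) (a a' : nat -> nat -> bool) i j :=
  ((i < m) && (j < n) && a i j ||
   (m <= i) && (n <= j) && a' (i - m) (j - n))%N.

(* [flip o a b] : the positive part of the entry with positive part [a] and
   negative part [b] after multiplication by (-1) ^+ o. *)
Definition flip (o a b : bool) := a && ~~ o || b && o.

(** [o] is the parity of the 0-based indices i that carry an entry at (i, i+1). *)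
Definition upperb (o : bool) i j := (i.+1 == j) && (odd i == o).
Definition symb (o e : bool) i j :=
  [|| upperb o i j, upperb o j i | [&& e, i == 0%N & j == 0%N]].
Definition noneb (i j : nat) := false.

(* Decides, or splits on, one arithmetic condition; running lia on the whole
   boolean identity is far too slow. *)
Ltac decide_atom :=
  match goal with
  | |- context [leq ?a ?b] =>
    first [rewrite (_ : leq a b = true); [|lia]
          |rewrite (_ : leq a b = false); [|lia] | case: (leqP a b) => ?]
  | |- context [@eq_op nat ?a ?b] =>
    first [rewrite (_ : @eq_op nat a b = true); [|lia]
          |rewrite (_ : @eq_op nat a b = false); [|lia] | case: (eqVneq a b) => ?]
  | |- context [@eq_op _ ?a ?b] =>
    first [rewrite (_ : eq_op a b = true); [|lia]
          |rewrite (_ : eq_op a b = false); [|lia] | case: (eqVneq a b) => ?]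
  | |- context [odd ?a] =>
    first [rewrite (_ : odd a = true); [|lia]
          |rewrite (_ : odd a = false); [|lia] | case: (boolP (odd a)) => ?]
  end; rewrite /= ?andbF ?orbF ?andbT ?orbT.

Ltac bool_lia :=
  rewrite /flip /blockb /symb /upperb /noneb; rewrite /= ?andbF ?orbF ?andbT ?orbT;
  repeat decide_atom; first [by [] | lia].

Section Signs.
Variable F : fieldType.

(* The entries are 0, 1 or -1: [a] and [b] tell where 1 and -1 sit. *)
Definition sign_matrix m n (A : 'M[F]_(m, n)) (a b : nat -> nat -> bool) :=
  forall i j, A i j = (a i j)%:R - (b i j)%:R.

Lemma sign_matrix_block m n m' n' (A : 'M[F]_(m, n)) (D : 'M[F]_(m', n'))
    a b a' b' : sign_matrix A a b -> sign_matrix D a' b' ->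
  sign_matrix (block_mx A 0 0 D) (blockb m n a a') (blockb m n b b').
Proof.
move=> eA eD i j; rewrite -[i]splitK -[j]splitK /blockb.
case: (split i) => i'; case: (split j) => j' /=.
- by rewrite block_mxEul eA !ltn_ord (leqNgt m i') ltn_ord /= !orbF.
- rewrite block_mxEur mxE (leqNgt m i') (ltnNge (n + j')) leq_addr ltn_ord /=.
  by rewrite subrr.
- rewrite block_mxEdl mxE (leqNgt n j') (ltnNge (m + i')) leq_addr ltn_ord /=.
  by rewrite ?andbF subrr.
- by rewrite block_mxEdr eD !(ltnNge (_ + _)) !leq_addr !addKn.
Qed.

Lemma sign_matrix0 m n : sign_matrix (0 : 'M_(m, n)) (fun _ _ => false)
  (fun _ _ => false).
Proof. by move=> i j; rewrite mxE subrr. Qed.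

Lemma flipE (o : nat) (a b : bool) :
  (-1) ^+ o * (a%:R - b%:R) =
  (flip (odd o) a b)%:R - (flip (odd o) b a)%:R :> F.
Proof.
rewrite -signr_odd /flip; case: (odd o) => /=.
  by rewrite !andbF !andbT mulN1r opprB.
by rewrite !andbT !andbF !orbF mul1r.
Qed.

(** [s] tells which old basis vector becomes the i-th new one, the parity of [c i] its sign. What
    remains is a Boolean identity for each pair of indices, within reach of [bool_lia]. *)
Lemma congruent_sign n n' (A B : 'M[F]_n) (A' B' : 'M[F]_n')
    a1 a2 b1 b2 a1' a2' b1' b2' (s c : nat -> nat) :
  sign_matrix A a1 a2 -> sign_matrix B b1 b2 ->
  sign_matrix A' a1' a2' -> sign_matrix B' b1' b2' ->
  n' = n -> (forall i, (i < n)%N -> (s i < n)%N) ->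
  (forall i j, (i < n)%N -> (j < n)%N -> s i = s j -> i = j) ->
  (forall i j, (i < n)%N -> (j < n)%N -> let o := odd (c i + c j) in
   [/\ a1' i j = flip o (a1 (s i) (s j)) (a2 (s i) (s j)),
       a2' i j = flip o (a2 (s i) (s j)) (a1 (s i) (s j)),
       b1' i j = flip o (b1 (s i) (s j)) (b2 (s i) (s j)) &
       b2' i j = flip o (b2 (s i) (s j)) (b1 (s i) (s j))]) ->
  congruent (MxPair A B) (MxPair A' B').
Proof.
move=> eA eB eA' eB' e sn injs H; subst n'.
apply: (congruent_nat (fA := fun i j => (a1 i j)%:R - (a2 i j)%:R)
  (fB := fun i j => (b1 i j)%:R - (b2 i j)%:R) (c := fun i => (-1) ^+ c i) _ sn injs _ eA eB) => //.
- by move=> i; rewrite signr_eq0.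
- move=> i j; rewrite eA' /= -exprD flipE.
  by have [-> ->] := H _ _ (ltn_ord i) (ltn_ord j).
- move=> i j; rewrite eB' /= -exprD flipE.
  by have [_ _ -> ->] := H _ _ (ltn_ord i) (ltn_ord j).
Qed.

Lemma equivalent_sign m n m' n' (A B : 'M[F]_(m, n)) (A' B' : 'M[F]_(m', n'))
    a1 a2 b1 b2 a1' a2' b1' b2' (s t c d : nat -> nat) :
  sign_matrix A a1 a2 -> sign_matrix B b1 b2 ->
  sign_matrix A' a1' a2' -> sign_matrix B' b1' b2' ->
  m' = m -> n' = n ->
  (forall i, (i < m)%N -> (s i < m)%N) ->
  (forall i j, (i < m)%N -> (j < m)%N -> s i = s j -> i = j) ->
  (forall i, (i < n)%N -> (t i < n)%N) ->
  (forall i j, (i < n)%N -> (j < n)%N -> t i = t j -> i = j) ->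
  (forall i j, (i < m)%N -> (j < n)%N -> let o := odd (c i + d j) in
   [/\ a1' i j = flip o (a1 (s i) (t j)) (a2 (s i) (t j)),
       a2' i j = flip o (a2 (s i) (t j)) (a1 (s i) (t j)),
       b1' i j = flip o (b1 (s i) (t j)) (b2 (s i) (t j)) &
       b2' i j = flip o (b2 (s i) (t j)) (b1 (s i) (t j))]) ->
  equivalent (MxPair A B) (MxPair A' B').
Proof.
move=> eA eB eA' eB' e e' sn injs tn injt H; subst m' n'.
apply: (equivalent_nat (fA := fun i j => (a1 i j)%:R - (a2 i j)%:R)
  (fB := fun i j => (b1 i j)%:R - (b2 i j)%:R) (c := fun i => (-1) ^+ c i) (d := fun i => (-1) ^+ d i)
  _ _ sn injs tn injt _ _ eA eB) => //.
- by move=> i; rewrite signr_eq0.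
- by move=> i; rewrite signr_eq0.
- move=> i j; rewrite eA' /= -exprD flipE.
  by have [-> ->] := H _ _ (ltn_ord i) (ltn_ord j).
- move=> i j; rewrite eB' /= -exprD flipE.
  by have [_ _ -> ->] := H _ _ (ltn_ord i) (ltn_ord j).
Qed.

Lemma sign_matrix_sym n (o e : bool) :
  sign_matrix (sym_tridiag (F := F) n (fun i => (e && (i == 0%N))%:R)
    (fun i => (odd i == o)%:R)) (symb o e) noneb.
Proof.
move=> i j; rewrite mxE -val_eqE /= /symb /noneb /upperb subr0.
have [->|ne1] := eqVneq (i : nat) j.
  rewrite [_.+1 == _](_ : _ = false) /=; last by lia.
  by rewrite !mulr0n !addr0 mulr1n; case: e; case: (_ == _).
rewrite mulr0n add0r (_ : [&& _, _ & _] = false); last by lia.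
have [e1|ne2] := eqVneq i.+1 j.
  by rewrite (_ : _ == _ :> nat = false) ?mulr0n ?addr0 ?orbF //; lia.
have [e1|ne3] := eqVneq j.+1 i; last by rewrite !mulr0n addr0.
by rewrite mulr0n add0r mulr1n /= orbF.
Qed.

Lemma sign_matrix_skew n (o : bool) :
  sign_matrix (skew_tridiag (F := F) n (fun i => (odd i == o)%:R))
    (upperb o) (fun i j => upperb o j i).
Proof.
move=> i j; rewrite mxE /upperb.
by case: (i.+1 == j :> nat); case: (j.+1 == i :> nat); rewrite ?mulr0n ?mulr1n.
Qed.

Lemma sign_matrix_jordan0 n :
  sign_matrix (jordan_block n (0 : F)) (fun i j => i.+1 == j) noneb.
Proof. by move=> i j; rewrite mxE mul0rn add0r subr0. Qed.

Lemma sign_matrix1 n : sign_matrix (1%:M : 'M[F]_n) (fun i j => i == j) noneb.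
Proof. by move=> i j; rewrite mxE subr0. Qed.

Lemma sign_matrixF n :
  sign_matrix (kronF F n) (fun i j => i == j) noneb.
Proof. by move=> i j; rewrite mxE subr0 eq_sym. Qed.

Lemma sign_matrixG n :
  sign_matrix (kronG F n) (fun i j => i.+1 == j) noneb.
Proof. by move=> i j; rewrite mxE subr0 eq_sym. Qed.

Lemma sign_matrix_tr m n (A : 'M[F]_(m, n)) a b : sign_matrix A a b ->
  sign_matrix A^T (fun i j => a j i) (fun i j => b j i).
Proof. by move=> eA i j; rewrite mxE eA. Qed.

Lemma sign_matrix_II n e :
  sign_matrix (mxpair_fst (summand_pair (@TypeII F n e))) (symb true e) noneb /\
  sign_matrix (mxpair_snd (summand_pair (@TypeII F n e)))
    (upperb false) (fun i j => upperb false j i).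
Proof.
split=> i j.
  rewrite -(sign_matrix_sym true e i j) !mxE.
  by rewrite !eqb_id.
rewrite -(sign_matrix_skew false i j) !mxE.
by rewrite !eqbF_neg.
Qed.

Lemma sign_matrix_III k :
  sign_matrix (mxpair_fst (summand_pair (@TypeIII F k)))
    (symb false false) noneb /\
  sign_matrix (mxpair_snd (summand_pair (@TypeIII F k)))
    (upperb true) (fun i j => upperb true j i).
Proof.
split=> i j.
  by rewrite -(sign_matrix_sym false false i j) !mxE !eqbF_neg.
by rewrite -(sign_matrix_skew true i j) !mxE !eqb_id.
Qed.


Lemma kron_form2 (p : mxpair F) b1 b2 : kron_valid b1 -> kron_valid b2 ->
  equivalent p
    (mxpair_add (kron_pair b1) (mxpair_add (kron_pair b2) (mxpair0 F))) ->
  is_kronecker_form p [:: b1; b2].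
Proof. by move=> v1 v2 E; split; rewrite //= v1 v2. Qed.

Lemma kron_typeII_wide k :
  is_kronecker_form (summand_pair (@TypeII F (2 * k + 1) false))
    [:: KronWide k; KronTall k].
Proof.
apply: kron_form2; [by []|by []|].
have [eA eB] := @sign_matrix_II (2 * k + 1) false.
have eF := @sign_matrixF k; have eG := @sign_matrixG k.
have eN := @sign_matrix0 0 0.
(* Only indices of opposite parity are coupled. Odd rows with even columns, read backwards, give the
   wide block; even rows with odd columns give the tall one. In the wide block Y is met below the
   diagonal, where it is -1, whence the alternating signs. *)
apply: (equivalent_sign
  (s := fun i => (if (i < k)%N then 2 * (k - i) - 1 else 2 * (k - (i - k)))%N)
  (t := fun j => (if (j <= k)%N then 2 * (k - j) else 2 * (k - (j - k.+1)) - 1)%N)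
  (c := fun i => if (i < k)%N then i else 0%N)
  (d := fun j => if (j <= k)%N then j else 0%N)
  eA eB
  (sign_matrix_block eF (sign_matrix_block (sign_matrix_tr eF) eN))
  (sign_matrix_block eG (sign_matrix_block (sign_matrix_tr eG) eN))) => /=.
- lia.
- lia.
- by move=> i Hi; case: (ltnP i k); lia.
- by move=> i j Hi Hj; case: (ltnP i k); case: (ltnP j k); lia.
- by move=> i Hi; case: (leqP i k); lia.
- by move=> i j Hi Hj; case: (leqP i k); case: (leqP j k); lia.
- move=> i j Hi Hj.
  by case: (ltnP i k); case: (leqP j k); intros; split; bool_lia.
Qed.

Lemma kron_typeII_inf2 k : (0 < k)%N ->
  is_kronecker_form (summand_pair (@TypeII F (2 * k) false))
    [:: KronInfinite k; KronInfinite k].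
Proof.
move=> k0; apply: kron_form2; [by []|by []|].
have [eA eB] := @sign_matrix_II (2 * k) false.
have eJ := @sign_matrix_jordan0 k; have e1 := @sign_matrix1 k.
have eN := @sign_matrix0 0 0.
apply: (equivalent_sign
  (s := fun i => (if (i < k)%N then 2 * (k - 1 - i) else 2 * (i - k) + 1)%N)
  (t := fun j => (if (j < k)%N then 2 * (k - 1 - j) + 1 else 2 * (j - k))%N)
  (c := fun i => (if (i < k)%N then 0 else (i - k).+1)%N)
  (d := fun j => (if (j < k)%N then 0 else j - k)%N)
  eA eB
  (sign_matrix_block eJ (sign_matrix_block eJ eN))
  (sign_matrix_block e1 (sign_matrix_block e1 eN))) => /=.
- lia.
- lia.
- by move=> i Hi; case: (ltnP i k); lia.
- by move=> i j Hi Hj; case: (ltnP i k); case: (ltnP j k); lia.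
- by move=> i Hi; case: (ltnP i k); lia.
- by move=> i j Hi Hj; case: (ltnP i k); case: (ltnP j k); lia.
- move=> i j Hi Hj.
  by case: (ltnP i k); case: (ltnP j k); intros; split; bool_lia.
Qed.

Lemma kron_form1 (p : mxpair F) b : kron_valid b ->
  equivalent p (mxpair_add (kron_pair b) (mxpair0 F)) ->
  is_kronecker_form p [:: b].
Proof. by move=> v1 E; split; rewrite //= v1. Qed.

(** The corner entry couples row 0 with column 0 and so joins the chain through the odd rows to the
    chain through the even rows: the two blocks found for epsilon = 0 merge into one, with the
    junction at position [m]. *)
Lemma kron_typeII_fin n : odd n ->
  is_kronecker_form (summand_pair (@TypeII F n true)) [:: KronFinite n 0].
Proof.
move=> odd_n; apply: kron_form1; [by rewrite /=; lia|].
have [eA eB] := @sign_matrix_II n true.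
have eJ := @sign_matrix_jordan0 n; have e1 := @sign_matrix1 n.
have eN := @sign_matrix0 0 0.
pose m := n./2; have en : n = (2 * m + 1)%N by rewrite /m; lia.
apply: (equivalent_sign
  (s := fun i => (if (i < m)%N then 2 * (m - i) - 1 else 2 * (i - m))%N)
  (t := fun j => (if (j <= m)%N then 2 * (m - j) else 2 * (j - m) - 1)%N)
  (c := fun i => (m - i)%N) (d := fun j => (m - j)%N)
  eA eB
  (sign_matrix_block e1 eN) (sign_matrix_block eJ eN)) => /=.
- lia.
- lia.
- by move=> i Hi; case: (ltnP i m); lia.
- by move=> i j Hi Hj; case: (ltnP i m); case: (ltnP j m); lia.
- by move=> i Hi; case: (leqP i m); lia.
- by move=> i j Hi Hj; case: (leqP i m); case: (leqP j m); lia.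
- move=> i j Hi Hj.
  by case: (ltnP i m); case: (leqP j m); intros; split; bool_lia.
Qed.

(** Here the corner entry becomes the superdiagonal entry that links two infinite blocks of half the
    size. *)
Lemma kron_typeII_inf n : (0 < n)%N -> ~~ odd n ->
  is_kronecker_form (summand_pair (@TypeII F n true)) [:: KronInfinite n].
Proof.
move=> n0 even_n; apply: kron_form1; [by []|].
have [eA eB] := @sign_matrix_II n true.
have eJ := @sign_matrix_jordan0 n; have e1 := @sign_matrix1 n.
have eN := @sign_matrix0 0 0.
pose m := n./2; have en : n = (2 * m)%N by rewrite /m; lia.
apply: (equivalent_sign
  (s := fun i => (if (i < m)%N then 2 * (m - 1 - i) else 2 * (i - m) + 1)%N)
  (t := fun j => (if (j < m)%N then 2 * (m - 1 - j) + 1 else 2 * (j - m))%N)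
  (c := fun i => (i.+1 - m)%N) (d := fun j => (j - m)%N)
  eA eB
  (sign_matrix_block eJ eN) (sign_matrix_block e1 eN)) => /=.
- lia.
- lia.
- by move=> i Hi; case: (ltnP i m); lia.
- by move=> i j Hi Hj; case: (ltnP i m); case: (ltnP j m); lia.
- by move=> i Hi; case: (ltnP i m); lia.
- by move=> i j Hi Hj; case: (ltnP i m); case: (ltnP j m); lia.
- move=> i j Hi Hj.
  by case: (ltnP i m); case: (ltnP j m); intros; split; bool_lia.
Qed.

Lemma kron_typeIII k : (0 < k)%N ->
  is_kronecker_form (summand_pair (@TypeIII F k))
    [:: KronFinite (2 * k) 0; KronFinite (2 * k) 0].
Proof.
move=> k0; apply: kron_form2; [by rewrite /=; lia|by rewrite /=; lia|].
have [eA eB] := @sign_matrix_III k.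
have eJ := @sign_matrix_jordan0 (2 * k); have e1 := @sign_matrix1 (2 * k).
have eN := @sign_matrix0 0 0.
pose m := (2 * k)%N.
apply: (equivalent_sign
  (s := fun i => (if (i < m)%N then 2 * (m - 1 - i) else 2 * (i - m) + 1)%N)
  (t := fun j => (if (j < m)%N then 2 * (m - 1 - j) + 1 else 2 * (j - m))%N)
  (c := fun i => (if (i < m)%N then i else 0)%N)
  (d := fun j => (if (j < m)%N then j else 0)%N)
  eA eB
  (sign_matrix_block e1 (sign_matrix_block e1 eN))
  (sign_matrix_block eJ (sign_matrix_block eJ eN))); rewrite {}/m /=.
- lia.
- lia.
- by move=> i Hi; case: (ltnP i (2 * k)); lia.
- by move=> i j Hi Hj; case: (ltnP i (2 * k)); case: (ltnP j (2 * k)); lia.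
- by move=> i Hi; case: (ltnP i (2 * k)); lia.
- by move=> i j Hi Hj; case: (ltnP i (2 * k)); case: (ltnP j (2 * k)); lia.
- move=> i j Hi Hj.
  by case: (ltnP i (2 * k)); case: (ltnP j (2 * k)); intros; split; bool_lia.
Qed.

End Signs.

(** * Type I *)

Section TypeI.
Variable F : fieldType.

Lemma congruent_add0 n (A B : 'M[F]_n) :
  congruent (MxPair A B) (mxpair_add (MxPair A B) (mxpair0 F)).
Proof.
apply: (congruent_frame (U := col_mx 1%:M 0)); first by rewrite /= addn0.
- by rewrite -sub1mx -addsmxE addsmxSl.
- by rewrite tr_col_mx trmx0 trmx1 !mul_col_mx !mul_mx_row !mul1mx !mulmx1
    !mul0mx !mulmx0 row_mx0 /= block_mxEv row_mx0.
- by rewrite tr_col_mx trmx0 trmx1 !mul_col_mx !mul_mx_row !mul1mx !mulmx1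
    !mul0mx !mulmx0 row_mx0 /= block_mxEv row_mx0.
Qed.

Lemma antitrig_unitmx k (M : 'M[F]_k) :
  (forall i j : 'I_k, (k <= i + j)%N -> M i j = 0) ->
  (forall i j : 'I_k, (i + j).+1 = k -> M i j != 0) -> M \in unitmx.
Proof.
move=> M0 Mn0; pose s := perm (@rev_ord_inj k).
have: row_perm s M \in unitmx.
  rewrite unitmxE det_trig ?unitfE.
    by apply/prodf_neq0 => i _; rewrite mxE permE Mn0 //=; have := ltn_ord i; lia.
  by apply/is_trig_mxP=> i j ij; rewrite mxE permE M0 //=; have := ltn_ord i; lia.
by rewrite row_permE unitmx_mul unitmx_perm.
Qed.

Definition hyper k (L M : 'M[F]_k) : mxpair F :=
  MxPair (block_mx 0 L L^T 0) (block_mx 0 M (- M^T) 0).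

(** The two halves are isotropic for both forms and their bases can be changed independently, so
    equivalence of (L, M) lifts to congruence. *)
Lemma congruent_hyper k (L M R S : 'M[F]_k) : R \in unitmx -> S \in unitmx ->
  congruent (hyper L M) (hyper (R *m L *m S) (R *m M *m S)).
Proof.
move=> uR uS; apply: (congruent_frame (U := block_mx R 0 0 S^T)) => //.
- by rewrite row_full_unit unitmxE det_ublock unitrM -!unitmxE unitmx_tr uR.
- rewrite tr_block_mx !trmx0 trmxK !mulmx_block.
  by rewrite !(mul0mx, mulmx0, addr0, add0r) !trmx_mul !mulmxA.
- rewrite tr_block_mx !trmx0 trmxK !mulmx_block.
  rewrite !(mul0mx, mulmx0, addr0, add0r) !trmx_mul !mulmxA.
  by rewrite mulmxN mulNmx ?mulmxA.
Qed.

(* The X and Y of type (i) restricted to odd rows and even columns. *)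
Definition lowL k : 'M[F]_k := \matrix_(i, j) (1 *+ (i == j) + 1 *+ (j.+1 == i :> nat)).
Definition lowM k (l : F) : 'M[F]_k :=
  \matrix_(i, j) (l *+ (i == j) - l *+ (j.+1 == i :> nat)).

(** Both matrices couple only indices of opposite parity; listing one parity class before the other
    empties the diagonal blocks. *)
Lemma typeI_low k l :
  congruent (summand_pair (TypeI k l)) (hyper (lowL k) (lowM k l)).
Proof.
pose fA i j : F := 1 *+ (i.+1 == j :> nat) + 1 *+ (j.+1 == i :> nat).
pose fB i j := l *+ (i.+1 == j :> nat) - l *+ (j.+1 == i :> nat).
pose f i j : F := 1 *+ (i == j :> nat) + 1 *+ (j.+1 == i :> nat).
pose g i j := l *+ (i == j :> nat) - l *+ (j.+1 == i :> nat).
pose z (i j : nat) : F := 0.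
apply: (congruent_nat (fA := fA) (fB := fB) (c := fun=> 1)
  (s := fun i => (if i < k then 2 * i else 2 * (i - k) + 1)%N)).
- by rewrite /=; lia.
- by move=> i Hi; case: (ltnP i k); lia.
- by move=> i j Hi Hj; case: (ltnP i k); case: (ltnP j k); lia.
- by move=> i; rewrite oner_eq0.
- by move=> i j; rewrite mxE mul0rn add0r.
- by move=> i j; rewrite mxE.
- move=> i j.
  rewrite (@block_mx_fun _ _ _ _ _ _ _ _ _ z f (fun i j => f j i) z); first last.
  + by move=> *; rewrite mxE.
  + by move=> *; rewrite !mxE.
  + by move=> *; rewrite mxE.
  + by move=> *; rewrite mxE.
  rewrite /block_fun !mul1r /z /f /fA.
  case: (ltnP i k) => Hi; case: (ltnP j k) => Hj.
  + by do 2 decide_atom; rewrite addr0.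
  + by congr (1 *+ _ + 1 *+ _); lia.
  + by rewrite addrC; congr (1 *+ _ + 1 *+ _); lia.
  + by do 2 decide_atom; rewrite addr0.
- move=> i j.
  rewrite (@block_mx_fun _ _ _ _ _ _ _ _ _ z g (fun i j => - g j i) z); first last.
  + by move=> *; rewrite mxE.
  + by move=> *; rewrite !mxE.
  + by move=> *; rewrite mxE.
  + by move=> *; rewrite mxE.
  rewrite /block_fun !mul1r /z /g /fB.
  case: (ltnP i k) => Hi; case: (ltnP j k) => Hj.
  + by do 2 decide_atom; rewrite !mulr0n subr0.
  + by congr (l *+ _ - l *+ _); lia.
  + by rewrite opprB; congr (l *+ _ - l *+ _); lia.
  + by do 2 decide_atom; rewrite !mulr0n subr0.
Qed.

Lemma lowL_unit k : lowL k \in unitmx.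
Proof.
rewrite unitmxE det_trig; last first.
  by apply/is_trig_mxP => i j ij; rewrite mxE -val_eqE /=; do 2 decide_atom; rewrite addr0.
rewrite big1 ?unitr1 // => i _.
by rewrite mxE eqxx (_ : _ == _ = false) ?addr0 //; lia.
Qed.

(* Writing the row e_i as s^-i with s acting as i -> i - 1, the multiplications
   by lowL and lowM are by 1 + s and l (1 - s), so the Jordan chain at l
   is (- 2 l)^i (1 + s)^(k - 1 - i) s^i e_(k - 1). *)
Definition chain_mx k (l : F) : 'M[F]_k :=
  \matrix_(i, j) ((- (l + l)) ^+ i * 'C(k.-1 - i, j)%:R).

Lemma sum_delta k (f : nat -> F) (a : nat) :
  \sum_(i < k) f i *+ (i == a :> nat) = f a *+ (a < k)%N.
Proof.
case: (ltnP a k) => Ha.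
  rewrite (bigD1 (Ordinal Ha)) //= eqxx big1 ?addr0 // => i.
  by rewrite -val_eqE /= => /negPf ->.
by rewrite big1 // => i _; rewrite (_ : _ == _ = false) //; have := ltn_ord i; lia.
Qed.

Lemma chain_lowM k l :
  chain_mx k l *m lowM k l = jordan_block k l *m chain_mx k l *m lowL k.
Proof.
pose X i j : F := (- (l + l)) ^+ i * 'C(k.-1 - i, j)%:R.
have XL (i j : nat) (x : F) : \sum_(m < k) X i m * (x *+ (j.+1 == m :> nat)) =
    X i j.+1 * x *+ (j.+1 < k)%N.
  rewrite -(sum_delta k (fun m => X i m * x)); apply: eq_bigr => m _.
  by rewrite eq_sym -mulrnAr.
have XL' (i : nat) (j : 'I_k) (x : F) : \sum_(m < k) X i m * (x *+ (m == j)) =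
    X i j * x.
  rewrite (bigD1 j) //= eqxx big1 ?addr0 // => m /negPf ->.
  by rewrite mulr0.
rewrite -mulmxA.
have E : chain_mx k l *m lowL k = \matrix_(i, j) (X i j + X i j.+1 *+ (j.+1 < k)%N).
  apply/matrixP=> i j; rewrite !mxE.
  under eq_bigr do rewrite !mxE mulrDr.
  by rewrite big_split XL XL' /= !mulr1.
apply/matrixP=> i j; rewrite E !mxE.
under eq_bigr do rewrite !mxE mulrBr.
rewrite sumrB XL XL'.
under [RHS]eq_bigr do rewrite !mxE mulrDl.
rewrite big_split /=.
(* The cut at the last column costs nothing: the binomial vanishes there anyway. *)
have X0 (a : nat) : X a j.+1 *+ (j.+1 < k)%N = X a j.+1.
  case: ltnP => // le_kj; rewrite mulr0n /X bin_small ?mulr0 //.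
  by have := ltn_ord j; lia.
rewrite -mulrnAl X0; under [X in _ = X + _]eq_bigr do rewrite X0.
under [X in _ = _ + X]eq_bigr do rewrite X0.
rewrite (bigD1 i) //= eqxx big1 ?addr0 => [|m]; last first.
  by rewrite eq_sym => /negPf ->; rewrite mul0r.
have -> : \sum_(m < k) (i.+1 == m :> nat)%:R * (X m j + X m j.+1) =
    - (l + l) * X i j.+1.
  transitivity (\sum_(m < k) (X m j + X m j.+1) *+ (m == i.+1 :> nat)).
    by apply: eq_bigr => m _; rewrite mulr_natl eq_sym.
  rewrite (sum_delta k (fun m => X m j + X m j.+1)) /X.
  case: ltnP => ik.
    (* Pascal's rule in row k-1-i; the spare factor of the power of -2l accounts for the scalar in
       front. *)
    rewrite -mulrDr -natrD addnC -(@prednK (k.-1 - i)); last lia.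
    by rewrite binS exprS -!mulrA [(k.-1 - i.+1)%N](_ : _ = (k.-1 - i).-1) //; lia.
  by rewrite (_ : k.-1 - i = 0)%N ?bin0n ?mulr0 //; lia.
rewrite mulNr mulrDl mulrDr ![X i _ * l]mulrC opprD addrA.
by rewrite mulr1n addrK.
Qed.

(** The binomial vanishes beyond the antidiagonal and equals 1 on it, which leaves the powers of
    -2l. *)
Lemma chain_unit k l : l + l != 0 -> chain_mx k l \in unitmx.
Proof.
move=> l0; apply: antitrig_unitmx => i j ij; rewrite mxE.
  by rewrite bin_small ?mulr0 //; have := ltn_ord i; lia.
rewrite (_ : k.-1 - i = j)%N ?binn ?mulr1; last lia.
by rewrite expf_neq0 // oppr_eq0.
Qed.

Lemma typeI_hyper k (l : F) : l + l != 0 ->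
  congruent (summand_pair (TypeI k l)) (hyper 1%:M (jordan_block k l)).
Proof.
move=> l0; apply: congruent_trans (typeI_low k l) _.
(* Passing to the Jordan chain on one half and to its dual basis under L on the other makes L the
   identity and M the Jordan block. *)
have uX := chain_unit k l0; have uXL : chain_mx k l *m lowL k \in unitmx.
  by rewrite unitmx_mul uX lowL_unit.
have := congruent_hyper (lowL k) (lowM k l) uX (S := invmx (chain_mx k l *m lowL k)).
rewrite unitmx_inv mulmxV // => /(_ uXL).
by rewrite chain_lowM -!mulmxA [chain_mx _ _ *m _]mulmxA mulmxV // mulmx1.
Qed.

Lemma equivalent_jordan_opp k (l : F) :
  equivalent (MxPair 1%:M (- (jordan_block k l)^T))
    (MxPair 1%:M (jordan_block k (- l))).
Proof.
pose fA i j : F := (i == j :> nat)%:R.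
pose fB i j : F := - (l *+ (i == j :> nat) + 1 *+ (j.+1 == i :> nat)).
(* Reversing the basis undoes the transposition, and alternating signs turn the off-diagonal -1 into
   1. *)
apply: (equivalent_nat (fA := fA) (fB := fB)
  (s := fun i => (k.-1 - i)%N) (t := fun i => (k.-1 - i)%N)
  (c := fun i => (-1) ^+ i) (d := fun i => (-1) ^+ i)) => //.
- by move=> i; lia.
- by move=> i j; lia.
- by move=> i; lia.
- by move=> i j; lia.
- by move=> i; rewrite signr_eq0.
- by move=> i; rewrite signr_eq0.
- by move=> i j; rewrite mxE.
- by move=> i j; rewrite !mxE -val_eqE /= eq_sym.
- move=> i j; rewrite mxE /fA; have := ltn_ord i; have := ltn_ord j => Hj Hi.
  rewrite -val_eqE /=; have [->|ne] := eqVneq (i : nat) j.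
    by rewrite eqxx mulr1 -expr2 sqrr_sign.
  by decide_atom; rewrite mulr0.
- move=> i j; rewrite mxE /fB; have := ltn_ord i; have := ltn_ord j => Hj Hi.
  rewrite -val_eqE /=; have [->|ne] := eqVneq (i : nat) j.
    by do 3 decide_atom; rewrite !addr0 -expr2 sqrr_sign mul1r.
  have [e|ne'] := eqVneq i.+1 j.
    do 2 decide_atom; rewrite !mulr0n !add0r -e exprS mulN1r.
    by rewrite mulrN mulrN mulNr opprK mulr1 -expr2 sqrr_sign.
  by do 2 decide_atom; rewrite !mulr0n !addr0 oppr0 mulr0.
Qed.

Lemma kron_typeI k (l : F) : (0 < k)%N -> l + l != 0 ->
  is_kronecker_form (summand_pair (TypeI k l))
    [:: KronFinite k l; KronFinite k (- l)].
Proof.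
move=> k0 l0; apply: kron_form2; [by []|by []|].
apply: equivalent_trans (congruent_equivalent (typeI_hyper k l0)) _.
pose J := jordan_block k l.
apply: (@equivalent_trans _
  (mxpair_add (MxPair 1%:M J) (MxPair 1%:M (- J^T)))).
  pose S : 'M[F]_(k + k) := block_mx 0 1%:M 1%:M 0.
  have uS : S \in unitmx.
    have SS : S *m S = 1%:M.
      rewrite mulmx_block !(mul0mx, mulmx0, addr0, add0r, mul1mx).
      by rewrite -scalar_mx_block.
    by have [] := mulmx1_unit SS.
  have := Equivalent (block_mx 0 1%:M 1%:M^T 0) (block_mx 0 J (- J^T) 0)
    (unitmx1 F _) uS.
  rewrite !mul1mx !mulmx_block !(mul0mx, mulmx0, addr0, add0r, mul1mx, mulmx1).
  by rewrite /hyper trmx1; apply.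
apply: equivalent_add; first exact: equivalent_refl.
apply: equivalent_trans (equivalent_jordan_opp k l) _.
exact: congruent_equivalent (congruent_add0 _ _).
Qed.

(** Reversing the basis exchanges superdiagonal and subdiagonal: X is kept and Y changes sign. *)
Lemma typeI_opp k (l : F) :
  congruent (summand_pair (TypeI k l)) (summand_pair (TypeI k (- l))).
Proof.
pose fA i j : F := 1 *+ (i.+1 == j :> nat) + 1 *+ (j.+1 == i :> nat).
pose fB i j := l *+ (i.+1 == j :> nat) - l *+ (j.+1 == i :> nat).
apply: (congruent_nat (fA := fA) (fB := fB) (c := fun=> 1)
  (s := fun i => ((2 * k).-1 - i)%N)) => //.
- by move=> i; lia.
- by move=> i j; lia.
- by move=> i; rewrite oner_eq0.
- by move=> i j; rewrite mxE mul0rn add0r.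
- by move=> i j; rewrite mxE.
- move=> i j; rewrite mxE mul0rn add0r !mul1r /fA addrC.
  by have := ltn_ord i; have := ltn_ord j => Hj Hi; congr (1 *+ _ + 1 *+ _); lia.
- move=> i j; rewrite mxE !mul1r /fB !mulNrn opprK addrC.
  by have := ltn_ord i; have := ltn_ord j => Hj Hi; congr (l *+ _ - l *+ _); lia.
Qed.

End TypeI.

(** * Dimensions of spaces of chains *)

Section Entries.
Variable F : fieldType.

(* Entry with natural-number indices, 0 out of range. *)
Definition entry m n (X : 'M[F]_(m, n)) (i j : nat) : F :=
  if insub i is Some i' then if insub j is Some j' then X i' j' else 0 else 0.

Lemma entryE m n (X : 'M[F]_(m, n)) (i : 'I_m) (j : 'I_n) : entry X i j = X i j.
Proof. by rewrite /entry !valK. Qed.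

Lemma entry_out m n (X : 'M[F]_(m, n)) i j :
  ~~ ((i < m) && (j < n))%N -> entry X i j = 0.
Proof.
rewrite negb_and => /orP [oi|oj]; rewrite /entry.
  by rewrite insubN.
by case: insub => // i'; rewrite insubN.
Qed.

Lemma entry_matrix m n (f : nat -> nat -> F) i j :
  (i < m)%N -> (j < n)%N -> entry (\matrix_(i < m, j < n) f i j) i j = f i j.
Proof. by move=> Hi Hj; rewrite (entryE _ (Ordinal Hi) (Ordinal Hj)) mxE. Qed.

Lemma eq_entry m n (X Y : 'M[F]_(m, n)) :
  X = Y <-> (forall i j, (i < m)%N -> (j < n)%N -> entry X i j = entry Y i j).
Proof.
split=> [-> //|E]; apply/matrixP => i j.
by rewrite -!entryE E.
Qed.

Lemma entry0 m n i j : entry (0 : 'M[F]_(m, n)) i j = 0.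
Proof. by rewrite /entry; case: insub => // i'; case: insub => // j'; rewrite mxE. Qed.

Lemma entry_mulr m n p (X : 'M[F]_(m, n)) (f : nat -> nat -> F) i j : (j < p)%N ->
  entry (X *m \matrix_(i < n, j < p) f i j) i j =
  \sum_(k < n) entry X i k * f k j.
Proof.
move=> Hj; case: (ltnP i m) => Hi; last first.
  rewrite entry_out ?ltnNge ?Hi // big1 // => k _.
  by rewrite entry_out ?mul0r ?ltnNge ?Hi.
rewrite (entryE _ (Ordinal Hi) (Ordinal Hj)) mxE; apply: eq_bigr => k _.
by rewrite (entryE _ (Ordinal Hi) k) mxE.
Qed.

Lemma entry_mull m n p (X : 'M[F]_(n, p)) (f : nat -> nat -> F) i j : (i < m)%N ->
  entry ((\matrix_(i < m, j < n) f i j) *m X) i j =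
  \sum_(k < n) f i k * entry X k j.
Proof.
move=> Hi; case: (ltnP j p) => Hj; last first.
  rewrite entry_out ?negb_and -?leqNgt ?Hj ?orbT // big1 // => k _.
  by rewrite entry_out ?mulr0 // negb_and -!leqNgt Hj orbT.
rewrite (entryE _ (Ordinal Hi) (Ordinal Hj)) mxE; apply: eq_bigr => k _.
by rewrite (entryE _ k (Ordinal Hj)) mxE.
Qed.

Definition shifted (f : nat -> F) j := if j is j'.+1 then f j' else 0.

Lemma sum_entry_r m n (X : 'M[F]_(m, n)) i a :
  \sum_(k < n) entry X i k * (k == a :> nat)%:R = entry X i a.
Proof.
under eq_bigr do rewrite mulr_natr.
rewrite (sum_delta n (entry X i)); case: ltnP => // na.
by rewrite entry_out // negb_and -!leqNgt na orbT.
Qed.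

Lemma sum_entry_l m n (X : 'M[F]_(m, n)) a j :
  \sum_(k < m) (k == a :> nat)%:R * entry X k j = entry X a j.
Proof.
under eq_bigr do rewrite mulr_natl.
rewrite (sum_delta m (entry X ^~ j)); case: ltnP => // ma.
by rewrite entry_out // negb_and -!leqNgt ma.
Qed.

Lemma sum_prev_r m n (X : 'M[F]_(m, n)) i a :
  \sum_(k < n) entry X i k * (k.+1 == a :> nat)%:R = shifted (entry X i) a.
Proof.
case: a => [|a] /=; first by rewrite big1 // => k _; rewrite mulr0.
by rewrite -sum_entry_r; apply: eq_bigr => k _; rewrite eqSS.
Qed.

Lemma sum_prev_l m n (X : 'M[F]_(m, n)) a j :
  \sum_(k < m) (k.+1 == a :> nat)%:R * entry X k j = shifted (entry X ^~ j) a.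
Proof.
case: a => [|a] /=; first by rewrite big1 // => k _; rewrite mul0r.
by rewrite -sum_entry_l; apply: eq_bigr => k _; rewrite eqSS.
Qed.

Lemma jordan_blockE n (l : F) : jordan_block n l =
  \matrix_(i < n, j < n) (l *+ (i == j :> nat) + (i.+1 == j :> nat)%:R).
Proof. by apply/matrixP=> i j; rewrite !mxE. Qed.

Lemma entry_jordan_r m n (X : 'M[F]_(m, n)) l i j : (j < n)%N ->
  entry (X *m jordan_block n l) i j = entry X i j * l + shifted (entry X i) j.
Proof.
move=> Hj; rewrite jordan_blockE.
rewrite (entry_mulr _ (fun i j => l *+ (i == j) + (i.+1 == j)%:R)) //.
under eq_bigr do rewrite mulrDr -[l *+ _]mulr_natl mulrA.
by rewrite big_split -mulr_suml /= sum_entry_r sum_prev_r.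
Qed.

Lemma entry_jordan_l m n (X : 'M[F]_(m, n)) l i j : (i < m)%N ->
  entry (jordan_block m l *m X) i j = l * entry X i j + entry X i.+1 j.
Proof.
move=> Hi; rewrite jordan_blockE.
rewrite (entry_mull _ (fun i j => l *+ (i == j) + (i.+1 == j)%:R)) //.
under eq_bigr do rewrite mulrDl -[l *+ _]mulr_natr -mulrA (eq_sym i) (eq_sym i.+1).
by rewrite big_split -mulr_sumr /= !sum_entry_l.
Qed.

Lemma entry_F_r m n (X : 'M[F]_(m, n)) i j : (j < n.+1)%N ->
  entry (X *m kronF F n) i j = entry X i j.
Proof.
move=> Hj; rewrite (entry_mulr _ (fun i j => (j == i)%:R)) //.
by under eq_bigr do rewrite eq_sym; rewrite sum_entry_r.
Qed.

Lemma entry_G_r m n (X : 'M[F]_(m, n)) i j : (j < n.+1)%N ->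
  entry (X *m kronG F n) i j = shifted (entry X i) j.
Proof.
move=> Hj; rewrite (entry_mulr _ (fun i j => (j == i.+1)%:R)) //.
by under eq_bigr do rewrite eq_sym; rewrite sum_prev_r.
Qed.

Lemma kronF_tr n : (kronF F n)^T = \matrix_(i < n.+1, j < n) (i == j :> nat)%:R.
Proof. by apply/matrixP=> i j; rewrite !mxE. Qed.

Lemma kronG_tr n : (kronG F n)^T = \matrix_(i < n.+1, j < n) (i == j.+1 :> nat)%:R.
Proof. by apply/matrixP=> i j; rewrite !mxE. Qed.

Lemma entry_FT_r m n (X : 'M[F]_(m, n.+1)) i j : (j < n)%N ->
  entry (X *m (kronF F n)^T) i j = entry X i j.
Proof.
move=> Hj; rewrite kronF_tr (entry_mulr _ (fun i j => (i == j)%:R)) //.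
by rewrite sum_entry_r.
Qed.

Lemma entry_GT_r m n (X : 'M[F]_(m, n.+1)) i j : (j < n)%N ->
  entry (X *m (kronG F n)^T) i j = entry X i j.+1.
Proof.
move=> Hj; rewrite kronG_tr (entry_mulr _ (fun i j => (i == j.+1)%:R)) //.
by rewrite sum_entry_r.
Qed.

Lemma entry_FT_l m n (X : 'M[F]_(m, n)) i j : (i < m.+1)%N ->
  entry ((kronF F m)^T *m X) i j = entry X i j.
Proof.
move=> Hi; rewrite kronF_tr (entry_mull _ (fun i j => (i == j)%:R)) //.
by under eq_bigr do rewrite eq_sym; rewrite sum_entry_l.
Qed.

Lemma entry_GT_l m n (X : 'M[F]_(m, n)) i j : (i < m.+1)%N ->
  entry ((kronG F m)^T *m X) i j = shifted (entry X ^~ j) i.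
Proof.
move=> Hi; rewrite kronG_tr (entry_mull _ (fun i j => (i == j.+1)%:R)) //.
by under eq_bigr do rewrite eq_sym; rewrite sum_prev_l.
Qed.

End Entries.

(** * Invariance and additivity of the solution spaces of P X A + Q X B = 0 *)

Section KernelDim.
Variable F : fieldType.
Implicit Types p q : mxpair F.

Section Map.
Variables (k l m n : nat) (A B : 'M[F]_(m, n)) (P Q : 'M[F]_(k, l)).
Definition pencil_map (X : 'M[F]_(l, m)) : 'M[F]_(k, n) :=
  P *m X *m A + Q *m X *m B.
Lemma pencil_map_is_linear : linear pencil_map.
Proof.
move=> a X Y; rewrite /pencil_map !mulmxDr !mulmxDl -!scalemxAr -!scalemxAl.
by rewrite scalerDr addrACA.
Qed.
HB.instance Definition _ := GRing.isLinear.Build F _ _ _ pencil_map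
  pencil_map_is_linear.
End Map.

Definition pencil_dim k l (P Q : 'M[F]_(k, l)) p : nat :=
  \dim (lker (linfun (pencil_map (mxpair_fst p) (mxpair_snd p) P Q))).

(** Linearity of [g] is a hypothesis, so that a parametrization of the kernel can be given by a bare
    formula. *)
Lemma dim_lker_param (U V W : vectType F) (f : {linear V -> W}) (g : U -> V) :
  linear g -> injective g -> (forall u, f (g u) = 0) ->
  (forall v, f v = 0 -> exists u, v = g u) ->
  \dim (lker (linfun f)) = dim U.
Proof.
move=> lg injg fg0 fg; pose gl : {linear U -> V} :=
  HB.pack g (GRing.isLinear.Build F U V _ g lg).
have -> : lker (linfun f) = limg (linfun gl).
  apply/vspaceP=> v; rewrite memv_ker lfunE; apply/eqP/memv_imgP.
    by case/fg=> u ->; exists u; rewrite ?memvf // lfunE.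
  by case=> u _ ->; rewrite lfunE /= fg0.
rewrite limg_dim_eq ?dimvf //; apply/eqP; rewrite -subv0.
have -> : (lker (linfun gl) = 0)%VS.
  by apply/eqP/lker0P => u v; rewrite !lfunE; apply: injg.
by rewrite capv0 subvv.
Qed.

Lemma pencil_dim_equiv k l (P Q : 'M[F]_(k, l)) p q : equivalent p q ->
  pencil_dim P Q p = pencil_dim P Q q.
Proof.
case=> m n A B R S uR uS; rewrite /pencil_dim /=.
set f := pencil_map A B P Q; set f' := pencil_map _ _ P Q.
have ff' X : f' X = f (X *m R) *m S.
  by rewrite /f' /f /pencil_map mulmxDl !mulmxA.
pose g (u : subvs_of (lker (linfun f))) := vsval u *m invmx R.
rewrite (@dim_lker_param _ _ _ f' g) //.
- by move=> a u v; rewrite /g linearP /= mulmxDl -scalemxAl.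
- move=> u v /(congr1 (mulmxr R)); rewrite /g /= !mulmxKV //.
  exact: val_inj.
- move=> u; rewrite -[LHS]/(f' (g u)) ff' /g mulmxKV //.
  have /eqP fu : f (vsval u) == 0 by have := subvsP u; rewrite memv_ker lfunE.
  by rewrite fu mul0mx.
- move=> X; rewrite -[X in X = 0 -> _]/(f' X) ff' => /(congr1 (mulmxr (invmx S))) /=.
  rewrite mulmxK // mul0mx => fX.
  have XU : X *m R \in lker (linfun f) by rewrite memv_ker lfunE; apply/eqP.
  by exists (Subvs XU); rewrite /g /= mulmxK.
Qed.

Lemma pencil_dim_add k l (P Q : 'M[F]_(k, l)) p q :
  pencil_dim P Q (mxpair_add p q) = (pencil_dim P Q p + pencil_dim P Q q)%N.
Proof.
case: p q => m n A B [m' n' A' B']; rewrite /pencil_dim /=.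
set f1 := pencil_map A B P Q; set f2 := pencil_map A' B' P Q.
set f := pencil_map _ _ P Q.
have fE X Y : f (row_mx X Y) = row_mx (f1 X) (f2 Y).
  rewrite /f /f1 /f2 /pencil_map !mul_mx_row !mul_row_block.
  by rewrite !(mulmx0, addr0, add0r) add_row_mx.
pose g (u : subvs_of (lker (linfun f1)) * subvs_of (lker (linfun f2))) :=
  row_mx (vsval u.1) (vsval u.2).
rewrite (@dim_lker_param _ _ _ f g) //.
- move=> a u v; rewrite /g !linearP /=.
  by rewrite scale_row_mx add_row_mx.
- move=> [u1 u2] [v1 v2] /eq_row_mx [/= /val_inj -> /val_inj ->] //.
- move=> [u1 u2]; rewrite -[LHS]/(f (row_mx (vsval u1) (vsval u2))) fE.
  have /eqP e1 : f1 (vsval u1) == 0 by have := subvsP u1; rewrite memv_ker lfunE.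
  have /eqP e2 : f2 (vsval u2) == 0 by have := subvsP u2; rewrite memv_ker lfunE.
  by rewrite e1 e2 row_mx0.
- move=> X; rewrite -[X in X = 0 -> _]/(f X) -(hsubmxK X) fE => E.
  have /eq_row_mx [f1X f2X] : row_mx (f1 (lsubmx X)) (f2 (rsubmx X)) = row_mx 0 0.
    by rewrite E row_mx0.
  have X1 : lsubmx X \in lker (linfun f1) by rewrite memv_ker lfunE; apply/eqP.
  have X2 : rsubmx X \in lker (linfun f2) by rewrite memv_ker lfunE; apply/eqP.
  by exists (Subvs X1, Subvs X2).
Qed.

Lemma pencil_dim0 k l (P Q : 'M[F]_(k, l)) : pencil_dim P Q (mxpair0 F) = 0%N.
Proof.
rewrite /pencil_dim; apply/eqP; rewrite dimv_eq0; apply/eqP/vspaceP => X.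
by rewrite (thinmx0 X) !mem0v.
Qed.

Lemma pencil_dim_sum k l (P Q : 'M[F]_(k, l)) (T : Type) (f : T -> mxpair F) s :
  pencil_dim P Q (mxpair_sum (map f s)) = (\sum_(t <- s) pencil_dim P Q (f t))%N.
Proof.
elim: s => [|t s IHs]; rewrite ?big_nil ?big_cons /= ?pencil_dim0 //.
by rewrite pencil_dim_add IHs.
Qed.

(* Spaces of chains of length k at the eigenvalue l, at infinity, and of
   polynomial null vectors with k coefficients. *)
Definition dim_fin k (l : F) := pencil_dim (- jordan_block k l) 1%:M.
Definition dim_inf k := pencil_dim 1%:M (- jordan_block k (0 : F)).
Definition dim_null k := pencil_dim (kronF F k)^T (- (kronG F k)^T).

(** Row by row this is the chain condition x_i B = l x_i A + x_(i+1) A. The chain ends because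
    [entry] reads row k as zero. *)
Lemma ker_finP k l m n (A B : 'M[F]_(m, n)) X :
  pencil_map A B (- jordan_block k l) 1%:M X = 0 <->
  forall i j, (i < k)%N -> (j < n)%N -> entry (X *m B) i j =
    l * entry (X *m A) i j + entry (X *m A) i.+1 j.
Proof.
have -> : (pencil_map A B (- jordan_block k l) 1%:M X = 0) <->
    X *m B = jordan_block k l *m (X *m A).
  rewrite /pencil_map mul1mx !mulNmx addrC mulmxA.
  by split=> [/eqP|->]; [rewrite subr_eq0 => /eqP | rewrite subrr].
rewrite eq_entry; split=> E i j Hi Hj.
  by rewrite E // entry_jordan_l.
by rewrite E // entry_jordan_l.
Qed.

Lemma ker_infP k m n (A B : 'M[F]_(m, n)) X :
  pencil_map A B 1%:M (- jordan_block k 0) X = 0 <->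
  forall i j, (i < k)%N -> (j < n)%N ->
    entry (X *m A) i j = entry (X *m B) i.+1 j.
Proof.
have -> : (pencil_map A B 1%:M (- jordan_block k 0) X = 0) <->
    X *m A = jordan_block k 0 *m (X *m B).
  rewrite /pencil_map mul1mx !mulNmx mulmxA.
  by split=> [/eqP|->]; [rewrite subr_eq0 => /eqP | rewrite subrr].
rewrite eq_entry; split=> E i j Hi Hj.
  by rewrite E // entry_jordan_l // mul0r add0r.
by rewrite E // entry_jordan_l // mul0r add0r.
Qed.

(** The rows are the coefficients of a polynomial null vector. There are k+1 conditions: i = 0 says
    that A kills the first coefficient, i = k that B kills the last. *)
Lemma ker_nullP k m n (A B : 'M[F]_(m, n)) X :
  pencil_map A B (kronF F k)^T (- (kronG F k)^T) X = 0 <->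
  forall i j, (i < k.+1)%N -> (j < n)%N ->
    entry (X *m A) i j = shifted (entry (X *m B) ^~ j) i.
Proof.
have -> : (pencil_map A B (kronF F k)^T (- (kronG F k)^T) X = 0) <->
    (kronF F k)^T *m (X *m A) = (kronG F k)^T *m (X *m B).
  rewrite /pencil_map !mulNmx !mulmxA.
  by split=> [/eqP|->]; [rewrite subr_eq0 => /eqP | rewrite subrr].
rewrite eq_entry; split=> E i j Hi Hj.
  by rewrite -entry_FT_l // E // entry_GT_l.
by rewrite entry_FT_l // E // entry_GT_l.
Qed.

Lemma dim_lker0 (V W : vectType F) (f : {linear V -> W}) :
  (forall v, f v = 0 -> v = 0) -> \dim (lker (linfun f)) = 0%N.
Proof.
move=> f0; apply/eqP; rewrite dimv_eq0 -subv0; apply/subvP=> v.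
by rewrite memv_ker lfunE memv0 => /eqP /f0 ->.
Qed.

End KernelDim.

(** * Chain spaces of the individual Kronecker blocks *)

Section BlockDims.
Variable F : fieldType.

Lemma entryD m n a (X Y : 'M[F]_(m, n)) i j :
  entry (a *: X + Y) i j = a * entry X i j + entry Y i j.
Proof.
rewrite /entry; case: insub => [i'|]; last by rewrite mulr0 addr0.
by case: insub => [j'|]; rewrite ?mxE // mulr0 addr0.
Qed.

Lemma entry_matrix_if m n (f : nat -> nat -> F) i j :
  entry (\matrix_(i < m, j < n) f i j) i j =
  if (i < m)%N && (j < n)%N then f i j else 0.
Proof.
case: ifP => [/andP [Hi Hj]|/negbT H]; first exact: entry_matrix.
exact: entry_out.
Qed.

(** Induction along a measure on positions, chosen so that each recurrence expresses an entry by
    entries of smaller measure; positions out of range count as zero and start the induction. *)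
Lemma entry_eq0 m n (X : 'M[F]_(m, n)) (mu : nat -> nat -> nat) :
  (forall i j, (i < m)%N -> (j < n)%N ->
     (forall i' j', (mu i' j' < mu i j)%N -> entry X i' j' = 0) ->
     entry X i j = 0) -> X = 0.
Proof.
move=> H; suff E : forall t i j, (mu i j < t)%N -> entry X i j = 0.
  by apply/eq_entry => i j _ _; rewrite entry0 (E (mu i j).+1).
elim=> // t IHt i j Ht.
have [/andP [Hi Hj]|] := boolP ((i < m) && (j < n))%N; last exact: entry_out.
by apply: H => // i' j' lt; apply: IHt; lia.
Qed.

Lemma dim_rV n : dim 'rV[F]_n = n.
Proof. by rewrite dim_matrix; apply: mul1n. Qed.

Lemma dim_cV n : dim 'cV[F]_n = n.
Proof. by rewrite dim_matrix; apply: muln1. Qed.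

Section Toeplitz.
Variables (k n : nat) (W : vectType F) (f : {linear 'M[F]_(k, n) -> W}).
Hypothesis fE : forall X, f X = 0 <->
  (forall i j, (i < k)%N -> (j < n)%N -> shifted (entry X i) j = entry X i.+1 j).

(** A solution is constant along diagonals. The first column forces zeros below the main diagonal,
    and the last row is zero up to its last entry, so the first min(k, n) entries of the last column
    are free and determine the rest. *)
Lemma dim_toeplitz : \dim (lker (linfun f)) = minn k n.
Proof.
pose g (u : 'rV[F]_(minn k n)) :=
  \matrix_(i < k, j < n) entry u 0 (i + (n.-1 - j)).
have gE u i j : entry (g u) i j =
    if (i < k)%N && (j < n)%N then entry u 0 (i + (n.-1 - j)) else 0.
  exact: (entry_matrix_if _ _ (fun i j => entry u 0 (i + (n.-1 - j)))).
transitivity (dim 'rV[F]_(minn k n)); last exact: dim_rV.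
apply: (@dim_lker_param _ _ _ _ f g).
- move=> a u v; apply/eq_entry => i j Hi Hj.
  by rewrite entryD !gE Hi Hj entryD.
- move=> u v E; apply/eq_entry => -[|//] d _ Hd.
  have := congr1 (fun X => entry X d n.-1) E.
  rewrite !gE subnn addn0 (_ : _ && _ = true) //; lia.
- move=> u; apply/fE => i [|j] Hi Hj /=.
    by rewrite gE; case: ifP => // _; rewrite entry_out //; lia.
  rewrite !gE; case: ifP => [_|]; last lia.
  case: ifP => [_|H]; first by congr entry; lia.
  by rewrite entry_out //; lia.
- move=> X /fE H; exists (\matrix_(i < 1, d < minn k n) entry X d n.-1).
  (* An entry is carried down its diagonal to the last column, or beyond the last row, where both
     sides are zero. *)
  have R t i j : (j + t = n.-1)%N -> (0 < n)%N ->
      entry X i j = entry X (i + t) n.-1.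
    elim: t i j => [|t IHt] i j e n0; first by rewrite addn0 -e addn0.
    case: (ltnP i k) => Hi; last by rewrite !entry_out //; lia.
    rewrite -[LHS]/(shifted (entry X i) j.+1) H //; last lia.
    by rewrite IHt ?addSnnS // -addSnnS.
  have Z t i : (t < n)%N -> entry X (i.+1 + t) t = 0.
    elim: t => [|t IHt] Ht.
      rewrite addn0; case: (ltnP i k) => Hi; first by rewrite -H.
      by rewrite entry_out //; lia.
    case: (ltnP (i.+1 + t) k) => Hi; last by rewrite entry_out //; lia.
    by rewrite addnS -H //= IHt //; lia.
  apply/eq_entry => i j Hi Hj; rewrite gE Hi Hj.
  rewrite (entry_matrix_if _ _ (fun _ d => entry X d n.-1)) /=.
  rewrite (R (n.-1 - j)%N) //; try lia.
  case: ltnP => // le.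
  case: (leqP k (i + (n.-1 - j))) => Hk; first by rewrite entry_out //; lia.
  rewrite (_ : i + (n.-1 - j) = (i + (n.-1 - j) - n).+1 + n.-1)%N; last lia.
  by rewrite Z //; lia.
Qed.

End Toeplitz.

Definition fin_kron k (l : F) (b : kron_block F) : nat :=
  match b with
  | KronFinite n m => if m == l then minn k n else 0
  | KronInfinite _ => 0
  | KronWide _ => 0
  | KronTall _ => k
  end.

Definition inf_kron k (b : kron_block F) : nat :=
  match b with
  | KronFinite _ _ => 0
  | KronInfinite n => minn k n
  | KronWide _ => 0
  | KronTall _ => k
  end.

Definition null_kron k (b : kron_block F) : nat :=
  if b is KronTall n then (k - n)%N else 0%N.

Lemma dim_finE k l b : dim_fin k l (kron_pair b) = fin_kron k l b.
Proof.
rewrite /dim_fin /pencil_dim; case: b => [n m|n|n|n] /=.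
- case: eqVneq => [->|ne].
    apply: dim_toeplitz => X; rewrite ker_finP; split=> H i j Hi Hj.
      have := H i j Hi Hj; rewrite entry_jordan_r // mulmx1 mulrC.
      by move/addrI.
    by rewrite entry_jordan_r // mulmx1 mulrC H.
  apply: dim_lker0 => X /ker_finP H.
  (* The entry times m - l is a difference of its neighbours below and to the left. *)
  apply: (entry_eq0 (mu := fun i j => j + (k - i))%N) => i j Hi Hj IH.
  have := H i j Hi Hj; rewrite entry_jordan_r // mulmx1 (IH i.+1 j); last lia.
  have -> : shifted (entry X i) j = 0.
    by case: j Hj IH {H} => //= j Hj IH; apply: IH; lia.
  rewrite !addr0 mulrC => /eqP; rewrite -subr_eq0 -mulrBl mulf_eq0 subr_eq0.
  by rewrite (negPf ne) => /eqP.
- apply: dim_lker0 => X /ker_finP H.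
  apply: (entry_eq0 (mu := fun i j => j)) => i j Hi Hj IH.
  have := H i j Hi Hj; rewrite mulmx1 => ->.
  have P i' : entry (X *m jordan_block n 0) i' j = 0.
    rewrite entry_jordan_r // mulr0 add0r.
    by case: j Hj IH => //= j Hj IH; apply: IH; lia.
  by rewrite !P mulr0 addr0.
- apply: dim_lker0 => X /ker_finP H.
  apply: (entry_eq0 (mu := fun i j => n - j)%N) => i j Hi Hj IH.
  have := H i j.+1 Hi Hj; rewrite entry_G_r //= => ->.
  by rewrite !entry_F_r // !IH ?mulr0 ?addr0 //; lia.
(* Column j+1 of a solution is the Jordan block times column j, so the first column is free and
   determines the others. *)
- pose T := fix T (c : 'cV[F]_k) j i := if j is j'.+1 then
    l * T c j' i + T c j' i.+1 else entry c i 0.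
  have T0 c j i : (k <= i)%N -> T c j i = 0.
    elim: j i => [|j IHj] i Hi /=; first by rewrite entry_out //; lia.
    by rewrite !IHj ?mulr0 ?addr0 //; lia.
  have TD a c d j i : T (a *: c + d) j i = a * T c j i + T d j i.
    elim: j i => [|j IHj] i /=; first exact: entryD.
    by rewrite !IHj !mulrDr addrACA mulrCA.
  pose g (c : 'cV[F]_k) := \matrix_(i < k, j < n.+1) T c j i.
  have gE c i j : entry (g c) i j =
      if (i < k)%N && (j < n.+1)%N then T c j i else 0.
    exact: (entry_matrix_if _ _ (fun i j => T c j i)).
  rewrite (@dim_lker_param _ _ _ _ _ g) ?dim_cV //.
  + move=> a u v; apply/eq_entry => i j Hi Hj.
    by rewrite entryD !gE Hi Hj TD.
  + move=> u v E; apply/eq_entry => i -[|//] Hi _.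
    by have := congr1 (fun X => entry X i 0) E; rewrite !gE Hi /=.
  + move=> u; apply/ker_finP => i j Hi Hj.
    rewrite entry_GT_r // !entry_FT_r // !gE Hi /= ltnS Hj ltnS ltnW // andbT.
    by case: ltnP => // le; rewrite (T0 u j i.+1).
  + move=> X /ker_finP H; exists (col 0 X).
    apply/eq_entry => i j Hi Hj; rewrite gE Hi Hj /=.
    elim: j i Hi Hj => [|j IHj] i Hi Hj /=.
      by rewrite !(entryE _ (Ordinal Hi) 0) mxE.
    have := H i j Hi Hj; rewrite entry_GT_r // !entry_FT_r // => ->.
    rewrite IHj //; last lia.
    case: (ltnP i.+1 k) => Hi1; first by rewrite IHj //; lia.
    by rewrite entry_out ?(T0 _ j i.+1) //; lia.
Qed.

Lemma dim_infE k b : dim_inf k (kron_pair b) = inf_kron k b.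
Proof.
rewrite /dim_inf /pencil_dim; case: b => [n m|n|n|n] /=.
- apply: dim_lker0 => X /ker_infP H.
  apply: (entry_eq0 (mu := fun i j => k - i)%N) => i j Hi Hj IH.
  have := H i j Hi Hj; rewrite mulmx1 => ->.
  rewrite entry_jordan_r // IH ?mul0r ?add0r; last lia.
  by case: j Hj {H IH} (IH i.+1) => //= j Hj IH; apply: IH; lia.
- apply: dim_toeplitz => X; rewrite ker_infP; split=> H i j Hi Hj.
    by have := H i j Hi Hj; rewrite entry_jordan_r // mulmx1 mulr0 add0r.
  by rewrite entry_jordan_r // mulmx1 mulr0 add0r H.
- apply: dim_lker0 => X /ker_infP H.
  apply: (entry_eq0 (mu := fun i j => k - i)%N) => i j Hi Hj IH.
  have := H i j Hi; rewrite entry_F_r ?entry_G_r //; try lia.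
  move=> -> //; last lia.
  by case: j {Hj H IH} (IH i.+1) => //= j IH; apply: IH; lia.
- pose g (c : 'cV[F]_k) := \matrix_(i < k, j < n.+1) entry c (i + (n - j)) 0.
  have gE c i j : entry (g c) i j =
      if (i < k)%N && (j < n.+1)%N then entry c (i + (n - j)) 0 else 0.
    exact: (entry_matrix_if _ _ (fun i j => entry c (i + (n - j)) 0)).
  rewrite (@dim_lker_param _ _ _ _ _ g) ?dim_cV //.
  + move=> a u v; apply/eq_entry => i j Hi Hj.
    by rewrite entryD !gE Hi Hj entryD.
  + move=> u v E; apply/eq_entry => i -[|//] Hi _.
    have := congr1 (fun X => entry X i n) E.
    by rewrite !gE Hi ltnS leqnn subnn addn0.
  + move=> u; apply/ker_infP => i j Hi Hj.
    rewrite entry_GT_r // entry_FT_r // !gE Hi /= !ltnS Hj (ltnW Hj) andbT.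
    case: ltnP => le; first by congr entry; lia.
    by rewrite entry_out //; lia.
  + move=> X /ker_infP H; exists (col ord_max X).
    apply/eq_entry => i j Hi Hj; rewrite gE Hi Hj /=.
    have R t i' j' : (j' + t = n)%N -> entry X i' j' = entry X (i' + t) n.
      elim: t i' j' => [|t IHt] i' j' e; first by move: e; rewrite !addn0 => ->.
      case: (ltnP i' k) => Hi'; last by rewrite !entry_out //; lia.
      have := H i' j' Hi'; rewrite entry_FT_r ?entry_GT_r //; try lia.
      by move=> -> //; [rewrite IHt ?addSnnS // addSnnS | lia].
    rewrite (R (n - j)%N); last lia.
    case: (ltnP (i + (n - j)) k) => Hk; last by rewrite !entry_out //; lia.
    by rewrite (entryE _ (Ordinal Hk) ord_max) (entryE _ (Ordinal Hk) 0) mxE.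
Qed.

Lemma dim_nullE k b : dim_null k (kron_pair b) = null_kron k b.
Proof.
rewrite /dim_null /pencil_dim; case: b => [n m|n|n|n] /=.
- apply: dim_lker0 => X /ker_nullP H.
  apply: (entry_eq0 (mu := fun i j => i)%N) => i j Hi Hj IH.
  have := H i j; rewrite mulmx1 => -> //; last lia.
  case: i Hi IH => //= i Hi IH; rewrite entry_jordan_r // IH // mul0r add0r.
  by case: j Hj => //= j Hj; rewrite IH.
- apply: dim_lker0 => X /ker_nullP H.
  apply: (entry_eq0 (mu := fun i j => k - i)%N) => i j Hi Hj IH.
  have := H i.+1 j; rewrite mulmx1 /= => <- //.
  rewrite entry_jordan_r // mulr0 add0r.
  by case: j Hj {H IH} (IH i.+1) => //= j Hj IH; apply: IH; lia.
- apply: dim_lker0 => X /ker_nullP H.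
  apply: (entry_eq0 (mu := fun i j => i)%N) => i j Hi Hj IH.
  have := H i j; rewrite entry_F_r; try lia.
  move=> ->; try lia.
  case: i Hi IH => //= i Hi IH; rewrite entry_G_r; try lia.
  by case: j Hj => //= j Hj; rewrite IH.
(* Solutions are Hankel matrices: entries depend on i + j only. The two boundary conditions kill i +
   j < n and i + j >= k, which leaves k - n free values. *)
- pose g (u : 'rV[F]_(k - n)) := \matrix_(i < k, j < n.+1)
    if (n <= i + j)%N then entry u 0 (i + j - n) else 0.
  have gE u i j : entry (g u) i j =
      if (i < k)%N && (j < n.+1)%N then
        if (n <= i + j)%N then entry u 0 (i + j - n) else 0 else 0.
    exact: (entry_matrix_if _ _
      (fun i j => if (n <= i + j)%N then entry u 0 (i + j - n) else 0)).
  rewrite (@dim_lker_param _ _ _ _ _ g) ?dim_rV //.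
  + move=> a u v; apply/eq_entry => i j Hi Hj.
    rewrite entryD !gE Hi Hj /=; case: ifP => _; first by rewrite entryD.
    by rewrite mulr0 addr0.
  + move=> u v E; apply/eq_entry => -[|//] d _ Hd.
    have := congr1 (fun X => entry X d n) E.
    rewrite !gE (_ : _ && _ = true) ?leq_addl ?addnK //; lia.
  + move=> u; apply/ker_nullP => i j Hi Hj; rewrite entry_FT_r // gE.
    case: i Hi => [|i] Hi /=.
      by case: ifP => //; case: ifP => //; lia.
    rewrite entry_GT_r // gE addSn addnS.
    have -> : (j < n.+1)%N = true by lia.
    have -> : (j.+1 < n.+1)%N = true by lia.
    have -> : (i < k)%N = true by lia.
    rewrite andbT /=; case: (ltnP i.+1 k) => // le.
    by case: ifP => // _; rewrite entry_out //; lia.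
  + move=> X /ker_nullP H; exists (\matrix_(_ < 1, d < k - n) entry X d n).
    have H' i j : (i < k.+1)%N -> (j < n)%N ->
        entry X i j = shifted (entry X ^~ j.+1) i.
      move=> Hi Hj; have := H i j Hi Hj; rewrite entry_FT_r // => ->.
      by case: i Hi => //= i Hi; rewrite entry_GT_r.
    have R t i j : (j + t = n)%N -> (i < k)%N ->
        entry X i j = if (t <= i)%N then entry X (i - t) n else 0.
      elim: t i j => [|t IHt] i j e Hi; first by move: e; rewrite addn0 subn0 => ->.
      rewrite H'; try lia.
      case: i Hi => //= i Hi; rewrite IHt ?subSS //; lia.
    apply/eq_entry => i j Hi Hj; rewrite gE Hi Hj /= (R (n - j)%N) //; last lia.
    case: ifP => le1; case: ifP => le2 //; try lia.
    rewrite (entry_matrix_if _ _ (fun _ d => entry X d n)) /=.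
    rewrite (_ : i + j - n = i - (n - j))%N; last lia.
    case: ltnP => // le3.
    have Z t a b : (a + t = k)%N -> (t <= b <= n)%N -> entry X a b = 0.
      elim: t a b => [|t IHt] a b e; first by rewrite entry_out //; lia.
      case: b => // b le; have := H' a.+1 b => /= <-; try lia.
      by rewrite IHt //; lia.
    by rewrite (Z (k - (i - (n - j)))%N) //; lia.
Qed.

End BlockDims.

(** * Uniqueness by counting Kronecker blocks *)

Section Uniqueness.
Variable F : fieldType.
Hypothesis two_neq0 : 1 + 1 != 0 :> F.
Implicit Types (t : summand F) (b : kron_block F).

Lemma double_neq0 (x : F) : x != 0 -> x + x != 0.
Proof. by move=> x0; rewrite -[x]mulr1 -mulrDr mulf_neq0. Qed.

Lemma eq_opp (x : F) : (x == - x) = (x == 0).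
Proof.
apply/idP/idP => [|/eqP ->]; last by rewrite oppr0.
by rewrite -subr_eq0 opprK; apply: contraLR; apply: double_neq0.
Qed.

Definition kron_blocks t : seq (kron_block F) :=
  match t with
  | TypeI k l => [:: KronFinite k l; KronFinite k (- l)]
  | TypeII n true => if odd n then [:: KronFinite n 0] else [:: KronInfinite n]
  | TypeII n false =>
      if odd n then [:: KronWide n./2; KronTall n./2]
      else [:: KronInfinite n./2; KronInfinite n./2]
  | TypeIII k => [:: KronFinite (2 * k) 0; KronFinite (2 * k) 0]
  end.

Lemma summand_kron t : summand_valid t ->
  is_kronecker_form (summand_pair t) (kron_blocks t).
Proof.
case: t => [k l|n [] |k] /=.
- by case/andP=> k0 l0; apply: kron_typeI => //; apply: double_neq0.
- case/andP=> n0 _; case: ifP => odd_n; first exact: kron_typeII_fin.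
  by apply: kron_typeII_inf; rewrite ?odd_n.
- case/andP=> n0 v; case: ifP => odd_n.
    have e : (n = 2 * n./2 + 1)%N by lia.
    by have := kron_typeII_wide F n./2; rewrite -e.
  have e : (n = 2 * n./2)%N by lia.
  have := @kron_typeII_inf2 F n./2; rewrite -e; apply; lia.
- exact: kron_typeIII.
Qed.

Lemma pencil_dim_kron k l (P Q : 'M[F]_(k, l)) p bs : is_kronecker_form p bs ->
  pencil_dim P Q p = (\sum_(b <- bs) pencil_dim P Q (kron_pair b))%N.
Proof.
by case=> _ /(pencil_dim_equiv P Q) ->; rewrite pencil_dim_sum.
Qed.

Lemma pencil_dim_summands k l (P Q : 'M[F]_(k, l)) (ts : seq (summand F)) :
  all (@summand_valid F) ts ->
  pencil_dim P Q (mxpair_sum [seq summand_pair t | t <- ts]) =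
  (\sum_(b <- flatten (map kron_blocks ts)) pencil_dim P Q (kron_pair b))%N.
Proof.
move=> v; rewrite pencil_dim_sum big_flatten big_map big_seq [RHS]big_seq.
by apply: eq_bigr => t /(allP v) vt; apply: pencil_dim_kron (summand_kron vt).
Qed.

(* [minn _ n] is concave with its only kink at [n], so second differences of
   the kernel dimensions count the blocks of a given size. *)
Lemma count_fin k l (bs : seq (kron_block F)) :
  (2 * \sum_(b <- bs) fin_kron k.+1 l b =
   \sum_(b <- bs) fin_kron k l b + \sum_(b <- bs) fin_kron k.+2 l b
   + count_mem (KronFinite k.+1 l) bs)%N.
Proof.
elim: bs => [|b bs IHbs] /=; first by rewrite !big_nil.
rewrite !big_cons mulnDr IHbs.
suff : (2 * fin_kron k.+1 l b =
    fin_kron k l b + fin_kron k.+2 l b + (b == KronFinite k.+1 l))%N.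
  by move: (nat_of_bool _) (count _ _) => c d; lia.
case: b {IHbs} => [n m|n|n|n] /=; try lia.
have -> : (KronFinite n m == KronFinite k.+1 l) = (n == k.+1) && (m == l).
  by apply/eqP/andP => [[-> ->]|[/eqP -> /eqP ->]].
by case: eqP => _; lia.
Qed.

Lemma count_inf k (bs : seq (kron_block F)) :
  (2 * \sum_(b <- bs) inf_kron k.+1 b =
   \sum_(b <- bs) inf_kron k b + \sum_(b <- bs) inf_kron k.+2 b
   + count_mem (KronInfinite k.+1) bs)%N.
Proof.
elim: bs => [|b bs IHbs] /=; first by rewrite !big_nil.
rewrite !big_cons mulnDr IHbs.
suff : (2 * inf_kron k.+1 b =
    inf_kron k b + inf_kron k.+2 b + (b == KronInfinite k.+1))%N.
  by move: (nat_of_bool _) (count _ _) => c d; lia.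
case: b {IHbs} => [n m|n|n|n] /=; try lia.
have -> : (KronInfinite n == KronInfinite k.+1 :> kron_block F) = (n == k.+1).
  by apply/eqP/eqP => [[->]|->].
lia.
Qed.

(** The truncated difference k - n is convex in k, opposite to [minn], so the count moves to the
    other side. At k = 0 the predecessor is read as 0, where every term vanishes. Counting tall
    blocks is enough for the summands, since their wide blocks come paired with tall ones of the
    same index. *)
Lemma count_null k (bs : seq (kron_block F)) :
  (2 * \sum_(b <- bs) null_kron k b + count_mem (KronTall k) bs =
   \sum_(b <- bs) null_kron k.-1 b + \sum_(b <- bs) null_kron k.+1 b)%N.
Proof.
elim: bs => [|b bs IHbs] /=; first by rewrite !big_nil.
rewrite !big_cons mulnDr.
suff : (2 * null_kron k b + (b == KronTall k) =
    null_kron k.-1 b + null_kron k.+1 b)%N.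
  by move: (nat_of_bool _) (count _ _) IHbs => c d; lia.
case: b {IHbs} => [n m|n|n|n] /=; try lia.
have -> : (KronTall n == KronTall k :> kron_block F) = (n == k).
  by apply/eqP/eqP => [[->]|->].
lia.
Qed.

(* A Kronecker block occurring in [kron_blocks t] but in no summand that is not
   the same as [t]; [key_mult t] is its multiplicity. *)
Definition key t : kron_block F :=
  match t with
  | TypeI k l => KronFinite k l
  | TypeII n true => if odd n then KronFinite n 0 else KronInfinite n
  | TypeII n false => if odd n then KronTall n./2 else KronInfinite n./2
  | TypeIII k => KronFinite (2 * k) 0
  end.

Definition key_mult t : nat :=
  match t with
  | TypeI k l => 1
  | TypeII n e => if e || odd n then 1 else 2
  | TypeIII k => 2
  end.

Lemma eq_fin n m n' m' :
  (KronFinite n m == KronFinite n' m' :> kron_block F) = (n == n') && (m == m').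
Proof. by apply/eqP/andP => [[-> ->]|[/eqP -> /eqP ->]]. Qed.

Lemma eq_inf n n' :
  (KronInfinite n == KronInfinite n' :> kron_block F) = (n == n').
Proof. by apply/eqP/eqP => [[->]|->]. Qed.

Lemma eq_tall n n' : (KronTall n == KronTall n' :> kron_block F) = (n == n').
Proof. by apply/eqP/eqP => [[->]|->]. Qed.

Lemma eq_typeII n e n' e' :
  (TypeII n e == TypeII n' e' :> summand F) = (n == n') && (e == e').
Proof. by apply/eqP/andP => [[-> ->]|[/eqP -> /eqP ->]]. Qed.

Lemma eq_typeIII n n' : (TypeIII n == TypeIII n' :> summand F) = (n == n').
Proof. by apply/eqP/eqP => [[->]|->]. Qed.

(** Validity prevents confusion. A nonzero l separates type (i) from blocks at 0, and l differs from
    -l. At 0, type (ii) gives odd sizes and type (iii) even ones. At infinity, epsilon = 1 gives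
    even sizes, while epsilon = 0 gives odd ones because 4 does not divide n. *)
Lemma count_key t t' : summand_valid t -> summand_valid t' ->
  count_mem (key t) (kron_blocks t') = (key_mult t * same_summand t t')%N.
Proof.
case: t => [k l|n e|k]; case: t' => [k' l'|n' e'|k'] /=.
- case/andP=> k0 l0 /andP [k0' l0']; rewrite !eq_fin addn0 mul1n eq_sym.
  case: eqVneq => //= _; rewrite eqr_oppLR; case: eqVneq => [->|] //=.
  by rewrite eq_opp (negPf l0).
- case/andP=> k0 l0 _; rewrite muln0.
  case: e'; case: ifP => //= _; rewrite addn0 eq_fin.
  by rewrite [0 == l]eq_sym (negPf l0) andbF.
- by case/andP=> k0 l0 _; rewrite !eq_fin [0 == l]eq_sym (negPf l0) !andbF.
- move=> _ /andP [k0' l0']; rewrite muln0.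
  case: e; case: ifP => //= _; rewrite !eq_fin oppr_eq0 (negPf l0') !andbF //.
- move=> /andP [n0 v] /andP [n0' v'].
  rewrite eq_typeII.
  case: e v => v; case: e' v' => v'; rewrite /= ?orbT ?mul1n;
    case: (boolP (odd n)) => o; case: (boolP (odd n')) => o' //=;
    rewrite ?eq_fin ?eq_inf ?eq_tall ?eqxx ?andbT ?andbF ?addn0 //; lia.
- move=> /andP [n0 v] _; rewrite muln0.
  by case: e v => v; case: (boolP (odd n)) => o //=; rewrite !eq_fin; lia.
- by move=> _ /andP [k0' l0']; rewrite !eq_fin oppr_eq0 (negPf l0') !andbF.
- move=> k0 /andP [n0 v]; rewrite muln0.
  by case: e' v => v; case: (boolP (odd n')) => o //=; rewrite !eq_fin; lia.
- move=> _ _; rewrite !eq_fin eqxx andbT eq_typeIII; lia.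
Qed.

Lemma same_summand_refl t : same_summand t t.
Proof. by case: t => [k l|n e|k] //=; rewrite ?eqxx. Qed.

Lemma same_summand_sym t t' : same_summand t t' = same_summand t' t.
Proof.
case: t => [k l|n e|k]; case: t' => [k' l'|n' e'|k'] //=; try exact: eq_sym.
by rewrite eq_sym [l' == l]eq_sym [l' == - l]eq_sym eqr_oppLR.
Qed.

Lemma same_summand_trans t1 t2 t3 :
  same_summand t1 t2 -> same_summand t1 t3 = same_summand t2 t3.
Proof.
case: t1 => [k l|n e|k]; case: t2 => [k' l'|n' e'|k'] //=; last first.
- by move/eqP => [->].
- by move/eqP => [-> ->].
case/andP=> /eqP -> /orP [/eqP ->|/eqP ->] //; case: t3 => //= k3 l3.
by rewrite opprK orbC.
Qed.

(** [same_summand] is an equivalence relation, so removing matched representatives from both lists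
    keeps the class counts equal. *)
Lemma same_summands_count (ts ts' : seq (summand F)) :
  (forall t, t \in ts ++ ts' ->
     count (same_summand t) ts = count (same_summand t) ts') ->
  same_summands ts ts'.
Proof.
elim: ts' ts => [|t' ts' IHts] ts H.
  case: ts H => [|t ts] H; first by exists [::].
  by have := H t; rewrite /= same_summand_refl mem_head => /(_ isT).
have : has (same_summand t') ts.
  rewrite has_count H ?mem_cat ?mem_head ?orbT //=.
  by rewrite same_summand_refl.
case/hasP=> t tin tt'.
have [|us pe al] := IHts (rem t ts).
  move=> u; rewrite mem_cat => Hu; have := H u.
  rewrite mem_cat inE (_ : _ || _ = true); last first.
    by case/orP: Hu => [/mem_rem ->|->]; rewrite ?orbT.
  move/(_ isT); rewrite (seq.permP (perm_to_rem tin)) /=.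
  rewrite !(same_summand_sym u) (same_summand_trans u tt').
  by move/addnI.
exists (t :: us); last by rewrite /= same_summand_sym tt'.
by apply: perm_trans (perm_to_rem tin) _; rewrite perm_cons.
Qed.

(** Equality of all pencil dimensions is the common consequence of having the same pair and of
    having the same Kronecker form; the two uniqueness claims both pass through it. *)
Lemma kron_unique (ts ts' : seq (summand F)) p p' :
  is_congruence_form p ts -> is_congruence_form p' ts' ->
  (forall k l (P Q : 'M[F]_(k, l)), pencil_dim P Q p = pencil_dim P Q p') ->
  same_summands ts ts'.
Proof.
move=> [v c] [v' c'] H.
pose bs ts := flatten (map kron_blocks ts).
have E k l (P Q : 'M[F]_(k, l)) :
   (\sum_(b <- bs ts) pencil_dim P Q (kron_pair b) =
    \sum_(b <- bs ts') pencil_dim P Q (kron_pair b))%N.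
  rewrite -!pencil_dim_summands //.
  rewrite -(pencil_dim_equiv _ _ (congruent_equivalent c)).
  by rewrite -(pencil_dim_equiv _ _ (congruent_equivalent c')).
have E1 k l : (\sum_(b <- bs ts) fin_kron k l b = \sum_(b <- bs ts') fin_kron k l b)%N.
  under eq_bigr do rewrite -dim_finE /dim_fin.
  by rewrite E; under eq_bigr do rewrite -/(dim_fin k l _) dim_finE.
have E2 k : (\sum_(b <- bs ts) inf_kron k b = \sum_(b <- bs ts') inf_kron k b)%N.
  under eq_bigr do rewrite -dim_infE /dim_inf.
  by rewrite E; under eq_bigr do rewrite -/(dim_inf k _) dim_infE.
have E3 k : (\sum_(b <- bs ts) null_kron k b = \sum_(b <- bs ts') null_kron k b)%N.
  under eq_bigr do rewrite -dim_nullE /dim_null.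
  by rewrite E; under eq_bigr do rewrite -/(dim_null k _) dim_nullE.
have C t : summand_valid t ->
    count_mem (key t) (bs ts) = count_mem (key t) (bs ts').
  have C1 k l : (0 < k)%N ->
      count_mem (KronFinite k l) (bs ts) = count_mem (KronFinite k l) (bs ts').
    case: k => // k _; have := count_fin k l (bs ts).
    by rewrite !E1 count_fin => /addnI.
  have C2 k : (0 < k)%N ->
      count_mem (KronInfinite k) (bs ts) = count_mem (KronInfinite k) (bs ts').
    case: k => // k _; have := count_inf k (bs ts).
    by rewrite !E2 count_inf => /addnI.
  have C3 k : count_mem (KronTall k) (bs ts) = count_mem (KronTall k) (bs ts').
    by have := count_null k (bs ts); rewrite !E3 -count_null => /addnI.
  case: t => [k l|n [] |k] /= => [/andP [k0 _]|/andP [n0 _]|/andP [n0 vn]|k0].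
  - exact: C1.
  - by case: ifP => _; [apply: C1|apply: C2].
  - by case: ifP => o; [apply: C3|apply: C2; lia].
  - by apply: C1; lia.
have K (us : seq (summand F)) t : all (@summand_valid F) us -> summand_valid t ->
    count_mem (key t) (bs us) = (key_mult t * count (same_summand t) us)%N.
  move=> vus vt; elim: us vus => [|u us IHus] /=; first by rewrite muln0.
  case/andP=> vu vus; rewrite /bs /= count_cat count_key // mulnDr.
  by rewrite -IHus.
apply: same_summands_count => t; rewrite mem_cat => tin.
have vt : summand_valid t by case/orP: tin => [/(allP v)|/(allP v')].
have := C t vt; rewrite !K // => /eqP; rewrite eqn_pmul2l => [/eqP //|].
by case: t {vt tin} => [||] //= n e; case: ifP.
Qed.

Lemma same_summands_congruent (ts ts' : seq (summand F)) p :
  is_congruence_form p ts -> same_summands ts ts' -> is_congruence_form p ts'.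
Proof.
move=> [v c] [us pe al]; rewrite (perm_all _ pe) in v.
have sq t : square (summand_pair t).
  by case: t => [k l|n e|k]; do 3 eexists.
have {c} c := congruent_trans c (congruent_sum_perm sq pe).
suff [v' c'] : all (@summand_valid F) ts' /\
   congruent (mxpair_sum [seq summand_pair t | t <- us])
             (mxpair_sum [seq summand_pair t | t <- ts']).
  by split=> //; apply: congruent_trans c c'.
elim: us ts' v al {pe c} => [|u us IHus] [|t ts1] //=.
  by split=> //; apply: congruent_refl.
case/andP=> vu vus /andP [ut al]; have [-> c] := IHus _ vus al.
have [-> c'] : summand_valid t /\ congruent (summand_pair u) (summand_pair t).
  case: u t vu ut => [k l|n e|k] [k' l'|n' e'|k'] //=.
  - case/andP=> k0 l0 /andP [/eqP <- /orP [/eqP ->|/eqP ->]].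
      by rewrite k0 l0; split=> //; apply: congruent_refl.
    by rewrite k0 oppr_eq0 l0; split=> //; apply: typeI_opp.
  - by move=> v /eqP [<- <-]; split=> //; apply: congruent_refl.
  - by move=> v /eqP [<-]; split=> //; apply: congruent_refl.
by split=> //; apply: congruent_add.
Qed.

End Uniqueness.

(** * Extending a summand by its kernel *)

Section Extension.
Variable F : fieldType.

(* Gram matrices on K + V + K*, with K* dual to K under Q, where (P, Q) lives on
   V, K is the kernel of the new first form and C its pairing V x K*. *)
Definition extP (eps : F) n s (P : 'M[F]_n) (C : 'M[F]_(n, s)) :
    'M[F]_(s + (n + s)) :=
  block_mx 0 0 0 (block_mx P C (eps *: C^T) 0).

Definition extQ (eps : F) n s (Q : 'M[F]_n) : 'M[F]_(s + (n + s)) :=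
  block_mx 0 (row_mx 0 (- eps)%:M) (col_mx 0 1%:M) (block_mx Q 0 0 0).

(* The rows of E are a basis of the row kernel of P, dual to the columns of C. *)
Definition kernel_data n s (P : 'M[F]_n) (C : 'M[F]_(n, s)) :=
  exists E : 'M_(s, n), exists Z : 'M_n,
  [/\ E *m P = 0, E *m C = 1%:M & P *m Z + C *m E = 1%:M].

Definition blockb4 (m n : nat) (f11 f12 f21 f22 : nat -> nat -> bool) i j :=
  if (i < m)%N then if (j < n)%N then f11 i j else f12 i (j - n)%N
  else if (j < n)%N then f21 (i - m)%N j else f22 (i - m)%N (j - n)%N.

Lemma sign_matrix_block4 m1 m2 n1 n2 (A11 : 'M[F]_(m1, n1)) (A12 : 'M_(m1, n2))
    (A21 : 'M_(m2, n1)) (A22 : 'M_(m2, n2)) f11 f12 f21 f22 g11 g12 g21 g22 :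
  sign_matrix A11 f11 g11 -> sign_matrix A12 f12 g12 ->
  sign_matrix A21 f21 g21 -> sign_matrix A22 f22 g22 ->
  sign_matrix (block_mx A11 A12 A21 A22)
    (blockb4 m1 n1 f11 f12 f21 f22) (blockb4 m1 n1 g11 g12 g21 g22).
Proof.
move=> e11 e12 e21 e22 i j.
pose h (f g : nat -> nat -> bool) i j : F := (f i j)%:R - (g i j)%:R.
rewrite (@block_mx_fun _ _ _ _ _ _ _ _ _ (h f11 g11) (h f12 g12) (h f21 g21)
  (h f22 g22)) // /block_fun /blockb4.
by case: ifP => _; case: ifP => _.
Qed.

Lemma sign_matrix_ext (o : bool) n s (P Q : 'M[F]_n) (C : 'M[F]_(n, s))
    p1 p2 q1 q2 c :
  sign_matrix P p1 p2 -> sign_matrix Q q1 q2 -> sign_matrix C c noneb ->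
  sign_matrix (extP ((-1) ^+ o) P C)
    (blockb4 s s noneb noneb noneb
      (blockb4 n n p1 c (fun i j => ~~ o && c j i) noneb))
    (blockb4 s s noneb noneb noneb
      (blockb4 n n p2 noneb (fun i j => o && c j i) noneb)) /\
  sign_matrix (extQ ((-1) ^+ o) s Q)
    (blockb4 s s noneb (fun i j => [&& o, (n <= j)%N & i == (j - n)%N])
      (fun i j => (n <= i)%N && (i - n == j)%N) (blockb4 n n q1 noneb noneb noneb))
    (blockb4 s s noneb (fun i j => [&& ~~ o, (n <= j)%N & i == (j - n)%N])
      noneb (blockb4 n n q2 noneb noneb noneb)).
Proof.
move=> eP eQ eC; have e0 m m' := @sign_matrix0 F m m'; split.
  apply: sign_matrix_block4 => //; apply: sign_matrix_block4 => //.
  by move=> i j; rewrite !mxE eC; case: o => /=;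
    rewrite subr0 ?mul1r ?mulN1r ?sub0r ?subr0.
apply: sign_matrix_block4 => //; last exact: sign_matrix_block4.
- move=> i j; rewrite -[j]splitK; case: (split j) => j' /=.
    rewrite row_mxEl mxE (leqNgt n) ltn_ord /= andbF.
    by rewrite !andbF subrr.
  rewrite row_mxEr mxE leq_addr addKn -val_eqE /=.
  by case: o; case: (_ == _) => /=; rewrite ?opprK ?mulr1n ?mulr0n ?subr0 ?sub0r.
- move=> i j; rewrite -[i]splitK; case: (split i) => i' /=.
    by rewrite col_mxEu mxE (leqNgt n) ltn_ord /= subrr.
  by rewrite col_mxEd mxE leq_addr addKn -val_eqE /= subr0.
Qed.

(* The tridiagonal matrices of types (ii) and (iii) are signed partial
   matchings: the only nonzero entry of row i is at [partner o i], if any. *)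
Definition partner (o : bool) i := if odd i == o then i.+1 else i.-1.
Definition matched (n : nat) (o e : bool) i :=
  if odd i == o then (i.+1 < n)%N else (0 < i)%N || e.

Definition select_mx n (u : seq nat) : 'M[F]_(n, size u) :=
  \matrix_(i, j) (i == nth 0 u j :> nat)%:R.

(** For a signed partial matching, P P^T is the projection onto the matched coordinates and C C^T
    the projection onto the unmatched ones, whence E = C^T and Z = P^T. *)
Lemma kernel_data_matching n (o e : bool) (P : 'M[F]_n) a b (u : seq nat) :
  sign_matrix P a b ->
  (forall i j, (i < n)%N -> (j < n)%N ->
     a i j (+) b i j = matched n o e i && (j == partner o i)
     /\ ~~ (a i j && b i j)) ->
  uniq u -> (forall i, (i < n)%N -> (i \in u) = ~~ matched n o e i) ->
  all (fun i => i < n)%N u ->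
  kernel_data P (select_mx n u).
Proof.
move=> eP ab uu mu un; exists (select_mx n u)^T, P^T; split.
- apply/matrixP=> i j; rewrite mxE; rewrite mxE big1 // => k _; rewrite !mxE.
  case: eqP => [e1|]; rewrite ?mul0r // mul1r eP.
  have : (k : nat) \in u by rewrite e1 mem_nth.
  rewrite mu // => /negPf nm; have := ab k j (ltn_ord k) (ltn_ord j).
  by rewrite nm; case: (a _ _); case: (b _ _); case=> //=; rewrite subrr.
- apply/matrixP=> i j; rewrite !mxE.
  have lt : (nth 0 u i < n)%N by have /all_nthP := un; apply.
  rewrite (bigD1 (Ordinal lt)) //= !mxE eqxx mul1r nth_uniq //.
  rewrite big1 ?addr0 // => k; rewrite -val_eqE /= => /negPf ne.
  by rewrite !mxE ne mul0r.
- apply/matrixP=> i j; rewrite !mxE.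
  have -> : \sum_k P i k * P^T k j = ((i == j) && matched n o e i)%:R.
    have Pm x y : P x y = 0 \/ (matched n o e x /\ y = partner o x :> nat).
      rewrite eP; have := ab x y (ltn_ord x) (ltn_ord y).
      case: (a _ _); case: (b _ _); case=> //=; try by left; rewrite subrr.
      + by move/esym/andP=> [H /eqP]; right.
      + by move/esym/andP=> [H /eqP]; right.
    case: (boolP (matched n o e i)) => [mi|nmi]; last first.
      rewrite andbF big1 // => k _; case: (Pm i k) => [->|[mi]]; first by rewrite mul0r.
      by rewrite mi in nmi.
    rewrite andbT; have pi : (partner o i < n)%N.
      move: mi; rewrite /matched /partner; have := ltn_ord i.
      by case: ifP; lia.
    rewrite (bigD1 (Ordinal pi)) //= big1 ?addr0; last first.
      move=> k; rewrite -val_eqE /= => ne; case: (Pm i k) => [->|[_ ek]].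
        by rewrite mul0r.
      by rewrite ek eqxx in ne.
    rewrite mxE; have [<-|ne] := eqVneq i j.
      rewrite eP; have := ab i (Ordinal pi) (ltn_ord i) (ltn_ord _).
      rewrite mi eqxx /=; case: (a _ _); case: (b _ _); case=> //= _ _.
        by rewrite subr0 mulr1.
      by rewrite sub0r mulrNN mulr1.
    (* Two matched indices with the same partner coincide, so the rows of P are orthogonal. *)
    case: (Pm j (Ordinal pi)) => [->|[mj /= epj]]; first by rewrite mulr0.
    case/negP: ne; apply/eqP/val_inj => /=.
    move: epj mi mj; rewrite /partner /matched.
    by case: ifP; case: ifP; have := ltn_ord i; have := ltn_ord j; lia.
  have -> : \sum_k select_mx n u i k * (select_mx n u)^T k j =
      ((i == j) && ((i : nat) \in u))%:R.
    case: (boolP ((i : nat) \in u)) => iu.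
      have lt : (index (i : nat) u < size u)%N by rewrite index_mem.
      rewrite (bigD1 (Ordinal lt)) //= !mxE nth_index // eqxx mul1r big1 ?addr0.
        by rewrite andbT -val_eqE eq_sym.
      move=> k; rewrite -val_eqE /= !mxE => ne.
      case: eqP => e1; rewrite ?mul0r //; case/negP: ne.
      by rewrite e1 index_uniq.
    rewrite andbF big1 // => k _; rewrite mxE.
    case: eqP => e1; rewrite ?mul0r //; case/negP: iu.
    by rewrite e1 mem_nth.
  rewrite mu // -natrD -mulnb -mulnb -mulnDr.
  by case: (matched _ _ _ _); rewrite muln1.
Qed.

Lemma sign_matrix_select n u :
  sign_matrix (select_mx n u) (fun i j => i == nth 0 u j) noneb.
Proof. by move=> i j; rewrite mxE subr0. Qed.

Lemma sign_matrix_eq m n (A : 'M[F]_(m, n)) a b a' b' : sign_matrix A a b ->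
  (forall i j, (i < m)%N -> (j < n)%N -> a i j = a' i j /\ b i j = b' i j) ->
  sign_matrix A a' b'.
Proof. by move=> eA H i j; rewrite eA; have [-> ->] := H i j (ltn_ord i) (ltn_ord j). Qed.

Ltac ext_lia := rewrite /blockb4; bool_lia.

(* Positions of the basis vectors of the prolonged summand in the order
   K, V, K*: prolongation at the last end, at the first end, at both ends. *)
Notation last_map n := (fun i => if (i < n)%N then i.+1 else
  if i == n then n.+1 else 0%N).

Lemma ext_typeII_last n : (0 < n)%N -> ~~ odd n ->
  let P := mxpair_fst (summand_pair (@TypeII F n true)) in
  let Q := mxpair_snd (summand_pair (@TypeII F n true)) in
  congruent (MxPair (extP 1 P (select_mx n [:: n.-1])) (extQ 1 1 Q))
    (summand_pair (TypeII (n + 2) true)).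
Proof.
move=> n0 even_n P Q; have [eP eQ] := @sign_matrix_II F n true.
have eC : sign_matrix (select_mx n [:: n.-1]) (fun i j => i == n.-1) noneb.
  by apply: sign_matrix_eq (@sign_matrix_select _ _) _ => i [|j].
have [e1 e2] := @sign_matrix_ext false _ _ _ _ _ _ _ _ _ _ eP eQ eC.
have [e1' e2'] := @sign_matrix_II F (n + 2) true.
apply: (congruent_sign (s := last_map n) (c := fun=> 0%N) e1 e2 e1' e2').
- by rewrite /=; lia.
- by move=> i /= Hi; case: (ltnP i n) => ?; case: (eqVneq i n) => ?; rewrite /=; lia.
- by move=> i j /= Hi Hj; case: (ltnP i n) => ?; case: (ltnP j n) => ?;
    case: (eqVneq i n) => ?; case: (eqVneq j n) => ?; rewrite /=; lia.
- move=> i j /= Hi Hj; case: (ltnP i n) => ?; case: (ltnP j n) => ?;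
    case: (eqVneq i n) => ?; case: (eqVneq j n) => ?; try lia; split; ext_lia.
Qed.

Notation first_map n := (fun i => if i == 0%N then 0%N else
  if i == 1%N then n.+1 else i.-1).

Notation both_map n := (fun i => if i == 0%N then 0%N else
  if i == 1%N then n.+2 else if (i < n.+2)%N then i else
  if i == n.+2 then n.+3 else 1%N).

Lemma ext_typeII_first n : odd n ->
  let P := mxpair_fst (summand_pair (@TypeII F n false)) in
  let Q := mxpair_snd (summand_pair (@TypeII F n false)) in
  congruent (MxPair (extP 1 P (select_mx n [:: 0%N])) (extQ 1 1 Q))
    (summand_pair (TypeII (n + 2) false)).
Proof.
move=> odd_n P Q; have [eP eQ] := @sign_matrix_II F n false.
have eC : sign_matrix (select_mx n [:: 0%N]) (fun i j => i == 0%N) noneb.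
  by apply: sign_matrix_eq (@sign_matrix_select _ _) _ => i [|j].
have [e1 e2] := @sign_matrix_ext false _ _ _ _ _ _ _ _ _ _ eP eQ eC.
have [e1' e2'] := @sign_matrix_II F (n + 2) false.
(* The new first vector lies in K, where Q gives - [eps] = -1 against its dual vector, but Y needs 1
   at the first position: its sign is flipped. *)
apply: (congruent_sign (s := first_map n) (c := fun i => (i == 0)%N : nat)
  e1 e2 e1' e2').
- by rewrite /=; lia.
- move=> i /= Hi.
  by case: (eqVneq i 0) => ?; case: (eqVneq i 1) => ?; rewrite /=; lia.
- move=> i j /= Hi Hj.
  by case: (eqVneq i 0) => ?; case: (eqVneq i 1) => ?;
    case: (eqVneq j 0) => ?; case: (eqVneq j 1) => ?; rewrite /=; lia.
- move=> i j /= Hi Hj; case: (eqVneq i 0) => ?; case: (eqVneq i 1) => ?;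
    case: (eqVneq j 0) => ?; case: (eqVneq j 1) => ?; try lia; split; ext_lia.
Qed.

Lemma ext_skew_last n e : odd n ->
  let P := mxpair_snd (summand_pair (@TypeII F n e)) in
  let Q := mxpair_fst (summand_pair (@TypeII F n e)) in
  congruent (MxPair (extQ (-1) 1 Q) (extP (-1) P (select_mx n [:: n.-1])))
    (summand_pair (TypeII (n + 2) e)).
Proof.
move=> odd_n P Q; have [eQ eP] := @sign_matrix_II F n e.
have eC : sign_matrix (select_mx n [:: n.-1]) (fun i j => i == n.-1) noneb.
  by apply: sign_matrix_eq (@sign_matrix_select _ _) _ => i [|j].
have [e1 e2] := @sign_matrix_ext true _ _ _ _ _ _ _ _ _ _ eP eQ eC.
have [e1' e2'] := @sign_matrix_II F (n + 2) e.
apply: (congruent_sign (s := last_map n) (c := fun=> 0%N) e2 e1 e1' e2').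
- by rewrite /=; lia.
- by move=> i /= Hi; case: (ltnP i n) => ?; case: (eqVneq i n) => ?; rewrite /=; lia.
- by move=> i j /= Hi Hj; case: (ltnP i n) => ?; case: (ltnP j n) => ?;
    case: (eqVneq i n) => ?; case: (eqVneq j n) => ?; rewrite /=; lia.
- move=> i j /= Hi Hj; case: (ltnP i n) => ?; case: (ltnP j n) => ?;
    case: (eqVneq i n) => ?; case: (eqVneq j n) => ?; try lia; split;
    case: (e) => /=; ext_lia.
Qed.

Definition both_fun n (i j : nat) :=
  (j == 0%N) && (i == 0%N) || (j == 1%N) && (i == n.-1).

Lemma sign_matrix_both n : (0 < n)%N ->
  sign_matrix (select_mx n [:: 0%N; n.-1]) (both_fun n) noneb.
Proof.
move=> n0; apply: sign_matrix_eq (@sign_matrix_select _ _) _ => i j Hi.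
by case: j => [|[|j]] //= _; rewrite /both_fun ?andbF ?orbF.
Qed.

Lemma ext_typeII_both n : (0 < n)%N -> ~~ odd n ->
  let P := mxpair_fst (summand_pair (@TypeII F n false)) in
  let Q := mxpair_snd (summand_pair (@TypeII F n false)) in
  congruent (MxPair (extP 1 P (select_mx n [:: 0%N; n.-1])) (extQ 1 2 Q))
    (summand_pair (TypeII (n + 4) false)).
Proof.
move=> n0 odd_n P Q; have [eP eQ] := @sign_matrix_II F n false.
have eC := sign_matrix_both n0.
have [e1 e2] := @sign_matrix_ext false _ _ _ _ _ _ _ _ _ _ eP eQ eC.
have [e1' e2'] := @sign_matrix_II F (n + 4) false.
apply: (congruent_sign (s := both_map n) (c := fun i => (i == 0)%N : nat)
  e1 e2 e1' e2').
- by rewrite /=; lia.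
- move=> i /= Hi; case: (eqVneq i 0) => ?; case: (eqVneq i 1) => ?;
  by case: (ltnP i n.+2) => ?; case: (eqVneq i n.+2) => ?; rewrite /=; lia.
- move=> i j /= Hi Hj; case: (eqVneq i 0) => ?; case: (eqVneq i 1) => ?;
    case: (ltnP i n.+2) => ?; case: (eqVneq i n.+2) => ?; try lia;
    case: (eqVneq j 0) => ?; case: (eqVneq j 1) => ?;
    case: (ltnP j n.+2) => ?; case: (eqVneq j n.+2) => ?; rewrite /=; lia.
- move=> i j /= Hi Hj; case: (eqVneq i 0) => ?; case: (eqVneq i 1) => ?;
    case: (ltnP i n.+2) => ?; case: (eqVneq i n.+2) => ?; try lia;
    case: (eqVneq j 0) => ?; case: (eqVneq j 1) => ?;
    case: (ltnP j n.+2) => ?; case: (eqVneq j n.+2) => ?; try lia; split;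
    rewrite /both_fun; ext_lia.
Qed.

Lemma ext_typeIII k : (0 < k)%N ->
  let P := mxpair_snd (summand_pair (@TypeIII F k)) in
  let Q := mxpair_fst (summand_pair (@TypeIII F k)) in
  congruent
    (MxPair (extQ (-1) 2 Q)
      (extP (-1) P (select_mx (4 * k) [:: 0%N; (4 * k).-1])))
    (summand_pair (TypeIII k.+1)).
Proof.
move=> k0 P Q; have [eQ eP] := @sign_matrix_III F k.
have n0 : (0 < 4 * k)%N by lia.
have eC := sign_matrix_both n0.
have [e1 e2] := @sign_matrix_ext true _ _ _ _ _ _ _ _ _ _ eP eQ eC.
have [e1' e2'] := @sign_matrix_III F k.+1.
(* The pairing of the dual vector with the old first vector has the wrong sign. Flipping the dual
   vector repairs it, and flipping its companion in K as well keeps X unchanged. *)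
apply: (congruent_sign (s := both_map (4 * k)%N) (c := fun i => (i < 2)%N : nat)
  e2 e1 e1' e2') => //.
- by rewrite /=; lia.
- move=> i /= Hi; case: (eqVneq i 0) => ?; case: (eqVneq i 1) => ?;
  by case: (ltnP i (4 * k).+2) => ?; case: (eqVneq i (4 * k).+2) => ?; rewrite /=; lia.
- move=> i j /= Hi Hj; case: (eqVneq i 0) => ?; case: (eqVneq i 1) => ?;
    case: (ltnP i (4 * k).+2) => ?; case: (eqVneq i (4 * k).+2) => ?; try lia;
    case: (eqVneq j 0) => ?; case: (eqVneq j 1) => ?;
    case: (ltnP j (4 * k).+2) => ?; case: (eqVneq j (4 * k).+2) => ?; rewrite /=; lia.
- move=> i j /= Hi Hj; case: (eqVneq i 0) => ?; case: (eqVneq i 1) => ?;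
    case: (ltnP i (4 * k).+2) => ?; case: (eqVneq i (4 * k).+2) => ?; try lia;
    case: (eqVneq j 0) => ?; case: (eqVneq j 1) => ?;
    case: (ltnP j (4 * k).+2) => ?; case: (eqVneq j (4 * k).+2) => ?; try lia; split;
    rewrite /both_fun; ext_lia.
Qed.

End Extension.

(** * Each summand of the list and its prolongation *)

Section SummandExtension.
Variable F : fieldType.

(** Index 0 is its own partner for [o] true, since [0.-1 = 0]; this self-pairing is the corner
    entry. *)
Lemma match_sym n o e i j : o || ~~ e -> (i < n)%N -> (j < n)%N ->
  symb o e i j (+) noneb i j = matched n o e i && (j == partner o i)
  /\ ~~ (symb o e i j && noneb i j).
Proof.
rewrite /matched /partner; case: (eqVneq i 0%N) => i0;
  case: o; case: e => //= _; case: (boolP (odd i)) => oi Hi Hj; split; bool_lia.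
Qed.

Lemma match_skew n o i j : (i < n)%N -> (j < n)%N ->
  upperb o i j (+) upperb o j i = matched n o false i && (j == partner o i)
  /\ ~~ (upperb o i j && upperb o j i).
Proof.
rewrite /matched /partner; case: (eqVneq i 0%N) => i0;
  case: o => //=; case: (boolP (odd i)) => oi Hi Hj; split; bool_lia.
Qed.

Lemma kernel_data_unit n (P : 'M[F]_n) (C : 'M_(n, 0)) :
  P \in unitmx -> kernel_data P C.
Proof.
move=> uP; exists 0, (invmx P); split; first exact: mul0mx.
  by rewrite mul0mx [RHS]flatmx0.
by rewrite mulmxV // mulmx0 addr0.
Qed.

Lemma kernel_data_unitP n (P : 'M[F]_n) (C : 'M_(n, 0)) :
  kernel_data P C -> P \in unitmx.
Proof.
case=> E [Z [_ _]]; rewrite (flatmx0 E) mulmx0 addr0 => PZ.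
by have [] := mulmx1_unit PZ.
Qed.

(** With no kernel the prolongation is the pair itself, but its size reads [0 + (n + 0)]; hence a
    base change in place of an equality. *)
Lemma ext_unit eps n (P Q : 'M[F]_n) (C : 'M_(n, 0)) :
  let U := col_mx 0 (col_mx 1%:M 0) : 'M[F]_(0 + (n + 0), n) in
  [/\ row_full U, extP eps P C = U *m P *m U^T & extQ eps 0 Q = U *m Q *m U^T].
Proof.
move=> U.
have UU : U^T *m U = 1%:M.
  rewrite /U !tr_col_mx !trmx0 trmx1 !mul_row_col.
  by rewrite !mul0mx mul1mx add0r addr0.
split; first by apply/row_fullP; exists U^T.
- rewrite /U !tr_col_mx !trmx0 trmx1 !mul_col_mx mul1mx !mul_mx_row !mulmx1.
  apply/matrixP => i j; rewrite -[i]splitK -[j]splitK.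
  case: (split i) => [[]//|i']; case: (split j) => [[]//|j'] /=.
  rewrite -[i']splitK -[j']splitK.
  case: (split i') => [{}i'|[]//]; case: (split j') => [{}j'|[]//] /=.
  by rewrite block_mxEdr block_mxEul col_mxEd col_mxEu row_mxEr row_mxEl.
- rewrite /U !tr_col_mx !trmx0 trmx1 !mul_col_mx mul1mx !mul_mx_row !mulmx1.
  apply/matrixP => i j; rewrite -[i]splitK -[j]splitK.
  case: (split i) => [[]//|i']; case: (split j) => [[]//|j'] /=.
  rewrite -[i']splitK -[j']splitK.
  case: (split i') => [{}i'|[]//]; case: (split j') => [{}j'|[]//] /=.
  by rewrite block_mxEdr block_mxEul col_mxEd col_mxEu row_mxEr row_mxEl.
Qed.

Lemma congruent_unit n n' (A B : 'M[F]_n) (A' B' : 'M[F]_n') :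
  congruent (MxPair A B) (MxPair A' B') -> A' \in unitmx -> B' \in unitmx ->
  A \in unitmx /\ B \in unitmx.
Proof.
move=> /congruent_frameP [e [U [full -> ->]]]; subst n'.
by rewrite !unitmx_mul => /andP [/andP [_ ->] _] /andP [/andP [_ ->] _].
Qed.

Lemma hyper_unit k (L : 'M[F]_k) (a : F) : a != 0 -> L \in unitmx ->
  block_mx 0 L (a *: L^T) 0 \in unitmx.
Proof.
move=> a0 uL.
have E : block_mx 0 L (a *: L^T) 0 *m
    block_mx 0 (a^-1 *: (invmx L)^T) (invmx L) 0 = 1%:M.
  rewrite mulmx_block !(mul0mx, mulmx0, addr0, add0r) mulmxV //.
  rewrite -scalemxAl -scalemxAr scalerA mulfV // scale1r -trmx_mul mulVmx //.
  by rewrite trmx1 -scalar_mx_block.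
by have [] := mulmx1_unit E.
Qed.

Lemma jordan_unit k (l : F) : l != 0 -> jordan_block k l \in unitmx.
Proof.
move=> l0; rewrite -unitmx_tr unitmxE det_trig; last first.
  by apply/is_trig_mxP=> i j ij; rewrite !mxE -val_eqE /=; do 2 decide_atom; rewrite addr0.
rewrite unitfE; apply/prodf_neq0 => i _.
by rewrite !mxE eqxx (_ : _ == _ :> nat = false) ?addr0 //; lia.
Qed.

Hypothesis two_neq0 : 1 + 1 != 0 :> F.

Lemma typeI_unit k (l : F) : l != 0 ->
  mxpair_fst (summand_pair (TypeI k l)) \in unitmx /\
  mxpair_snd (summand_pair (TypeI k l)) \in unitmx.
Proof.
move=> l0; have l20 : l + l != 0 by rewrite -[l]mulr1 -mulrDr mulf_neq0.
apply: (congruent_unit (typeI_hyper k l20)).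
  by rewrite -[_^T]scale1r hyper_unit ?oner_eq0 ?unitmx1.
by rewrite -scaleN1r hyper_unit ?oppr_eq0 ?oner_eq0 ?jordan_unit.
Qed.

(** The packed pair and the existential sizes let one statement cover all types; [s = 0] is the case
    of a nonsingular first matrix. *)
Definition ext_first_spec (p : mxpair F) :=
  exists n, exists A : 'M_n, exists B : 'M_n, [/\ p = MxPair A B, (0 < n)%N &
  exists s, exists C : 'M_(n, s), exists t,
  [/\ kernel_data A C, summand_valid t &
      congruent (MxPair (extP 1 A C) (extQ 1 s B)) (summand_pair t)]].

Definition ext_second_spec (p : mxpair F) :=
  exists n, exists A : 'M_n, exists B : 'M_n, [/\ p = MxPair A B, (0 < n)%N &
  exists s, exists C : 'M_(n, s), exists t,
  [/\ kernel_data B C, summand_valid t &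
      congruent (MxPair (extQ (-1) s A) (extP (-1) B C)) (summand_pair t)]].

Lemma ext_first_unit t n (A B : 'M[F]_n) : summand_valid t ->
  summand_pair t = MxPair A B -> (0 < n)%N -> A \in unitmx ->
  ext_first_spec (summand_pair t).
Proof.
move=> vt Et n0 uA; exists n, A, B; split=> //; exists 0, 0, t; split=> //.
  exact: kernel_data_unit.
have [full eP eQ] := ext_unit 1 A B 0.
by rewrite Et; apply: congruent_sym; apply: congruent_frame full eP eQ; rewrite addn0.
Qed.

Lemma ext_second_unit t n (A B : 'M[F]_n) : summand_valid t ->
  summand_pair t = MxPair A B -> (0 < n)%N -> B \in unitmx ->
  ext_second_spec (summand_pair t).
Proof.
move=> vt Et n0 uB; exists n, A, B; split=> //; exists 0, 0, t; split=> //.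
  exact: kernel_data_unit.
have [full eP eQ] := ext_unit (-1) B A 0.
by rewrite Et; apply: congruent_sym; apply: congruent_frame full eQ eP; rewrite addn0.
Qed.

(** X is singular only in type (ii): at the last vector for n even and epsilon = 1, at the first for
    n odd and epsilon = 0, at both for n even and epsilon = 0. In the last case the size grows by 4
    and stays off the multiples of 4. *)
Lemma summand_ext_first t : summand_valid t -> ext_first_spec (summand_pair t).
Proof.
case: t => [k l|n e|k] vt.
- have /andP [k0 l0] := vt; have [uA uB] := typeI_unit k l0.
  by apply: ext_first_unit vt _ _ uA; rewrite //=; lia.
- have /andP [n0 v] := vt; have [eX eY] := @sign_matrix_II F n e.
  case: e v vt eX eY => v vt eX eY.
    case: (boolP (odd n)) => on.
      apply: (ext_first_unit vt (erefl _)) => //.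
      apply: (@kernel_data_unitP _ _ (select_mx F n [::])).
      apply: (kernel_data_matching (u := [::]) (o := true) (e := true) eX) => //.
        by move=> i j; apply: match_sym.
      by move=> i /= Hi; rewrite /matched in_nil; case: (boolP (odd i)) => oi; bool_lia.
    do 3 eexists; split; [reflexivity|by []|].
    exists 1%N, (select_mx F n [:: n.-1]), (TypeII (n + 2) true); split.
    + apply: (kernel_data_matching (u := [:: n.-1]) (o := true) (e := true) eX) => //.
      * by move=> i j; apply: match_sym.
      * by move=> i /= Hi; rewrite /matched inE; case: (boolP (odd i)) => oi; bool_lia.
      * by rewrite /= andbT; lia.
    + by rewrite /= addn2 implybT.
    + exact: ext_typeII_last.
  case: (boolP (odd n)) => on.
    do 3 eexists; split; [reflexivity|by []|].
    exists 1%N, (select_mx F n [:: 0%N]), (TypeII (n + 2) false); split.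
    + apply: (kernel_data_matching (u := [:: 0%N]) (o := true) (e := false) eX) => //.
      * by move=> i j; apply: match_sym.
      * by move=> i /= Hi; rewrite /matched inE; case: (boolP (odd i)) => oi; bool_lia.
      * by rewrite /= andbT; lia.
    + by move: v => /=; lia.
    + exact: ext_typeII_first.
  do 3 eexists; split; [reflexivity|by []|].
  exists 2%N, (select_mx F n [:: 0%N; n.-1]), (TypeII (n + 4) false); split.
  + apply: (kernel_data_matching (u := [:: 0%N; n.-1]) (o := true) (e := false) eX) => //.
    * by move=> i j; apply: match_sym.
    * by rewrite /= inE andbT; lia.
    * by move=> i /= Hi; rewrite /matched !inE; case: (boolP (odd i)) => oi; bool_lia.
    * by rewrite /= andbT; lia.
  + by move: v => /=; lia.
  + exact: ext_typeII_both.
- have [eX eY] := @sign_matrix_III F k; rewrite /= in vt.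
  apply: (@ext_first_unit (TypeIII k) _ _ _ vt (erefl _)); first by lia.
  apply: (@kernel_data_unitP _ _ (select_mx F (4 * k) [::])).
  apply: (kernel_data_matching (u := [::]) (o := false) (e := false) eX) => //.
    by move=> i j; apply: match_sym.
  by move=> i /= Hi; rewrite /matched in_nil; case: (boolP (odd i)) => oi; bool_lia.
Qed.

(** Y is singular at the last vector in type (ii) with n odd, and at both ends in type (iii). *)
Lemma summand_ext_second t : summand_valid t -> ext_second_spec (summand_pair t).
Proof.
case: t => [k l|n e|k] vt.
- have /andP [k0 l0] := vt; have [uA uB] := typeI_unit k l0.
  by apply: ext_second_unit vt _ _ uB; rewrite //=; lia.
- have /andP [n0 v] := vt; have [eX eY] := @sign_matrix_II F n e.
  case: (boolP (odd n)) => on.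
    do 3 eexists; split; [reflexivity|by []|].
    exists 1%N, (select_mx F n [:: n.-1]), (TypeII (n + 2) e); split.
    + apply: (kernel_data_matching (u := [:: n.-1]) (o := false) (e := false) eY) => //.
      * by move=> i j; apply: match_skew.
      * by move=> i /= Hi; rewrite /matched inE; case: (boolP (odd i)) => oi; bool_lia.
      * by rewrite /= andbT; lia.
    + by move: v => /=; lia.
    + exact: ext_skew_last.
  apply: (ext_second_unit vt (erefl _)) => //.
  apply: (@kernel_data_unitP _ _ (select_mx F n [::])).
  apply: (kernel_data_matching (u := [::]) (o := false) (e := false) eY) => //.
    by move=> i j; apply: match_skew.
  by move=> i /= Hi; rewrite /matched in_nil; case: (boolP (odd i)) => oi; bool_lia.
- have [eX eY] := @sign_matrix_III F k; rewrite /= in vt.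
  do 3 eexists; split; [reflexivity|by lia|].
  exists 2%N, (select_mx F (4 * k) [:: 0%N; (4 * k).-1]), (TypeIII k.+1); split.
  + apply: (kernel_data_matching (u := [:: 0%N; (4 * k).-1]) (o := true) (e := false) eY) => //.
    * by move=> i j; apply: match_skew.
    * by rewrite /= inE andbT; lia.
    * by move=> i /= Hi; rewrite /matched !inE; case: (boolP (odd i)) => oi; bool_lia.
    * by rewrite /= andbT; lia.
  + by [].
  + exact: ext_typeIII.
Qed.

End SummandExtension.

(** * Splitting off a summand when one matrix is singular *)

Section Splitting.
Variable F : fieldType.

Lemma row_complement n w (W : 'M[F]_(w, n)) : row_free W ->
  exists u, exists U : 'M[F]_(u, n), (w + u)%N = n /\ (1%:M <= W + U)%MS.
Proof.
move=> fW; exists (\rank W^C)%MS, (row_base W^C)%MS; split.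
  rewrite mxrank_compl; have := rank_leq_col W.
  by move/eqP: fW => ->; lia.
have := addsmx_compl_full W; rewrite -sub1mx => /submx_trans; apply.
by rewrite addsmxS // eq_row_base.
Qed.

Lemma orth_split n w (eps : F) (M : 'M[F]_n) (W : 'M_(w, n)) :
  M^T = eps *: M -> W *m M *m W^T \in unitmx ->
  exists u, exists U : 'M[F]_(u, n),
  [/\ (w + u)%N = n, (1%:M <= W + U)%MS, U *m M *m W^T = 0 & W *m M *m U^T = 0].
Proof.
move=> sM uG; set G := W *m M *m W^T in uG.
pose N := M *m W^T; exists (\rank (kermx N)); pose U := row_base (kermx N).
have KN : U *m M *m W^T = 0.
  by apply/eqP; rewrite -mulmxA -/N -sub_kermx eq_row_base.
exists U; split=> //.
- rewrite mxrank_ker; have rN : \rank N = w.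
    apply/eqP; rewrite eqn_leq rank_leq_col /=.
    have := mxrankM_maxr W N; rewrite mulmxA -/G.
    by have := uG; rewrite -row_free_unit => /eqP ->.
  by rewrite rN; have := rank_leq_row N; rewrite rN; lia.
(* Projection onto the span of [W] along its orthogonal complement. *)
- pose X := N *m invmx G *m W.
  have -> : 1%:M = X + (1%:M - X) :> 'M[F]_n by rewrite addrC subrK.
  rewrite addmx_sub_adds // ?submxMl // eq_row_base.
  apply/sub_kermxP; rewrite mulmxBl mul1mx /X -!mulmxA.
  by rewrite [W *m _]mulmxA -/G mulVmx // mulmx1 subrr.
- apply: trmx_inj; rewrite trmx0 trmx_mul trmxK [(W *m M)^T]trmx_mul sM -scalemxAl -scalemxAr.
  by rewrite mulmxA KN scaler0.
Qed.

(** The relation [W *m P = X *m (W *m Q)] says that the functionals which P draws from W are among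
    those drawn by Q, so the Q-complement of W is also P-orthogonal to it. *)
Lemma orth_split2 n w (eps eta : F) (P Q : 'M[F]_n) (W : 'M_(w, n)) (X : 'M_w) :
  P^T = eps *: P -> Q^T = eta *: Q -> W *m Q *m W^T \in unitmx ->
  W *m P = X *m (W *m Q) ->
  exists u, exists U : 'M[F]_(u, n),
  [/\ (w + u)%N = n, (1%:M <= W + U)%MS,
     (U *m Q *m W^T = 0 /\ W *m Q *m U^T = 0) &
     (U *m P *m W^T = 0 /\ W *m P *m U^T = 0)].
Proof.
move=> sP sQ uG WP; have [u [U [e full UW WU]]] := orth_split sQ uG.
have WPU : W *m P *m U^T = 0 by rewrite WP -mulmxA WU mulmx0.
exists u, U; split=> //; split=> //.
apply: trmx_inj; rewrite trmx0 !trmx_mul trmxK sP -scalemxAl -scalemxAr.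
by rewrite mulmxA WPU scaler0.
Qed.

Lemma sub_tr_mul0 k l m n (A : 'M[F]_(k, n)) (B : 'M_(l, n)) (X : 'M_(m, n)) :
  (A <= B)%MS -> X *m B^T = 0 -> X *m A^T = 0.
Proof. by case/submxP=> D ->; rewrite trmx_mul mulmxA => ->; rewrite mul0mx. Qed.

Lemma full3_eq0 a b c m n (X : 'M[F]_(a, n)) (Y : 'M_(b, n)) (Z : 'M_(c, n))
    (M : 'M_(m, n)) : (1%:M <= X + (Y + Z))%MS ->
  M *m X^T = 0 -> M *m Y^T = 0 -> M *m Z^T = 0 -> M = 0.
Proof.
move=> full MX MY MZ.
have : M *m 1%:M^T = 0.
  apply: sub_tr_mul0 full _; apply: sub_tr_mul0 (_ : _ <= col_mx X (col_mx Y Z))%MS _.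
    by rewrite -addsmxE addsmxS // -addsmxE.
  by rewrite !tr_col_mx !mul_mx_row MX MY MZ !row_mx0.
by rewrite trmx1 mulmx1.
Qed.

Lemma row_free_normal s k (M : 'M[F]_(s, k)) : row_free M ->
  exists q, exists R : 'M_(k, s + q), exists R' : 'M_(s + q, k),
  [/\ k = (s + q)%N, R' *m R = 1%:M, R *m R' = 1%:M & M *m R = row_mx 1%:M 0].
Proof.
case/row_complement=> q [N [e full]]; exists q; subst k.
have uMN : col_mx M N \in unitmx.
  by rewrite -row_full_unit -sub1mx -addsmxE.
exists (invmx (col_mx M N)), (col_mx M N); split=> //; first exact: mulmxV.
  exact: mulVmx.
have := mulmxV uMN; rewrite mul_col_mx scalar_mx_block /block_mx.
by case/eq_col_mx.
Qed.

(** Read off from the rank normal form A = L D R: the last columns of L, the last rows of its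
    inverse, and a generalized inverse of A. *)
Lemma kernel_data_exists n (A : 'M[F]_n) :
  exists s, exists C : 'M_(n, s), kernel_data A C.
Proof.
pose r := \rank A; have [q e] : exists q, n = (r + q)%N.
  by exists (n - r)%N; rewrite subnKC ?rank_leq_row.
move: (col_ebase_unit A) (row_ebase_unit A) (mulmx_ebase A); rewrite -/r.
move: (col_ebase A) (row_ebase A) => L R; move: r e => r e; subst n.
move=> uL uR EA; exists q, (L *m col_mx 0 1%:M), (row_mx 0 1%:M *m invmx L).
have Epid : pid_mx r = block_mx 1%:M 0 0 0 :> 'M[F]_(r + q).
  by rewrite -pid_mx_block.
exists (invmx R *m pid_mx r *m invmx L); split.
- rewrite -EA Epid -!mulmxA [invmx L *m _]mulmxA mulVmx // mul1mx mulmxA.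
  by rewrite mul_row_block !(mul0mx, mulmx0, mul1mx, addr0) row_mx0 mul0mx.
- rewrite -mulmxA [invmx L *m _]mulmxA mulVmx // mul1mx mul_row_col.
  by rewrite mul0mx mul1mx add0r.
- rewrite -EA -!mulmxA [R *m _]mulmxA mulmxV // mul1mx.
  rewrite -mulmxDr (mulmxA (pid_mx r) (pid_mx r)) (mulmxA (col_mx 0 _)) -mulmxDl.
  rewrite Epid mulmx_block mul_col_row add_block_mx.
  rewrite !(mul0mx, mulmx0, mul1mx, addr0, add0r) -scalar_mx_block mul1mx.
  by rewrite mulmxV.
Qed.

Lemma kernel_data_add n1 s1 n2 s2 (A1 : 'M[F]_n1) (C1 : 'M_(n1, s1))
    (A2 : 'M_n2) (C2 : 'M_(n2, s2)) :
  kernel_data A1 C1 -> kernel_data A2 C2 ->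
  kernel_data (block_mx A1 0 0 A2) (block_mx C1 0 0 C2).
Proof.
move=> [E1 [Z1 [a1 b1 c1]]] [E2 [Z2 [a2 b2 c2]]].
exists (block_mx E1 0 0 E2), (block_mx Z1 0 0 Z2).
rewrite !mulmx_block add_block_mx !(mul0mx, mulmx0, addr0, add0r).
by rewrite a1 b1 c1 a2 b2 c2 -!scalar_mx_block block_mx0.
Qed.

Lemma form_tr n (eps : F) (M : 'M[F]_n) a b (X : 'M_(a, n)) (Y : 'M_(b, n)) :
  M^T = eps *: M -> (Y *m M *m X^T)^T = eps *: (X *m M *m Y^T).
Proof.
move=> sM; rewrite trmx_mul trmxK [(Y *m M)^T]trmx_mul sM.
by rewrite -scalemxAl -scalemxAr mulmxA.
Qed.

(* Y is dual to K under Q and U is the Q-complement of K + Y.  The result makes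
   the P-pairings of Y normal: first Y moves modulo U, which spoils
   the Q-orthogonality, then adding multiples of K, which P does not see,
   restores it. *)
Section Frame.
Variables (eps : F) (n k m : nat) (P Q : 'M[F]_n).
Variables (K Y : 'M[F]_(k, n)) (U : 'M[F]_(m, n)).
Variables (s : nat) (C : 'M[F]_(m, s)).
Hypothesis two_neq0 : 1 + 1 != 0 :> F.
Hypothesis eps2 : eps * eps = 1.
Hypothesis sP : P^T = eps *: P.
Hypothesis sQ : Q^T = - eps *: Q.
Hypothesis size_frame : (k + (k + m))%N = n.
Hypothesis full : (1%:M <= K + (Y + U))%MS.
Hypothesis KP : K *m P = 0.
Hypothesis kerP : forall v : 'rV_n, v *m P = 0 -> (v <= K)%MS.
Hypothesis KQK : K *m Q *m K^T = 0.
Hypothesis YQK : Y *m Q *m K^T = 1%:M.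
Hypothesis UQK : U *m Q *m K^T = 0.
Hypothesis UQY : U *m Q *m Y^T = 0.
Hypothesis dataC : kernel_data (U *m P *m U^T) C.

Lemma frame_eps0 : eps != 0.
Proof. by apply: contraNneq (oner_neq0 F) => e; rewrite -eps2 e mulr0. Qed.

Lemma frame_KQY : K *m Q *m Y^T = - eps *: 1%:M.
Proof. by have := form_tr K Y sQ; rewrite YQK trmx1 => E; rewrite E scalerA mulrNN eps2 scale1r. Qed.

Lemma frame_U_free : row_free U.
Proof.
have := mxrank_adds_leqif K (Y + U)%MS; have := mxrank_adds_leqif Y U.
move=> [h1 _] [h2 _]; have := mxrankS full; rewrite mxrank1.
have := rank_leq_row K; have := rank_leq_row Y; have := rank_leq_row U.
by rewrite /row_free; lia.
Qed.

Lemma frame_PK a (X : 'M_(a, n)) : X *m P *m K^T = 0.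
Proof.
apply: trmx_inj; rewrite (form_tr K X sP) KP mul0mx scaler0.
by rewrite trmx0.
Qed.

Lemma frame_ker v : v *m P = 0 -> v *m Q *m Y^T = 0 -> v = 0 :> 'rV_n.
Proof.
move/kerP/submxP=> [a ->]; rewrite -!mulmxA [K *m _]mulmxA frame_KQY.
rewrite -scalemxAr mulmx1 => /eqP; rewrite scaler_eq0 oppr_eq0 (negPf frame_eps0).
by move/eqP ->; rewrite mul0mx.
Qed.

Lemma singular_frame : exists q, exists K' : 'M_(s + q, n),
  exists Y' : 'M_(s + q, n), exists U' : 'M_(m, n), exists D : 'M_q,
  [/\ k = (s + q)%N /\ (1%:M <= K' + (Y' + U'))%MS, K' *m P = 0,
   [/\ K' *m Q *m K'^T = 0, Y' *m Q *m K'^T = 1%:M & Y' *m Q *m Y'^T = 0],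
   [/\ U' *m Q *m K'^T = 0, U' *m Q *m Y'^T = 0 &
       U' *m Q *m U'^T = U *m Q *m U^T] &
   [/\ U' *m P *m U'^T = U *m P *m U^T, U' *m P *m Y'^T = row_mx C 0 &
       Y' *m P *m Y'^T = block_mx 0 0 0 D]].
Proof.
case: dataC; set A := U *m P *m U^T => E [Z [EA EC AZ]].
pose Cy := U *m P *m Y^T.
(* A combination u E U that is P-orthogonal to Y is P-orthogonal to everything, hence lies in K;
   being also Q-orthogonal to Y, it is zero. *)
have fEC : row_free (E *m Cy).
  rewrite -kermx_eq0; apply/rowV0P => u /sub_kermxP uEC.
  have uEU0 : u *m E *m U = 0.
    apply: frame_ker.
      apply: (full3_eq0 full); first exact: frame_PK.
        by rewrite -[RHS]uEC /Cy !mulmxA.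
      have := congr1 (mulmx u) EA; rewrite mulmx0 => <-.
      by rewrite /A !mulmxA.
    by rewrite -mulmxA -mulmxA [U *m _]mulmxA UQY mulmx0.
  have : u *m E = 0.
    by move/row_freeP: frame_U_free => [V UV]; rewrite -[LHS]mulmx1 -UV mulmxA uEU0 mul0mx.
  by move/(congr1 (mulmx^~ C)); rewrite -mulmxA EC mulmx1 mul0mx.
have [q [R [R' [ek R'R RR' ECR]]]] := row_free_normal fEC.
have sA : A^T = eps *: A by apply: form_tr.
have AE : A *m E^T = 0.
  by apply: trmx_inj; rewrite trmx_mul trmxK trmx0 sA -scalemxAr EA scaler0.
have [K1 eK1] : exists K1, K1 = R' *m K by exists (R' *m K).
have K1P : K1 *m P = 0 by rewrite eK1 -mulmxA KP mulmx0.
have PK1 a (X : 'M_(a, n)) : X *m P *m K1^T = 0.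
  by rewrite eK1 trmx_mul mulmxA frame_PK mul0mx.
have K1QK1 : K1 *m Q *m K1^T = 0.
  transitivity (R' *m (K *m Q *m K^T) *m R'^T); first by rewrite eK1 trmx_mul !mulmxA.
  by rewrite KQK mulmx0 mul0mx.
have UQK1 : U *m Q *m K1^T = 0 by rewrite eK1 trmx_mul mulmxA UQK mul0mx.
have K1QU : K1 *m Q *m U^T = 0.
  by apply: trmx_inj; rewrite (form_tr U K1 sQ) UQK1 trmx0 scaler0.
(* The excess of the pairing over its normal form. E kills it, so it equals A (Z W0) and can be
   removed by moving Y along U. *)
pose W0 := Cy *m R - row_mx C 0.
have EW0 : E *m W0 = 0.
  by rewrite /W0 mulmxBr mulmxA ECR mul_mx_row EC mulmx0 subrr.
have AZW : A *m (Z *m W0) = W0.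
  have := congr1 (mulmx^~ W0) AZ; rewrite mul1mx mulmxDl -!mulmxA EW0.
  by rewrite mulmx0 addr0.
have [Y2 eY2] : exists Y2, Y2 = R^T *m Y - (Z *m W0)^T *m U by eexists.
have UPY2 : U *m P *m Y2^T = row_mx C 0.
  rewrite eY2 linearB /= !trmx_mul !trmxK mulmxBr !mulmxA -/A -/Cy.
  by rewrite -(mulmxA A) AZW /W0 opprB addrC subrK.
have Y2PU : Y2 *m P *m U^T = eps *: (row_mx C 0)^T.
  by have := form_tr Y2 U sP; rewrite UPY2 => ->; rewrite scalerA eps2 scale1r.
pose D2 := Y2 *m P *m Y2^T.
have sD2 : D2^T = eps *: D2 by apply: form_tr.
(* Adding X E U keeps the pairings with U and changes the Gram matrix of Y by (X 0) plus [eps] times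
   its transpose. The upper left block is met by both terms, hence the half; each off-diagonal block
   by one. *)
pose hf : F := (1 + 1)^-1.
pose X : 'M_(s + q, s) := col_mx (- hf *: ulsubmx D2) (- dlsubmx D2).
have [Y3 eY3] : exists Y3, Y3 = Y2 + X *m E *m U by eexists.
have UPY3 : U *m P *m Y3^T = row_mx C 0.
  rewrite eY3 linearD /= !trmx_mul mulmxDr UPY2 !mulmxA -/A.
  by rewrite AE mul0mx addr0.
have Y3PU : Y3 *m P *m U^T = eps *: (row_mx C 0)^T.
  by have := form_tr Y3 U sP; rewrite UPY3 => ->; rewrite scalerA eps2 scale1r.
have hf2 : hf + hf = 1 by rewrite /hf -[X in X + X]mulr1 -mulrDr mulVf.
have XEC : X *m E *m row_mx C 0 = row_mx X 0 :> 'M_(s + q).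
  by rewrite mul_mx_row mulmx0 -mulmxA EC mulmx1.
have eD2 := submxK D2; move: sD2; rewrite -{1 2}eD2 tr_block_mx scale_block_mx.
case/eq_block_mx => sul sdl _ _.
have Y3PY3 : Y3 *m P *m Y3^T = block_mx 0 0 0 (drsubmx D2).
  rewrite {2}eY3 linearD /= mulmxDr !trmx_mul !mulmxA Y3PU.
  rewrite {1}eY3 !mulmxDl -/D2 -!(mulmxA (X *m E)) UPY2 XEC.
  have -> : eps *: (row_mx C (0 : 'M_(m, q)))^T *m E^T *m X^T =
      eps *: (row_mx X (0 : 'M_(s + q, q)))^T.
    by rewrite -XEC !trmx_mul -!scalemxAl mulmxA.
  rewrite -{1}eD2 (_ : row_mx X (0 : 'M_(s + q, q)) =
    block_mx (- hf *: ulsubmx D2) 0 (- dlsubmx D2) 0); last first.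
    by rewrite block_mxEh col_mx0.
  rewrite tr_block_mx scale_block_mx !add_block_mx !trmx0 !scaler0 !addr0.
  rewrite !linearN linearZ /= sul sdl !scalerA (mulrAC eps) eps2 mul1r scale1r.
  by rewrite -addrA -scalerDl -opprD hf2 scaleN1r !subrr.
have K1QY3 : K1 *m Q *m Y3^T = - eps *: 1%:M.
  rewrite eY3 [(_ + _)^T]linearD /= mulmxDr [(_ *m U)^T]trmx_mul mulmxA K1QU mul0mx.
  rewrite addr0 eY2 [(_ - _)^T]linearB /= mulmxBr !trmx_mul !trmxK !mulmxA K1QU.
  rewrite !mul0mx subr0 eK1 -!(mulmxA R') frame_KQY -scalemxAl mul1mx.
  by rewrite -scalemxAr R'R.
have Y3QK1 : Y3 *m Q *m K1^T = 1%:M.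
  apply: trmx_inj; rewrite (form_tr K1 Y3 sQ) K1QY3 scalerA mulrNN eps2 scale1r.
  by rewrite trmx1.
(* The coefficients [be] and [d] solve linear equations, as Q pairs K1 with Y3 by - [eps]. The half
   in [d] is there because its correction to the Gram matrix of Y3 occurs twice. *)
have [be ebe] : exists be, be = eps *: (U *m Q *m Y3^T) by eexists.
have [U' eU'] : exists U', U' = U + be *m K1 by eexists.
have [de ede] : exists de, de = Y3 *m Q *m Y3^T by eexists.
have [d ed] : exists d, d = (eps * hf) *: de by eexists.
have [Y' eY'] : exists Y', Y' = Y3 + d *m K1 by eexists.
have sde : de^T = - eps *: de by rewrite ede; apply: form_tr.
have U'QK1 : U' *m Q *m K1^T = 0.
  by rewrite eU' !mulmxDl UQK1 -!mulmxA (mulmxA K1) K1QK1 mulmx0 addr0.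
have U'QY3 : U' *m Q *m Y3^T = 0.
  rewrite eU' !mulmxDl -!(mulmxA be) K1QY3 -scalemxAr mulmx1 ebe scalerA.
  by rewrite mulNr eps2 scaleN1r subrr.
have U'P : U' *m P = U *m P by rewrite eU' mulmxDl -mulmxA K1P mulmx0 addr0.
have Y'P : Y' *m P = Y3 *m P by rewrite eY' mulmxDl -mulmxA K1P mulmx0 addr0.
have PU' a (M : 'M_(a, n)) : M *m P *m U'^T = M *m P *m U^T.
  by rewrite eU' linearD /= trmx_mul mulmxDr mulmxA PK1 mul0mx addr0.
have PY' a (M : 'M_(a, n)) : M *m P *m Y'^T = M *m P *m Y3^T.
  by rewrite eY' linearD /= trmx_mul mulmxDr mulmxA PK1 mul0mx addr0.
have Y'QK1 : Y' *m Q *m K1^T = 1%:M.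
  by rewrite eY' !mulmxDl Y3QK1 -!mulmxA (mulmxA K1) K1QK1 mulmx0 addr0.
exists q, K1, Y', U', (drsubmx D2); split; rewrite ?PU' ?PY' ?U'P ?Y'P //.
- split=> //; apply: submx_trans full _; set S := (K1 + _)%MS.
  have sK1 : (K1 <= S)%MS by apply: addsmxSl.
  have sY' : (Y' <= S)%MS by apply: submx_trans (addsmxSl _ _) (addsmxSr _ _).
  have sU' : (U' <= S)%MS by apply: submx_trans (addsmxSr _ _) (addsmxSr _ _).
  have sU : (U <= S)%MS.
    have -> : U = U' - be *m K1 by rewrite eU' addrK.
    by rewrite addmx_sub // eqmx_opp mulmx_sub.
  have sK : (K <= S)%MS.
    have -> : K = R *m K1 by rewrite eK1 mulmxA RR' mul1mx.
    exact: mulmx_sub.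
  have sY3 : (Y3 <= S)%MS.
    have -> : Y3 = Y' - d *m K1 by rewrite eY' addrK.
    by rewrite addmx_sub // eqmx_opp mulmx_sub.
  have sY2 : (Y2 <= S)%MS.
    have -> : Y2 = Y3 - X *m E *m U by rewrite eY3 addrK.
    by rewrite addmx_sub // eqmx_opp mulmx_sub.
  have sY : (Y <= S)%MS.
    have -> : Y = R'^T *m (Y2 + (Z *m W0)^T *m U).
      by rewrite eY2 subrK mulmxA -trmx_mul RR' trmx1 mul1mx.
    by rewrite mulmx_sub // addmx_sub // mulmx_sub.
  by rewrite !addsmx_sub sK sY sU.
- split=> //; rewrite {2}eY' linearD /= trmx_mul mulmxDr mulmxA Y'QK1 mul1mx.
  rewrite eY' !mulmxDl -ede -!(mulmxA d) K1QY3 -scalemxAr mulmx1 ed [(_ *: de)^T]linearZ /= sde.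
  rewrite !scalerA mulNr mulrA eps2 mul1r mulrN mulrAC eps2 mul1r.
  by rewrite -addrA -scalerDl -opprD hf2 scaleN1r subrr.
- split=> //.
    by rewrite eY' linearD /= trmx_mul mulmxDr mulmxA U'QK1 mul0mx addr0.
  rewrite {2}eU' linearD /= trmx_mul mulmxDr mulmxA U'QK1 mul0mx addr0.
  by rewrite eU' !mulmxDl -!(mulmxA be) K1QU mulmx0 addr0.
Qed.

End Frame.
End Splitting.

(** * Orthogonal summands of a pair with one singular form *)

Section SingularSplit.
Variable F : fieldType.
Hypothesis two_neq0 : 1 + 1 != 0 :> F.

(** [T] receives the Gram matrices in the order (P, Q), so the same splitting serves whichever of A,
    B is singular. *)
Definition peelable n (P Q : 'M[F]_n) (T : forall w, 'M[F]_w -> 'M[F]_w -> Prop) :=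
  exists w, exists u, exists W : 'M_(w, n), exists U : 'M_(u, n),
  [/\ (0 < w)%N /\ (w + u)%N = n, (1%:M <= W + U)%MS,
   (U *m P *m W^T = 0 /\ W *m P *m U^T = 0),
   (U *m Q *m W^T = 0 /\ W *m Q *m U^T = 0) &
   T w (W *m P *m W^T) (W *m Q *m W^T)].

Lemma gram_col n a b c d (M : 'M[F]_n) (X : 'M_(a, n)) (X' : 'M_(b, n))
    (Y : 'M_(c, n)) (Y' : 'M_(d, n)) :
  col_mx X X' *m M *m (col_mx Y Y')^T =
  block_mx (X *m M *m Y^T) (X *m M *m Y'^T) (X' *m M *m Y^T) (X' *m M *m Y'^T).
Proof. by rewrite tr_col_mx mul_col_mx mul_col_row. Qed.

Lemma gram_eq_block n a b c d (M : 'M[F]_n) (X : 'M_(a, n)) (X' : 'M_(b, n))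
    (Y : 'M_(c, n)) (Y' : 'M_(d, n)) e11 e12 e21 e22 :
  col_mx X X' *m M *m (col_mx Y Y')^T = block_mx e11 e12 e21 e22 ->
  [/\ X *m M *m Y^T = e11, X *m M *m Y'^T = e12, X' *m M *m Y^T = e21 &
      X' *m M *m Y'^T = e22].
Proof. by rewrite gram_col => /eq_block_mx. Qed.

Lemma gram_eq_row n a c d (M : 'M[F]_n) (X : 'M_(a, n))
    (Y : 'M_(c, n)) (Y' : 'M_(d, n)) e1 e2 :
  X *m M *m (col_mx Y Y')^T = row_mx e1 e2 ->
  X *m M *m Y^T = e1 /\ X *m M *m Y'^T = e2.
Proof. by rewrite tr_col_mx mul_mx_row => /eq_row_mx. Qed.

Lemma gram_eq0l n a b c (M : 'M[F]_n) (X : 'M_(a, n)) (X' : 'M_(b, n))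
    (Y : 'M_(c, n)) :
  col_mx X X' *m M *m Y^T = 0 -> X *m M *m Y^T = 0 /\ X' *m M *m Y^T = 0.
Proof. by rewrite !mul_col_mx -[RHS]col_mx0 => /eq_col_mx. Qed.

Lemma gram_eq0r n a c d (M : 'M[F]_n) (X : 'M_(a, n))
    (Y : 'M_(c, n)) (Y' : 'M_(d, n)) :
  X *m M *m (col_mx Y Y')^T = 0 -> X *m M *m Y^T = 0 /\ X *m M *m Y'^T = 0.
Proof. by move=> E; apply: gram_eq_row; rewrite E row_mx0. Qed.

Lemma gram0l n a b c (M : 'M[F]_n) (X : 'M_(a, n)) (X' : 'M_(b, n))
    (Y : 'M_(c, n)) :
  X *m M *m Y^T = 0 -> X' *m M *m Y^T = 0 -> col_mx X X' *m M *m Y^T = 0.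
Proof. by move=> E E'; rewrite !mul_col_mx E E' col_mx0. Qed.

Lemma gram0r n a c d (M : 'M[F]_n) (X : 'M_(a, n))
    (Y : 'M_(c, n)) (Y' : 'M_(d, n)) :
  X *m M *m Y^T = 0 -> X *m M *m Y'^T = 0 -> X *m M *m (col_mx Y Y')^T = 0.
Proof. by move=> E E'; rewrite tr_col_mx mul_mx_row E E' row_mx0. Qed.

Lemma form0_sym n (eta : F) (M : 'M[F]_n) a b (X : 'M_(a, n)) (Y : 'M_(b, n)) :
  M^T = eta *: M -> Y *m M *m X^T = 0 -> eta != 0 -> X *m M *m Y^T = 0.
Proof.
move=> sM E eta0; have := form_tr X Y sM; rewrite E trmx0 => /esym/eqP.
by rewrite scaler_eq0 (negPf eta0) => /eqP.
Qed.

Variables (eps : F) (T : forall w, 'M[F]_w -> 'M[F]_w -> Prop).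
Hypothesis eps2 : eps * eps = 1.

(** The three starting points of prolongation: a common kernel vector, a part of K on which Q is
    nondegenerate, and K with its dual space as the whole space, where D is P on the dual. *)
Hypothesis T_zero : T (0 : 'M_1) 0.
Hypothesis T_kernel : forall k (M : 'M_k), M^T = - eps *: M -> M != 0 ->
  exists w, exists X : 'M_(w, k), [/\ (0 < w)%N, X *m M *m X^T \in unitmx &
    T 0 (X *m M *m X^T)].
Hypothesis T_form : forall k (D : 'M_k), D^T = eps *: D -> D != 0 ->
  exists w, exists X : 'M_(w, k), [/\ (0 < w)%N, X *m D *m X^T \in unitmx &
    T (block_mx (X *m D *m X^T) 0 0 0) (block_mx 0 1%:M (- eps)%:M 0)].

(* An orthogonal summand of (P, Q) whose prolongation satisfies [T]. *)
Definition frame_split n (P Q : 'M_n) :=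
  exists n1, exists n2, exists U1 : 'M_(n1, n), exists U2 : 'M_(n2, n),
  [/\ (0 < n1)%N /\ (n1 + n2)%N = n, (1%:M <= U1 + U2)%MS,
   (U2 *m P *m U1^T = 0 /\ U1 *m P *m U2^T = 0),
   (U2 *m Q *m U1^T = 0 /\ U1 *m Q *m U2^T = 0) &
   exists s, exists C : 'M_(n1, s), kernel_data (U1 *m P *m U1^T) C /\
     T (extP eps (U1 *m P *m U1^T) C) (extQ eps s (U1 *m Q *m U1^T))].

(** The summand V1 comes with kernel data chosen in advance, V2 takes arbitrary ones. In the normal
    frame the vectors of K and of its dual attached to V1 are orthogonal to everything attached to
    V2 and to the q leftover pairs, so V1 is prolonged on its own. *)
Lemma singular_split_ext n k m (P Q : 'M[F]_n) (K Y : 'M_(k, n)) (U : 'M_(m, n)) :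
  P^T = eps *: P -> Q^T = - eps *: Q ->
  (k + (k + m))%N = n -> (1%:M <= K + (Y + U))%MS ->
  K *m P = 0 -> (forall v : 'rV_n, v *m P = 0 -> (v <= K)%MS) ->
  K *m Q *m K^T = 0 -> Y *m Q *m K^T = 1%:M ->
  U *m Q *m K^T = 0 -> U *m Q *m Y^T = 0 ->
  frame_split (U *m P *m U^T) (U *m Q *m U^T) ->
  peelable P Q T.
Proof.
move=> sP sQ e full KP kerP KQK YQK UQK UQY.
case=> n1 [n2 [V1 [V2 [[n10 em] fullV [P21 P12] [Q21 Q12] [s1 [C1 [dC1 TC1]]]]]]].
have [s2 [C2 dC2]] := kernel_data_exists (V2 *m (U *m P *m U^T) *m V2^T).
pose V := col_mx V1 V2; pose UU := V *m U.
have fUU M : UU *m M *m UU^T = V *m (U *m M *m U^T) *m V^T.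
  by rewrite /UU trmx_mul !mulmxA.
have gP : UU *m P *m UU^T = block_mx (V1 *m (U *m P *m U^T) *m V1^T) 0 0
     (V2 *m (U *m P *m U^T) *m V2^T).
  by rewrite fUU gram_col P21 P12.
have gQ : UU *m Q *m UU^T = block_mx (V1 *m (U *m Q *m U^T) *m V1^T) 0 0
     (V2 *m (U *m Q *m U^T) *m V2^T).
  by rewrite fUU gram_col Q21 Q12.
have dC := kernel_data_add dC1 dC2; rewrite -gP in dC.
have fullUU : (1%:M <= K + (Y + UU))%MS.
  have UUU : (U <= UU)%MS.
    rewrite -[X in (X <= _)%MS]mul1mx /UU submxMr //.
    by rewrite -addsmxE.
  apply: submx_trans full _.
  by rewrite addsmxS // addsmxS.
have UUQK : UU *m Q *m K^T = 0.
  by rewrite /UU -!mulmxA (mulmxA U) UQK mulmx0.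
have UUQY : UU *m Q *m Y^T = 0.
  by rewrite /UU -!mulmxA (mulmxA U) UQY mulmx0.
have e' : (k + (k + (n1 + n2)))%N = n by rewrite em.
have [q [K' [Y' [U' [D]]]]] :=
  singular_frame two_neq0 eps2 sP sQ e' fullUU KP kerP KQK YQK UUQK UUQY dC.
rewrite gP gQ; move: (V1 *m (U *m P *m U^T) *m V1^T) TC1 {dC1 dC gP} => A1 TC1.
move: (V1 *m (U *m Q *m U^T) *m V1^T) TC1 => B1 TC1.
move: (V2 *m (U *m P *m U^T) *m V2^T) (V2 *m (U *m Q *m U^T) *m V2^T) {dC2 gQ} => A2 B2.
rewrite -(vsubmxK K') -(vsubmxK Y') -(vsubmxK U').
move: (usubmx K') (dsubmx K') (usubmx Y') (dsubmx Y') (usubmx U') (dsubmx U') => {}K' K3 {}Y' Y3 U1 U2.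
rewrite -(vsubmxK K') -(vsubmxK Y').
move: (usubmx K') (dsubmx K') (usubmx Y') (dsubmx Y') => {}K' K2 {}Y' Y2.
case=> -[ek full'] KP0 [KQK0 YQK1 YQY0] [UQK0 UQY0 UQU] [UPU UPY YPY].
have e0 : eps != 0 by apply: contraNneq (oner_neq0 F) => e1; rewrite -eps2 e1 mulr0.
have me0 : - eps != 0 by rewrite oppr_eq0.
have symP a b (X : 'M_(a, n)) (X' : 'M_(b, n)) := form0_sym (X := X) (Y := X') sP.
have symQ a b (X : 'M_(a, n)) (X' : 'M_(b, n)) := form0_sym (X := X) (Y := X') sQ.
move: KP0; rewrite !mul_col_mx -[0 in RHS]col_mx0 => /eq_col_mx [].
rewrite -[0 in RHS]col_mx0 => /eq_col_mx [K'P K2P] K3P.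
have PK' a (X : 'M_(a, n)) : X *m P *m K'^T = 0.
  by apply: symP => //; rewrite K'P mul0mx.
have [/gram_eq0r[/gram_eq0l[/gram_eq0l[K'QK' K2QK'] K3QK'] _] _] := gram_eq0r KQK0.
move: YQK1; rewrite scalar_mx_block => /gram_eq_block[].
rewrite scalar_mx_block => /gram_eq_block[Y'QK' Y'QK2 Y2QK' _].
move=> /gram_eq0l[Y'QK3 _] /gram_eq0r[Y3QK' _] _.
have [/gram_eq0r[/gram_eq0l[/gram_eq0l[Y'QY' Y2QY'] Y3QY'] _] _] := gram_eq0r YQY0.
have [/gram_eq0r[/gram_eq0l[U1QK' U2QK'] /gram_eq0l[U1QK2 _]] /gram_eq0l[U1QK3 _]]
  := gram_eq0r UQK0.
have [/gram_eq0r[/gram_eq0l[U1QY' U2QY'] /gram_eq0l[U1QY2 _]] /gram_eq0l[U1QY3 _]]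
  := gram_eq0r UQY0.
have [U1QU1 _ U2QU1 _] := gram_eq_block UQU.
have [U1PU1 _ U2PU1 _] := gram_eq_block UPU.
have [/gram_eq_block[U1PY' U1PY2 U2PY' _] /gram_eq0l[U1PY3 _]] := gram_eq_row UPY.
have [/gram_eq0r[/gram_eq0l[Y'PY' Y2PY'] _] _ /gram_eq0r[Y3PY' _] _] :=
  gram_eq_block YPY.
pose W := col_mx K' (col_mx U1 Y').
pose Ur := col_mx (col_mx K2 K3) (col_mx U2 (col_mx Y2 Y3)).
have UrPW : Ur *m P *m W^T = 0.
  rewrite /W; apply: gram0r; [exact: PK'|apply: gram0r]; rewrite /Ur.
  - apply: gram0l; first by apply: gram0l; rewrite ?K2P ?K3P mul0mx.
    by apply: gram0l => //; apply: gram0l; apply: symP.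
  - apply: gram0l; first by apply: gram0l; rewrite ?K2P ?K3P mul0mx.
    by apply: gram0l => //; apply: gram0l.
have UrQW : Ur *m Q *m W^T = 0.
  rewrite /W; apply: gram0r; last apply: gram0r; rewrite /Ur.
  - apply: gram0l; first exact: gram0l.
    by apply: gram0l => //; apply: gram0l.
  - apply: gram0l; first by apply: gram0l; apply: symQ.
    by apply: gram0l => //; apply: gram0l; apply: symQ.
  - apply: gram0l; first by apply: gram0l; apply: symQ.
    by apply: gram0l => //; apply: gram0l.
exists (s1 + (n1 + s1))%N, ((s2 + q) + (n2 + (s2 + q)))%N, W, Ur; split.
- by split; lia.
- apply: submx_trans full' _.
  have sWK : (K' <= W)%MS by rewrite /W -(addsmxE K') addsmxSl.
  have sWUY : (col_mx U1 Y' <= W)%MS by rewrite /W -(addsmxE K') addsmxSr.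
  have := sWUY; rewrite col_mx_sub => /andP [sWU sWY].
  have : (Ur <= Ur)%MS by []; rewrite {1}/Ur !col_mx_sub.
  case/andP => /andP [sK2 sK3] /and3P [sU2 sY2 sY3].
  have subW a (X : 'M_(a, n)) : (X <= W -> X <= W + Ur)%MS.
    by move/submx_trans; apply; apply: addsmxSl.
  have subU a (X : 'M_(a, n)) : (X <= Ur -> X <= W + Ur)%MS.
    by move/submx_trans; apply; apply: addsmxSr.
  by rewrite !addsmx_sub !col_mx_sub (subW _ K') // (subW _ Y') // (subW _ U1) // !subU.
- by split=> //; apply: symP.
- by split=> //; apply: symQ.
- have -> : W *m P *m W^T = extP eps A1 C1.
    rewrite /W gram_col K'P !mul0mx PK' gram_col U1PU1 U1PY' Y'PY' /extP.
    congr (block_mx _ _ _ (block_mx _ _ _ _)).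
    have := form_tr Y' U1 sP; rewrite U1PY' => ->.
    by rewrite scalerA eps2 scale1r.
  have -> : W *m Q *m W^T = extQ eps s1 B1; last exact: TC1.
  rewrite /W gram_col K'QK' gram_col U1QU1 U1QY' Y'QY' /extQ.
  have -> : Y' *m Q *m U1^T = 0 by apply: symQ.
  rewrite !mul_col_mx U1QK' Y'QK' tr_col_mx mul_mx_row.
  have -> : K' *m Q *m U1^T = 0 by apply: symQ.
  have -> : K' *m Q *m Y'^T = (- eps)%:M => //.
  have := form_tr K' Y' sQ; rewrite Y'QK' trmx1 => E1.
  rewrite -[LHS]scale1r -eps2 -mulrNN -scalerA -E1.
  by rewrite scalemx1.
Qed.

Lemma singular_split n (P Q : 'M[F]_n) :
  P^T = eps *: P -> Q^T = - eps *: Q -> P \notin unitmx ->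
  (forall m (P' Q' : 'M_m), (0 < m < n)%N ->
     P'^T = eps *: P' -> Q'^T = - eps *: Q' -> frame_split P' Q') ->
  peelable P Q T.
Proof.
move=> sP sQ nuP IH.
have e0 : eps != 0 by apply: contraNneq (oner_neq0 F) => e1; rewrite -eps2 e1 mulr0.
have me0 : - eps != 0 by rewrite oppr_eq0.
have [k [K [KP fK kerP k0]]] : exists k, exists K : 'M_(k, n),
    [/\ K *m P = 0, row_free K, forall v : 'rV_n, v *m P = 0 -> (v <= K)%MS &
        (0 < k)%N].
  exists (\rank (kermx P)), (row_base (kermx P)); split.
  - by apply/eqP; rewrite -sub_kermx eq_row_base.
  - by rewrite row_base_free.
  - by move=> v vP; rewrite eq_row_base; apply/sub_kermxP.
  - by rewrite lt0n mxrank_eq0 kermx_eq0 row_free_unit.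
case: (boolP (row_free (K *m Q))) => [fKQ|]; last first.
  rewrite -kermx_eq0 => /rowV0Pn [u /sub_kermxP uKQ u0].
  pose w := u *m K; have w0 : w != 0.
    apply: contra_neq u0 => wK; have [V KV] := row_freeP fK.
    by rewrite -[u]mulmx1 -KV mulmxA -/w wK mul0mx.
  have fw : row_free w by rewrite /row_free rank_rV w0.
  have [r [U [e full]]] := row_complement fw.
  have wP : w *m P = 0 by rewrite /w -mulmxA KP mulmx0.
  have wQ : w *m Q = 0 by rewrite /w -mulmxA uKQ.
  exists 1%N, r, w, U; split=> //.
  - split; last by rewrite wP mul0mx.
    by apply: (form0_sym sP) => //; rewrite wP mul0mx.
  - split; last by rewrite wQ mul0mx.
    by apply: (form0_sym sQ) => //; rewrite wQ mul0mx.
  - by rewrite wP wQ !mul0mx.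
have [KQK|KQK] := eqVneq (K *m Q *m K^T) 0; last first.
  have [w [X [w0 uX TX]]] := T_kernel (form_tr K K sQ) KQK.
  pose W := X *m K.
  have WM M : W *m M *m W^T = X *m (K *m M *m K^T) *m X^T.
    by rewrite /W trmx_mul !mulmxA.
  have WP : W *m P = 0 by rewrite /W -mulmxA KP mulmx0.
  have [||r [U [e full [UQ WQ] [UP WPU]]]] := orth_split2 (X := 0) (W := W) sP sQ.
  - by rewrite WM.
  - by rewrite WP mul0mx.
  exists w, r, W, U; split=> //.
  by rewrite WP mul0mx WM.
have [Y0 KQY0] : exists Y0 : 'M_(k, n), Y0 *m Q *m K^T = 1%:M.
  have [V KV] := row_freeP fKQ; exists (- eps *: V^T).
  apply: trmx_inj; rewrite (form_tr K _ sQ) trmx1 linearZ /= trmxK -scalemxAr.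
  by rewrite KV scalerA mulrNN eps2 scale1r.
pose W := col_mx K Y0.
have gW : W *m Q *m W^T = block_mx 0 (- eps)%:M 1%:M (Y0 *m Q *m Y0^T).
  rewrite /W gram_col KQK KQY0; congr block_mx.
  have := form_tr K Y0 sQ; rewrite KQY0 trmx1 => E1.
  by rewrite -[LHS]scale1r -eps2 -mulrNN -scalerA -E1 scalemx1.
have uW : W *m Q *m W^T \in unitmx.
  rewrite gW; set d := Y0 *m Q *m Y0^T.
  have E1 : block_mx 0 (- eps)%:M 1%:M d *m
     block_mx (eps *: d) 1%:M (- eps)%:M 0 = 1%:M.
    rewrite mulmx_block !(mul0mx, mulmx0, mulmx1, mul1mx, addr0, add0r).
    rewrite -scalar_mxM mulrNN eps2 mul_mx_scalar scaleNr subrr.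
    by rewrite -scalar_mx_block.
  by have [] := mulmx1_unit E1.
have [m [U [e full UQW WQU]]] := orth_split sQ uW.
have [UQK UQY0] := gram_eq0r UQW.
have full3 : (1%:M <= K + (Y0 + U))%MS.
  apply: submx_trans full _; rewrite /W addsmx_sub col_mx_sub.
  rewrite addsmxSl (submx_trans (addsmxSl Y0 U) (addsmxSr _ _)).
  exact: submx_trans (addsmxSr Y0 U) (addsmxSr _ _).
have [m0|m0] := posnP m; last first.
  apply: (singular_split_ext (K := K) (Y := Y0) (U := U)) => //.
    by rewrite addnA.
  apply: IH; first by lia.
    exact: form_tr.
  exact: form_tr.
(* The Q-complement is zero. The frame lemma is applied with s = 0, in order to make the dual space
   of K isotropic for Q. *)
subst m.
have dC : kernel_data (U *m P *m U^T) (0 : 'M_(0, 0)).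
  by exists 0, 0; split; rewrite ?[LHS]flatmx0 ?[RHS]flatmx0.
have e' : (k + (k + 0))%N = n by rewrite addnA.
have [q [K' [Y [U' [D]]]]] :=
  singular_frame two_neq0 eps2 sP sQ e' full3 KP kerP KQK KQY0 UQK UQY0 dC.
case=> -[ek full'] K'P [K'QK' YQK' YQY] _ _ {D}.
have [D eD] : exists D, D = Y *m P *m Y^T by eexists.
have sD : D^T = eps *: D by rewrite eD; apply: form_tr.
have K'QY : K' *m Q *m Y^T = (- eps)%:M.
  have := form_tr K' Y sQ; rewrite YQK' trmx1 => E1.
  by rewrite -[LHS]scale1r -eps2 -mulrNN -scalerA -E1 scalemx1.
have PK' a (X : 'M_(a, n)) : X *m P *m K'^T = 0.
  by apply: (form0_sym sP) => //; rewrite K'P mul0mx.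
have subK a (X : 'M_(a, n)) : X *m P = 0 -> (X <= K)%MS.
  by move=> XP; apply/row_subP => i; apply: kerP; rewrite -row_mul XP row0.
have D0 : D != 0.
  (* Otherwise Y lies in the kernel of P, hence in K, which is Q-isotropic although Y and K' are
     dual. *)
  apply/eqP => D0; have YP : Y *m P = 0.
    apply: (full3_eq0 full'); [exact: PK'|by rewrite -eD|].
    by rewrite [U'^T]thinmx0 mulmx0.
  have /submxP [a Ya] := subK _ _ YP; have /submxP [b Kb] := subK _ _ K'P.
  have := YQK'; rewrite Ya Kb trmx_mul !mulmxA -!(mulmxA a) KQK mul0mx mulmx0.
  move/esym/matrixP => H; have q0 : (0 < 0 + q)%N by rewrite -ek.
  have := H (Ordinal q0) (Ordinal q0); rewrite !mxE eqxx => /eqP.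
  by rewrite oner_eq0.
have [w [X [w0 uG TX]]] := T_form sD D0.
set G := X *m D *m X^T in uG TX.
have sG : G^T = eps *: G by apply: form_tr.
(* The choice makes c dual to X, so that V1 and V2 are dual under Q, and makes [V1 *m P] a
   combination of [V2 *m Q], as the orthogonal splitting demands. *)
pose c := invmx G *m X *m D.
have Xc : X *m c^T = 1%:M.
  have -> : c^T = eps *: (D *m X^T *m (invmx G)^T).
    rewrite /c !trmx_mul sD -!scalemxAl.
    by rewrite !mulmxA.
  rewrite -scalemxAr !mulmxA -/G scalemxAl -sG -trmx_mul mulVmx // trmx1 //.
have cX : c *m X^T = 1%:M by apply: trmx_inj; rewrite trmx_mul trmxK Xc trmx1.
pose V1 := X *m Y; pose V2 := c *m K'.
pose W1 := col_mx V1 V2.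
have gP : W1 *m P *m W1^T = block_mx G 0 0 0.
  rewrite /W1 gram_col; congr block_mx.
  - by rewrite /V1 /G eD trmx_mul !mulmxA.
  - by rewrite /V2 trmx_mul mulmxA PK' mul0mx.
  - by rewrite /V2 -(mulmxA c) K'P mulmx0 mul0mx.
  - by rewrite /V2 -(mulmxA c) K'P mulmx0 mul0mx.
have gQ : W1 *m Q *m W1^T = block_mx 0 1%:M (- eps)%:M 0.
  rewrite /W1 gram_col; congr block_mx.
  - transitivity (X *m (Y *m Q *m Y^T) *m X^T); first by rewrite /V1 trmx_mul !mulmxA.
    by rewrite YQY mulmx0 mul0mx.
  - transitivity (X *m (Y *m Q *m K'^T) *m c^T); first by rewrite /V1 /V2 !trmx_mul !mulmxA.
    by rewrite YQK' mulmx1.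
  - transitivity (c *m (K' *m Q *m Y^T) *m X^T); first by rewrite /V1 /V2 !trmx_mul !mulmxA.
    by rewrite K'QY mul_mx_scalar -scalemxAl cX scalemx1.
  - transitivity (c *m (K' *m Q *m K'^T) *m c^T); first by rewrite /V2 trmx_mul !mulmxA.
    by rewrite K'QK' mulmx0 mul0mx.
have uW1 : W1 *m Q *m W1^T \in unitmx.
  rewrite gQ; have E1 : block_mx 0 1%:M (- eps)%:M 0 *m
      block_mx 0 (- eps)%:M 1%:M 0 = 1%:M :> 'M[F]_(w + w).
    rewrite mulmx_block !(mul0mx, mulmx0, mulmx1, mul1mx, addr0, add0r).
    by rewrite -scalar_mxM mulrNN eps2 -scalar_mx_block.
  by have [] := mulmx1_unit E1.
have W1P : W1 *m P = block_mx 0 (- eps *: G) 0 0 *m (W1 *m Q).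
  rewrite /W1 (mul_col_mx _ _ P) (mul_col_mx _ _ Q) mul_block_col !mul0mx !add0r.
  rewrite {2}/V2 -[c *m K' *m P]mulmxA K'P mulmx0; congr col_mx.
  apply/eqP; rewrite -subr_eq0; apply/eqP; apply: (full3_eq0 full').
  - rewrite mulmxBl /V1 PK' sub0r; apply/eqP; rewrite oppr_eq0 /V2; apply/eqP.
    by rewrite -!mulmxA (mulmxA K') K'QK' !mulmx0.
  - rewrite mulmxBl /V1 /V2 -!mulmxA (mulmxA Y) -eD (mulmxA K') K'QY.
    rewrite mul_mx_scalar -!scalemxAr -scalemxAl scalerA mulrNN eps2 scale1r.
    by rewrite mulKVmx // subrr.
  - by rewrite [U'^T]thinmx0 mulmx0.
have [r [V [er fullV [VQ W1Q] [VP W1PV]]]] := orth_split2 sP sQ uW1 W1P.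
exists (w + w)%N, r, W1, V; split=> //.
- by split=> //; rewrite addn_gt0 w0.
- by rewrite gP gQ.
Qed.

End SingularSplit.

(** * The nonsingular case *)

Section Regular.
Variable F : closedFieldType.
Hypothesis two_neq0 : 1 + 1 != 0 :> F.

Lemma entry_tr m n (X : 'M[F]_(m, n)) i j : entry X^T i j = entry X j i.
Proof.
case: (boolP ((i < n) && (j < m))%N) => [/andP[Hi Hj]|H].
  by rewrite (entryE _ (Ordinal Hi) (Ordinal Hj)) mxE -entryE.
by rewrite !entry_out // andbC.
Qed.

(** A Sylvester equation with spectra l and -l, which are disjoint; entries are cleared from the
    lower right corner. *)
Lemma jordan_skew_eq0 k (l : F) (M : 'M[F]_k) : l != 0 ->
  jordan_block k l *m M = - (M *m (jordan_block k l)^T) -> M = 0.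
Proof.
move=> l0 E; apply: (entry_eq0 (mu := fun i j => (k - i) + (k - j))%N).
move=> i j Hi Hj IH; have /eq_entry/(_ i j Hi Hj) := E.
have -> : entry (- (M *m (jordan_block k l)^T)) i j =
    - (l * entry M i j + entry M i j.+1).
  rewrite -[M in LHS]trmxK -trmx_mul -scaleN1r.
  have := entryD (-1) (jordan_block k l *m M^T)^T 0 i j; rewrite addr0 entry0 addr0 => ->.
  by rewrite entry_tr entry_jordan_l // !entry_tr mulN1r.
rewrite entry_jordan_l // (IH i.+1 j) ?(IH i j.+1); try lia.
rewrite !addr0 => /eqP; rewrite -subr_eq0 opprK -mulrDl mulf_eq0 => /orP [|/eqP //].
by rewrite (negPf (double_neq0 two_neq0 l0)).
Qed.

(** k is the first index at which the kernels of the powers stop growing. Stabilization is the form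
    in which maximality of the chain is used. *)
Lemma nilpotent_chain n (N : 'M[F]_n) (v : 'rV_n) : v != 0 -> v *m N = 0 ->
  exists k, exists x : 'rV_n, [/\ (0 < k)%N, x *m N ^+ k = 0,
    x *m N ^+ k.-1 != 0 &
    forall w : 'rV_n, w *m N ^+ k.+1 = 0 -> w *m N ^+ k = 0].
Proof.
move=> v0 vN; pose d i := \rank (kermx (N ^+ i)).
have [k dk mink] : exists2 k, (d k.+1 <= d k)%N & forall i, (d i.+1 <= d i)%N -> (k <= i)%N.
  have ex : exists i, (d i.+1 <= d i)%N.
    have [/existsP [i Hi]|H] := boolP [exists i : 'I_n.+1, d i.+1 <= d i]%N.
      by exists i.
    have D i : (i <= n.+1)%N -> (i <= d i)%N.
      elim: i => // i IHi Hi; apply: leq_ltn_trans (IHi (ltnW Hi)) _.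
      by move/existsPn: H => /(_ (Ordinal Hi)); rewrite -ltnNge.
    by have := D n.+1 (leqnn _); rewrite leqNgt ltnS rank_leq_row.
  by case: (ex_minnP ex) => k dk mink; exists k.
have sub i : (kermx (N ^+ i) <= kermx (N ^+ i.+1))%MS.
  by apply/sub_kermxP; rewrite exprSr -mulmxE mulmxA mulmx_ker mul0mx.
have stab (w : 'rV_n) : w *m N ^+ k.+1 = 0 -> w *m N ^+ k = 0.
  move=> /sub_kermxP wk; apply/sub_kermxP; apply: submx_trans wk _.
  by rewrite -(geq_leqif (mxrank_leqif_sup (sub k))).
exists k; have k0 : (0 < k)%N.
  rewrite lt0n; apply/eqP => ek; move: stab; rewrite ek => /(_ v).
  by rewrite expr1 expr0 mulmx1 => /(_ vN) /eqP; rewrite (negPf v0).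
have : ~~ (kermx (N ^+ k) <= kermx (N ^+ k.-1))%MS.
  apply/negP => le; have : (k <= k.-1)%N by apply: mink; rewrite prednK // /d mxrankS.
  by lia.
case/row_subPn => i nle; exists (row i (kermx (N ^+ k))); split=> //.
  by apply/sub_kermxP; apply: row_sub.
by apply: contraNneq nle => /sub_kermxP.
Qed.

Lemma chain_jordan n k (T : 'M[F]_n) (l : F) (x : 'rV_n) :
  x *m (T - l%:M) ^+ k = 0 ->
  let X := \matrix_(i < k, j < n) (x *m (T - l%:M) ^+ i) 0 j in
  X *m T = jordan_block k l *m X.
Proof.
set N := T - l%:M => xN X.
have XE i : (i <= k)%N -> forall j, entry X i j = entry (x *m N ^+ i) 0 j.
  move=> Hi j; case: (ltnP j n) => Hj; last by rewrite !entry_out //; lia.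
  move: Hi; rewrite leq_eqVlt => /orP [/eqP ->|Hi].
    by rewrite xN entry0 entry_out // ltnn.
  by rewrite (entryE _ (Ordinal Hi) (Ordinal Hj)) (entryE _ 0 (Ordinal Hj)) mxE.
have rX (i : 'I_k) : row i X = x *m N ^+ i by apply/rowP => j; rewrite !mxE.
apply/eq_entry => i j Hi Hj; rewrite entry_jordan_l // !XE //; last exact: ltnW.
rewrite (entryE _ (Ordinal Hi) (Ordinal Hj)).
have -> : (X *m T) (Ordinal Hi) (Ordinal Hj) = (row (Ordinal Hi) X *m T) 0 (Ordinal Hj).
  by rewrite -row_mul [RHS]mxE.
rewrite rX /= !(entryE _ 0 (Ordinal Hj)) exprSr -mulmxE mulmxA.
rewrite -[T](subrK l%:M) -/N mulmxDr mul_mx_scalar addrC.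
by rewrite mxE [X in X + _]mxE.
Qed.

Lemma regular_split n (A B : 'M[F]_n) : (0 < n)%N ->
  A^T = A -> B^T = - B -> A \in unitmx -> B \in unitmx ->
  peelable B A (fun w M L => exists2 t, summand_valid t &
    congruent (MxPair L M) (summand_pair t)).
Proof.
move=> n0 sA sB uA uB.
pose T := B *m invmx A; have TA : T *m A = B by rewrite /T mulmxKV.
have [l rl] : exists l, root (char_poly T) l.
  by apply/closed_rootP; rewrite size_char_poly; lia.
have {rl} /eigenvalueP [v vT v0] : eigenvalue T l by rewrite eigenvalue_root_char.
have l0 : l != 0.
  apply: contraNneq v0 => l0; have := congr1 (mulmx^~ A) vT.
  rewrite l0 scale0r mul0mx -mulmxA TA => vB.
  by rewrite -[v]mulmx1 -(mulmxV uB) mulmxA vB mul0mx.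
pose N := T - l%:M; pose N' := T - (- l)%:M.
have [|k [x [k0 xN xN1 stab]]] := @nilpotent_chain _ N v v0.
  by rewrite /N mulmxBr vT mul_mx_scalar subrr.
have N'A : N' *m A = B + l *: A.
  by rewrite /N' mulmxBl TA mul_scalar_mx scaleNr opprK.
have NA : N *m A = B - l *: A by rewrite /N mulmxBl TA mul_scalar_mx.
have AN' : A *m N'^T = - (N *m A).
  have -> : A *m N'^T = (N' *m A)^T by rewrite trmx_mul sA.
  by rewrite N'A NA linearD linearZ /= sA sB opprB addrC.
(* T is skew for the form A, so the adjoint of T + l is -(T - l). *)
have AN'e j : A *m (N' ^+ j)^T = (-1) ^+ j *: (N ^+ j *m A).
  elim: j => [|j IHj]; first by rewrite !expr0 trmx1 mulmx1 mul1mx scale1r.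
  rewrite exprSr -mulmxE trmx_mul mulmxA AN' mulNmx -mulmxA IHj.
  by rewrite -scalemxAr mulmxA mulmxE -exprS [(-1) ^+ j.+1]exprS mulN1r scaleNr.
pose z := x *m N ^+ k.-1.
have zN : z *m N = 0.
  by rewrite /z -mulmxA mulmxE -exprSr prednK.
(* If z were A-orthogonal to the kernel of N'^k, then A z^T would lie in the image of N'^k, and z =
   w N^k up to sign. As z N = 0, stabilization would give z = 0. *)
have [y yN' zAy] : exists2 y : 'rV_n, y *m N' ^+ k = 0 & z *m A *m y^T != 0.
  have [s [C [E [Z [EM _ MZ]]]]] := kernel_data_exists (N' ^+ k).
  have [Ez|/matrix0Pn [i [j nz]]] := eqVneq (E *m (A *m z^T)) 0; last first.
    exists (row i E); first by rewrite -row_mul EM row0.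
    apply: contraNneq nz => zAy.
    have : (row i E *m A *m z^T)^T = 0.
      by rewrite trmx_mul trmxK trmx_mul sA mulmxA.
    rewrite -!row_mul -mulmxA => /(congr1 trmx); rewrite trmxK trmx0.
    by move/rowP/(_ j); rewrite mxE [RHS]mxE => ->.
  case/eqP: xN1; rewrite -/z.
  pose u := (Z *m (A *m z^T))^T; pose w := u *m invmx A.
  have zA : z *m A = u *m (N' ^+ k)^T.
    rewrite /u -trmx_mul -[LHS]trmxK [(z *m A)^T]trmx_mul sA; congr (_^T).
    rewrite -[LHS]mul1mx -MZ mulmxDl -[C *m E *m _]mulmxA Ez mulmx0 addr0.
    by rewrite -mulmxA.
  have zw : z = (-1) ^+ k *: (w *m N ^+ k).
    apply: (can_inj (mulmxK uA)); rewrite zA -[u](mulmxKV uA) -/w -(mulmxA w) AN'e.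
    by rewrite -scalemxAr -scalemxAl mulmxA.
  rewrite zw stab ?scaler0 //; have := zN; rewrite {1}zw -scalemxAl => /eqP.
  rewrite scaler_eq0 signr_eq0 /= => /eqP <-.
  by rewrite exprSr -mulmxE mulmxA.
have jc := chain_jordan xN; set X := \matrix_(i, j) _ in jc.
have jc' := chain_jordan yN'; set Y := \matrix_(i, j) _ in jc'.
have XB : X *m B = jordan_block k l *m (X *m A).
  by rewrite -TA mulmxA jc mulmxA.
have YB : Y *m B = jordan_block k (- l) *m (Y *m A).
  by rewrite -TA mulmxA jc' mulmxA.
(* A chain at a nonzero eigenvalue spans an A-isotropic space: its Gram matrix solves the Sylvester
   equation above. *)
have iso0 (W : 'M_(k, n)) (a : F) : a != 0 ->
    W *m B = jordan_block k a *m (W *m A) -> W *m A *m W^T = 0.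
  move=> a0 WB; apply: (jordan_skew_eq0 a0); rewrite mulmxA -WB.
  rewrite -[LHS]trmxK [X in X^T]trmx_mul trmxK [(W *m B)^T]trmx_mul sB.
  rewrite mulNmx mulmxN linearN /=; congr (- _).
  by rewrite mulmxA WB trmx_mul trmxK trmx_mul [(W *m A)^T]trmx_mul sA !mulmxA.
have XAX := iso0 X l l0 XB.
have YAY : Y *m A *m Y^T = 0 by apply: iso0 YB; rewrite oppr_eq0.
pose G := X *m A *m Y^T.
have rX (i : 'I_k) : row i X = x *m N ^+ i by apply/rowP => j; rewrite !mxE.
have rY (i : 'I_k) : row i Y = y *m N' ^+ i by apply/rowP => j; rewrite !mxE.
have GE (i j : 'I_k) : G i j = (-1) ^+ j * (x *m N ^+ (i + j) *m A *m y^T) 0 0.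
  transitivity ((row i X *m A *m (row j Y)^T) 0 0).
    rewrite -row_mul [LHS]mxE [RHS]mxE; apply: eq_bigr => m _.
    congr (_ * _); first by rewrite [RHS]mxE.
    by rewrite [LHS]mxE [RHS]mxE [RHS]mxE.
  rewrite rX rY trmx_mul mulmxA -(mulmxA _ A) AN'e -scalemxAr -scalemxAl mxE.
  by rewrite exprD -mulmxE !mulmxA.
(* Up to sign the entries depend on i + j only: they vanish from k on, and at k-1 they are the
   nonzero value z A y^T. *)
have uG : G \in unitmx.
  apply: antitrig_unitmx => i j ij; rewrite GE.
    by rewrite -(subnKC ij) exprD -mulmxE mulmxA xN !mul0mx mxE mulr0.
  rewrite mulf_neq0 ?signr_eq0 // (_ : i + j = k.-1)%N; last lia.
  apply: contraNneq zAy => E; apply/eqP/matrixP => a b.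
  by rewrite !ord1 [RHS]mxE.
pose W := col_mx X Y.
have gA : W *m A *m W^T = block_mx 0 G G^T 0.
  rewrite /W gram_col XAX YAY -/G; congr block_mx.
  by rewrite /G trmx_mul trmxK [(X *m A)^T]trmx_mul sA mulmxA.
have gB : W *m B *m W^T = block_mx 0 (jordan_block k l *m G)
     (- (jordan_block k l *m G)^T) 0.
  have E1 : X *m B *m Y^T = jordan_block k l *m G by rewrite XB /G !mulmxA.
  rewrite /W gram_col E1; congr block_mx.
  - by rewrite XB -mulmxA XAX mulmx0.
  - rewrite -E1 trmx_mul trmxK [(X *m B)^T]trmx_mul sB mulNmx mulmxN opprK.
    by rewrite mulmxA.
  - by rewrite YB -mulmxA YAY mulmx0.
have uW : W *m A *m W^T \in unitmx by rewrite gA -[G^T]scale1r hyper_unit ?oner_eq0.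
have WB : W *m B = block_mx (jordan_block k l) 0 0 (jordan_block k (- l)) *m (W *m A).
  rewrite /W (mul_col_mx _ _ A) (mul_col_mx _ _ B) mul_block_col.
  by rewrite !mul0mx addr0 add0r XB YB.
have sB' : B^T = (-1) *: B by rewrite scaleN1r.
have sA' : A^T = 1 *: A by rewrite scale1r.
have [r [U [er fullU [UA WU] [UB WUB]]]] := orth_split2 sB' sA' uW WB.
exists (k + k)%N, r, W, U; split=> //.
  by rewrite addn_gt0 k0.
exists (TypeI k l); first by rewrite /= k0.
rewrite gA gB; apply: congruent_sym; apply: congruent_trans.
  exact: (typeI_hyper k (double_neq0 two_neq0 l0)).
have uG' : invmx G \in unitmx by rewrite unitmx_inv.
apply: congruent_sym.
have := congruent_hyper G (jordan_block k l *m G) (unitmx1 F k) uG'.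
by rewrite !mul1mx mulmxV // mulmxK.
Qed.

End Regular.

(** * Starting points of prolongation and the induction on the size *)

Section Existence.
Variable F : closedFieldType.
Hypothesis two_neq0 : 1 + 1 != 0 :> F.

Lemma square_root (c : F) : exists r, r * r = c.
Proof.
have sz := @size_XnsubC F 2 c isT.
have /closed_rootP [r] : size ('X^2 - c%:P) != 1%N by rewrite sz.
by rewrite /root !hornerE subr_eq0 -?expr2 => /eqP; exists r.
Qed.

Definition skew2 : 'M[F]_2 := skew_tridiag 2 (fun i => (~~ odd i)%:R).

Lemma skew2_unit : skew2 \in unitmx.
Proof.
have E : skew2 *m - skew2 = 1%:M.
  apply/matrixP => i j; rewrite !mxE !big_ord_recl big_ord0 !mxE.
  by case: i => [[|[]]] // Hi; case: j => [[|[]]] // Hj; rewrite /= ?mulr0n ?mulr1n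
     ?subr0 ?sub0r ?oppr0 ?mulr0 ?mul0r ?addr0 ?add0r ?opprK ?mulr1 ?mulN1r ?opprK.
by have [] := mulmx1_unit E.
Qed.

Lemma delta_form k (M : 'M[F]_k) (a c : 'I_k) :
  ((delta_mx 0 a : 'rV_k) *m M *m (delta_mx 0 c : 'rV_k)^T) 0 0 = M a c.
Proof. by rewrite -rowE trmx_delta -colE !mxE. Qed.

Lemma symmetric_unit_vector k (M : 'M[F]_k) : M^T = M -> M != 0 ->
  exists x : 'rV_k, x *m M *m x^T = 1%:M.
Proof.
move=> sM M0.
have [x xMx] : exists x : 'rV_k, (x *m M *m x^T) 0 0 != 0.
  have /matrix0Pn [i [j Mij]] := M0.
  have [qi|] := eqVneq (M i i) 0; last by rewrite -delta_form; eexists; eassumption.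
  have [qj|] := eqVneq (M j j) 0; last by rewrite -delta_form; eexists; eassumption.
  (* Both basis vectors are isotropic, so their sum has value 2 M_ij. *)
  exists (delta_mx 0 i + delta_mx 0 j).
  have D (X Y : 'M[F]_1) : (X + Y) 0 0 = X 0 0 + Y 0 0 by rewrite mxE.
  rewrite linearD /= !mulmxDr !mulmxDl !D !delta_form qi qj add0r addr0.
  have -> : M j i = M i j by rewrite -[in LHS]sM mxE.
  exact: double_neq0.
have [r rE] := square_root ((x *m M *m x^T) 0 0)^-1.
exists (r *: x); rewrite linearZ /= -scalemxAr -!scalemxAl scalerA rE.
apply/matrixP => a b; rewrite !ord1 mxE mulVf //.
by rewrite mxE.
Qed.

Lemma skew_hyperbolic_pair k (M : 'M[F]_k) : M^T = - M -> M != 0 ->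
  exists X : 'M_(2, k), X *m M *m X^T = skew2.
Proof.
move=> sM /matrix0Pn [i [j Mij]].
have sE a c : M a c = - M c a by rewrite -[in LHS](trmxK M) mxE sM mxE.
have M0 a : M a a = 0.
  by apply/eqP; rewrite -(eq_opp two_neq0); apply/eqP/sE.
pose X : 'M_(1 + 1, k) := col_mx ((M i j)^-1 *: delta_mx 0 i) (delta_mx 0 j).
exists X.
have -> : X *m M *m X^T = block_mx 0 1%:M (- 1)%:M 0 :> 'M_(1 + 1).
  have Z (a : F) (Y : 'M[F]_1) : (a *: Y) 0 0 = a * Y 0 0 by rewrite mxE.
  rewrite /X gram_col; congr block_mx; rewrite ?linearZ /= -?scalemxAr -?scalemxAl;
    apply/matrixP => a b; rewrite !ord1 [RHS]mxE ?eqxx ?Z ?delta_form ?M0 ?mulr0 //.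
    by rewrite mulVf.
  by rewrite (sE j i) mulrN mulVf.
suff E (a b : 'I_(1 + 1)) : block_mx 0 1%:M (- 1)%:M 0 a b = (skew2 : 'M_(1 + 1)) a b.
  by apply/matrixP => a b; apply: E.
rewrite -[a]splitK -[b]splitK.
case: (split a) => a'; case: (split b) => b' /=; rewrite !ord1.
- by rewrite block_mxEul !mxE /= !mulr0n subrr.
- by rewrite block_mxEur !mxE /= mulr0n mulr1n subr0.
- by rewrite block_mxEdl !mxE /= mulr0n mulr1n sub0r.
- by rewrite block_mxEdr !mxE /= !mulr0n subrr.
Qed.

Definition first_type w (P Q : 'M[F]_w) :=
  exists2 t, summand_valid t & congruent (MxPair P Q) (summand_pair t).

Definition second_type w (P Q : 'M[F]_w) :=
  exists2 t, summand_valid t & congruent (MxPair Q P) (summand_pair t).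

Lemma sign_matrix_skew2 :
  sign_matrix skew2 (upperb false) (fun i j => upperb false j i).
Proof. exact: (@sign_matrix_II F 2 false).2. Qed.

Lemma sign_matrix_scalar n (o : bool) :
  sign_matrix (((-1) ^+ o)%:M : 'M[F]_n) (fun i j => ~~ o && (i == j))
    (fun i j => o && (i == j)).
Proof.
move=> i j; rewrite mxE -val_eqE /=.
by case: o; case: (_ == _); rewrite /= ?mulr1n ?mulr0n ?subrr ?subr0 ?sub0r.
Qed.

Lemma first_type_zero : first_type (0 : 'M_1) 0.
Proof.
exists (TypeII 1 false) => //; have [e1 e2] := @sign_matrix_II F 1 false.
apply: (congruent_sign (s := id) (c := fun=> 0%N) (@sign_matrix0 _ _ _)
  (@sign_matrix0 _ _ _) e1 e2) => //.
by move=> [|//] [|//] _ _; split.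
Qed.

Lemma second_type_zero : second_type (0 : 'M_1) 0.
Proof. by have [t vt c] := first_type_zero; exists t. Qed.

Lemma first_type_kernel k (M : 'M_k) : M^T = - 1 *: M -> M != 0 ->
  exists w, exists X : 'M_(w, k), [/\ (0 < w)%N, X *m M *m X^T \in unitmx &
    first_type 0 (X *m M *m X^T)].
Proof.
rewrite scaleN1r => sM M0; have [X XM] := skew_hyperbolic_pair sM M0.
exists 2%N, X; rewrite XM skew2_unit; split=> //.
exists (TypeII 2 false) => //; have [e1 e2] := @sign_matrix_II F 2 false.
apply: (congruent_sign (s := id) (c := fun=> 0%N) (@sign_matrix0 _ _ _)
  sign_matrix_skew2 e1 e2) => //.
by move=> [|[|//]] [|[|//]] _ _; split.
Qed.

Lemma second_type_kernel k (M : 'M_k) : M^T = - - 1 *: M -> M != 0 ->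
  exists w, exists X : 'M_(w, k), [/\ (0 < w)%N, X *m M *m X^T \in unitmx &
    second_type 0 (X *m M *m X^T)].
Proof.
rewrite opprK scale1r => sM M0; have [X XM] := symmetric_unit_vector sM M0.
exists 1%N, X; rewrite XM unitmx1; split=> //.
exists (TypeII 1 true) => //; have [e1 e2] := @sign_matrix_II F 1 true.
apply: (congruent_sign (s := id) (c := fun=> 0%N) (@sign_matrix1 _ _)
  (@sign_matrix0 _ _ _) e1 e2) => //.
by move=> [|//] [|//] _ _; split.
Qed.

Lemma first_type_form k (D : 'M_k) : D^T = 1 *: D -> D != 0 ->
  exists w, exists X : 'M_(w, k), [/\ (0 < w)%N, X *m D *m X^T \in unitmx &
    first_type (block_mx (X *m D *m X^T) 0 0 0) (block_mx 0 1%:M (- 1)%:M 0)].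
Proof.
rewrite scale1r => sD D0; have [X XD] := symmetric_unit_vector sD D0.
exists 1%N, X; rewrite XD unitmx1; split=> //.
exists (TypeII 2 true) => //; have [e1 e2] := @sign_matrix_II F 2 true.
have z m n := @sign_matrix0 F m n; have o := @sign_matrix1 F 1.
apply: (congruent_sign (s := id) (c := fun=> 0%N)
  (sign_matrix_block4 o (z _ _) (z _ _) (z _ _))
  (sign_matrix_block4 (z _ _) o (@sign_matrix_scalar 1 true) (z _ _)) e1 e2) => //.
by move=> [|[|//]] [|[|//]] _ _; split.
Qed.

Lemma second_type_form k (D : 'M_k) : D^T = - 1 *: D -> D != 0 ->
  exists w, exists X : 'M_(w, k), [/\ (0 < w)%N, X *m D *m X^T \in unitmx &
    second_type (block_mx (X *m D *m X^T) 0 0 0) (block_mx 0 1%:M (- - 1)%:M 0)].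
Proof.
rewrite scaleN1r => sD D0; have [X XD] := skew_hyperbolic_pair sD D0.
exists 2%N, X; rewrite XD skew2_unit opprK; split=> //.
exists (TypeIII 1) => //; have [e1 e2] := @sign_matrix_III F 1.
have z m n := @sign_matrix0 F m n; have o := @sign_matrix1 F 2.
(* The nonzero pairings form a path: Q, then P, then Q. The permutation lists the four vectors along
   it. *)
apply: (congruent_sign (s := nth 0%N [:: 2; 0; 1; 3]) (c := fun=> 0%N)
  (sign_matrix_block4 (z _ _) o o (z _ _))
  (sign_matrix_block4 sign_matrix_skew2 (z _ _) (z _ _) (z _ _)) e1 e2) => //.
- by move=> [|[|[|[|//]]]].
- by move=> [|[|[|[|//]]]] [|[|[|[|//]]]].
- by move=> [|[|[|[|//]]]] [|[|[|[|//]]]] _ _; split.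
Qed.

Lemma square_sum_summands (ts : seq (summand F)) : exists n, exists A B : 'M_n,
  mxpair_sum [seq summand_pair t | t <- ts] = MxPair A B.
Proof. by apply: square_sum; case=> *; do 3 eexists. Qed.

Definition has_form n (A B : 'M[F]_n) :=
  exists ts, is_congruence_form (MxPair A B) ts.

Lemma peel_form n w u (A B : 'M[F]_n) (W : 'M_(w, n)) (U : 'M_(u, n)) t :
  (w + u)%N = n -> (1%:M <= W + U)%MS ->
  U *m A *m W^T = 0 /\ W *m A *m U^T = 0 ->
  U *m B *m W^T = 0 /\ W *m B *m U^T = 0 ->
  summand_valid t ->
  congruent (MxPair (W *m A *m W^T) (W *m B *m W^T)) (summand_pair t) ->
  has_form (U *m A *m U^T) (U *m B *m U^T) -> has_form A B.
Proof.
move=> e full [UA WA] [UB WB] vt ct [ts [vts cts]]; exists (t :: ts); split.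
  by rewrite /= vt.
apply: congruent_trans (congruent_split e full WA UA WB UB) _.
exact: congruent_add ct cts.
Qed.

(** Only one summand is extracted; the others are kept as an orthogonal complement, which is all
    that its prolongation asks for. *)
Lemma has_form_nonempty n (A B : 'M[F]_n) : (0 < n)%N -> has_form A B ->
  exists t, summand_valid t /\ exists n1, exists n2, exists A1 B1 : 'M_n1,
  exists U1 : 'M_(n1, n), exists U2 : 'M_(n2, n),
  [/\ summand_pair t = MxPair A1 B1, (n1 + n2)%N = n, (1%:M <= U1 + U2)%MS,
   [/\ U1 *m A *m U1^T = A1, U2 *m A *m U1^T = 0 & U1 *m A *m U2^T = 0] &
   [/\ U1 *m B *m U1^T = B1, U2 *m B *m U1^T = 0 & U1 *m B *m U2^T = 0]].
Proof.
move=> n0 [[|t ts] [vts cts]].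
  by have [/= e _] := congruent_frameP cts; lia.
case/andP: vts => vt _; exists t; split=> //.
have [n1 [A1 [B1 E1]]] : square (summand_pair t).
  by case: t {vt cts} => *; do 3 eexists.
have [n2 [A2 [B2 E2]]] := square_sum_summands ts.
move: cts; rewrite /= E1 E2 => /congruent_splitP [e [[U1 U2]]].
case=> full [a1 a2 a3 _] [b1 b2 b3 _].
by exists n1, n2, A1, B1, U1, U2.
Qed.

Lemma congruence_form_exists n (A B : 'M[F]_n) :
  A^T = A -> B^T = - B -> has_form A B.
Proof.
elim/ltn_ind: n => n IHn in A B * => sA sB.
case: (posnP n) => [n0|n0].
  by subst n; exists [::]; split=> //; rewrite (flatmx0 A) (flatmx0 B); apply: congruent_refl.
have sA1 : A^T = 1 *: A by rewrite scale1r.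
have sB1 : B^T = - 1 *: B by rewrite scaleN1r.
have sA2 : A^T = - - 1 *: A by rewrite opprK scale1r.
have peel w u (W : 'M_(w, n)) (U : 'M_(u, n)) :
    (0 < w)%N /\ (w + u)%N = n -> (1%:M <= W + U)%MS ->
    U *m A *m W^T = 0 /\ W *m A *m U^T = 0 ->
    U *m B *m W^T = 0 /\ W *m B *m U^T = 0 ->
    first_type (W *m A *m W^T) (W *m B *m W^T) -> has_form A B.
  move=> [w0 e] full hA hB [t vt ct]; apply: (peel_form e full hA hB vt ct).
  apply: IHn; first by lia.
    by rewrite (form_tr U U sA1) scale1r.
  by rewrite (form_tr U U sB1) scaleN1r.
case: (boolP (A \in unitmx)) => uA; last first.
  have [|w [u [W [U [e full hA hB T]]]]] := singular_split two_neq0 (mulr1 1)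
    first_type_zero first_type_kernel first_type_form sA1 sB1 uA; last exact: peel e full hA hB T.
  move=> m P Q /andP [m0 mn] sP sQ.
  have [|t [vt [n1 [n2 [A1 [B1 [U1 [U2 [E e full [a1 a2 a3] [b1 b2 b3]]]]]]]]]] :=
    @has_form_nonempty m P Q m0.
    by apply: IHn; rewrite // ?sP ?sQ ?scale1r ?scaleN1r.
  have [n' [A' [B' [E' n0' [s [C [t' [dC vt' ct']]]]]]]] := summand_ext_first two_neq0 vt.
  move: E'; rewrite E => E'; have en : n1 = n' by have := congr1 (@mxpair_rows F) E'.
  subst n'; have [eA eB] := MxPair_inj E'; subst A' B'.
  exists n1, n2, U1, U2; split=> //.
  exists s, C; rewrite a1 b1; split=> //.
  by exists t'.
case: (boolP (B \in unitmx)) => uB; last first.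
  (* Same splitting with B in the role of P and [eps] = -1; [second_type] swaps the pair back. *)
  have [|w [u [W [U [e full hB hA T]]]]] := singular_split two_neq0 (etrans (mulrNN 1 1) (mulr1 1))
    second_type_zero second_type_kernel second_type_form sB1 sA2 uB; last exact: peel e full hA hB T.
  move=> m P Q /andP [m0 mn] sP sQ.
  have [|t [vt [n1 [n2 [A1 [B1 [U1 [U2 [E e full [a1 a2 a3] [b1 b2 b3]]]]]]]]]] :=
    @has_form_nonempty m Q P m0.
    by apply: IHn; rewrite // ?sP ?sQ ?opprK ?scale1r ?scaleN1r.
  have [n' [A' [B' [E' n0' [s [C [t' [dC vt' ct']]]]]]]] := summand_ext_second two_neq0 vt.
  move: E'; rewrite E => E'; have en : n1 = n' by have := congr1 (@mxpair_rows F) E'.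
  subst n'; have [eA eB] := MxPair_inj E'; subst A' B'.
  exists n1, n2, U1, U2; split=> //.
  exists s, C; rewrite a1 b1; split=> //.
  by exists t'.
have [w [u [W [U [e full hB hA T]]]]] := regular_split two_neq0 n0 sA sB uA uB.
exact: peel e full hA hB T.
Qed.

End Existence.

Theorem theorem4p1 (F : closedFieldType) (charF : 2%N \notin [pchar F]) :
  (* (a) *)
  (forall (n : nat) (A B : 'M[F]_n), A^T = A -> B^T = - B ->
     exists2 ts : seq (summand F),
       is_congruence_form (MxPair A B) ts
       & forall ts' : seq (summand F),
           is_congruence_form (MxPair A B) ts' <-> same_summands ts ts')
  /\
  (* (b), first sentence *)
  (forall (n n' : nat) (A B : 'M[F]_n) (A' B' : 'M[F]_n')
          (ts ts' : seq (summand F)) (bs bs' : seq (kron_block F)),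
     A^T = A -> B^T = - B -> A'^T = A' -> B'^T = - B' ->
     is_congruence_form (MxPair A B) ts ->
     is_congruence_form (MxPair A' B') ts' ->
     is_kronecker_form (MxPair A B) bs ->
     is_kronecker_form (MxPair A' B') bs' ->
     perm_eq bs bs' -> same_summands ts ts')
  /\
  (* (b), Kronecker canonical forms of the summands *)
  [/\ forall (k : nat) (l : F), summand_valid (TypeI k l) ->
        is_kronecker_form (summand_pair (TypeI k l))
          [:: KronFinite k l; KronFinite k (- l)],
      (forall k : nat, summand_valid (@TypeII F (2 * k + 1) false) ->
        is_kronecker_form (summand_pair (@TypeII F (2 * k + 1) false))
          [:: KronWide k; KronTall k]) /\
      (forall k : nat, summand_valid (@TypeII F (2 * k) false) ->
        odd k /\
        is_kronecker_form (summand_pair (@TypeII F (2 * k) false))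
          [:: KronInfinite k; KronInfinite k]),
      (forall n : nat, summand_valid (@TypeII F n true) -> odd n ->
        is_kronecker_form (summand_pair (@TypeII F n true))
          [:: KronFinite n 0]) /\
      (forall n : nat, summand_valid (@TypeII F n true) -> ~~ odd n ->
        is_kronecker_form (summand_pair (@TypeII F n true))
          [:: KronInfinite n])
    & forall k : nat, summand_valid (@TypeIII F k) ->
        is_kronecker_form (summand_pair (@TypeIII F k))
          [:: KronFinite (2 * k) 0; KronFinite (2 * k) 0]].
Proof.
have two_neq0 : 1 + 1 != 0 :> F.
  by move: charF; rewrite inE /= mulr2n.
split.
  move=> n A B sA sB; have [ts fts] := congruence_form_exists two_neq0 sA sB.
  exists ts => // ts'; split=> [fts'|].
    exact: (kron_unique two_neq0 fts fts').
  exact: same_summands_congruent fts.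
split.
  move=> n n' A B A' B' ts ts' bs bs' _ _ _ _ fts fts' kbs kbs' pb.
  apply: (kron_unique two_neq0 fts fts') => k l P Q.
  by rewrite (pencil_dim_kron P Q kbs) (pencil_dim_kron P Q kbs') (perm_big _ pb).
split; [|split|split|].
- by move=> k l vt; apply: (summand_kron two_neq0 vt).
- by move=> k vt; apply: kron_typeII_wide.
- move=> k /= /andP [k0 v]; split; first by move: v; lia.
  by apply: kron_typeII_inf2; lia.
- by move=> n vt on; apply: kron_typeII_fin.
- by move=> n /andP [n0 _] on; apply: kron_typeII_inf.
- by move=> k vt; apply: kron_typeIII.
Qed.
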